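(* Let $a(x)\in\mathbf{U}$ have the canonical decomposition $a(x)=cx+r(x)$ with $c\ne 0$. If either $r(x)\succ \log^{2+\epsilon}x$ for some $\epsilon>0$ (i.e. $\lim_{x\to\infty}r(x)/(\log x)^{2+\epsilon}=\pm\infty$), or $c=\frac1m$ for some $m\in\mathbb{Z}$, then $(\lfloor a(n)\rfloor)_{n\in\mathbb{N}}$ is pointwise $L^2$-good: for every invertible probability measure preserving system $(X,\mathcal{B},\mu,T)$ and every $f\in L^2(\mu)$, the averages $$\frac1N\sum_{n=1}^N f(T^{\lfloor a(n)\rfloor}x)$$ converge as $N\to\infty$ for $\mu$-almost every $x\in X$.
   Context: Let $\mathbf{B}$ be the ring of germs at $+\infty$ of continuous real functions on $\mathbb{R}$. A Hardy field is a subfield of $\mathbf{B}$ closed under differentiation, and $\mathbf{U}$ is the union of all Hardy fields. Since these are germs, finitely many values of $n$ are irrelevant. Write $u_1\prec u_2$ if $\lim_{x\to\infty}u_1(x)/u_2(x)=0$. A function $u\in\mathbf{U}$ is subpolynomial if there are $n\in\mathbb{N}$ and $C>0$ with $|u(x)|\le Cx^n$ for all large $x$. A function $r$ in a Hardy field is called non-polynomial if it is subpolynomial and for every $k\in\mathbb{N}\cup\{0\}$ either $r(x)\prec x^k$ or $x^k\prec r(x)$. Every subpolynomial $a\in\mathbf{U}$ has a canonical decomposition $a(x)=p(x)+r(x)$, where $p$ is a real polynomial, $r$ is non-polynomial, and $r(x)\prec x^s$ for each nonzero term $c_sx^s$ of $p(x)$. In the present statement $p(x)=cx$, so in particular $r(x)\prec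 x$. *)

(* Defs.v *)
From HB Require Import structures.
From mathcomp Require Import all_boot all_order all_algebra.
From mathcomp Require Import all_classical all_reals all_analysis.
Import Order.TTheory GRing.Theory Num.Theory.
Import numFieldNormedType.Exports.

Set Implicit Arguments.
Unset Strict Implicit.
Unset Printing Implicit Defensive.

Local Open Scope classical_set_scope.
Local Open Scope ring_scope.

(* A germ at +oo is represented by any function R -> R in its class, and a set
   of germs by the set of all representatives of its elements. *)
Definition germ_eq (R : realType) (f g : R -> R) : Prop :=
  \forall x \near +oo, f x = g x.

Definition continuous_germ (R : realType) (f : R -> R) : Prop :=
  exists2 g : R -> R, continuous g & germ_eq f g.

(* [hardy_inv] asks for an inverse of every nonzero germ: this is stronger than
   f being merely nonzero somewhere near +oo, as g must satisfy f * g = 1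
   eventually. *)
Record hardy_field (R : realType) (H : set (R -> R)) : Prop := HardyField {
  hardy_germ : forall f g, germ_eq f g -> H f -> H g ;
  hardy_cont : forall f, H f -> continuous_germ f ;
  hardy_one : H (fun=> 1) ;
  hardy_sub : forall f g, H f -> H g -> H (fun x => f x - g x) ;
  hardy_mul : forall f g, H f -> H g -> H (fun x => f x * g x) ;
  hardy_inv : forall f, H f -> ~ germ_eq f (fun=> 0) ->
    exists2 g, H g & germ_eq (fun x => f x * g x) (fun=> 1) ;
  hardy_deriv : forall f, H f ->
    exists2 g, H g & \forall x \near +oo, is_derive (x : R) (1 : R) f (g x)
}.

Definition U (R : realType) : set (R -> R) :=
  [set f | exists2 H, hardy_field H & H f].

(* The first conjunct is needed because x / 0 = 0 in MathComp: without it
   every u1 would satisfy u1 < 0. *)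
Definition prec (R : realType) (u1 u2 : R -> R) : Prop :=
  (\forall x \near +oo, u2 x != 0) /\
  (u1 x / u2 x @[x --> +oo] --> (0 : R)).

Definition subpolynomial (R : realType) (u : R -> R) : Prop :=
  exists (n : nat) (C : R),
    0 < C /\ \forall x \near +oo, `|u x| <= C * x ^+ n.

Definition nonpolynomial (R : realType) (r : R -> R) : Prop :=
  [/\ U r, subpolynomial r &
      forall k : nat, prec r (fun x => x ^+ k) \/ prec (fun x => x ^+ k) r].

Definition canonical_decomposition (R : realType) (a : R -> R) (p : {poly R})
    (r : R -> R) : Prop :=
  [/\ germ_eq a (fun x => p.[x] + r x), nonpolynomial r &
      forall s : nat, p`_s != 0 -> prec r (fun x => x ^+ s)].

Definition invertible_measure_preserving (R : realType) (d : measure_display)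
    (X : measurableType d) (mu : probability X R) (T Tinv : X -> X) : Prop :=
  [/\ cancel T Tinv, cancel Tinv T,
      measurable_fun [set: X] T, measurable_fun [set: X] Tinv &
      forall A : set X, measurable A -> mu (T @^-1` A) = mu A].

(* T ^ k for k : int; [Negz n] is - (n + 1). *)
Definition iterz (X : Type) (T Tinv : X -> X) (k : int) : X -> X :=
  match k with
  | Posz n => iter n T
  | Negz n => iter n.+1 Tinv
  end.

Definition ergodic_average (R : realType) (X : Type) (T Tinv : X -> X)
    (b : nat -> int) (f : X -> R) (x : X) (N : nat) : R :=
  N%:R^-1 * \sum_(1 <= n < N.+1) f (iterz T Tinv (b n) x).

Definition pointwise_L2_good (R : realType) (b : nat -> int) : Prop :=
  forall (d : measure_display) (X : measurableType d) (mu : probability X R)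
    (T Tinv : X -> X) (f : X -> R),
  invertible_measure_preserving mu T Tinv ->
  f \in Lfun mu 2%:E ->
  {ae mu, forall x : X, cvgn (ergodic_average T Tinv b f x)}.

(* Main.v *)
Require Import Defs.
From mathcomp Require Import all_boot all_order all_algebra.
From mathcomp Require Import all_classical all_reals all_analysis.
From mathcomp Require Import measurable_realfun ring lra zify.
Import Order.TTheory GRing.Theory Num.Theory.
Import numFieldNormedType.Exports.

(* Replacing T by its inverse if c < 0, and f by its positive and negative parts,
   let c > 0 and f >= 0.  If y_k denotes the solution of a(y_k) = k, then
   floor(a(n)) = k exactly for nu_k <= n < nu_{k+1}, with nu_k the ceiling of y_k,
   so the averages in question are, up to the factor c, averages of f(T^k x) with
   weights w_k = nu_{k+1} - nu_k.

   If c = 1/m, then w_k = m except on a set of density zero, because r is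
   eventually monotone and o(x); the exceptional terms vanish by Cauchy-Schwarz and
   Birkhoff's theorem for f^2.

   Otherwise w_k = (y_{k+1} - y_k) + h_{k+1} - h_k, where h_k = nu_k - y_k is a
   sawtooth function of y_k.  The gaps tend to 1/c.  As f >= 0, the sawtooth may be
   sandwiched between trigonometric polynomials in y_k, so it suffices that the
   averages of cos(b y_k) f(T^k x) and sin(b y_k) f(T^k x) tend to 0 for b <> 0.
   Their L^2 norm is at most the supremum over t of the exponential sums with
   phase b y_k + k t, which by van der Corput's second derivative test is
   O(|r''(N)|^(-1/2) / N).  In a Hardy field the growth of r forces
   |r''(x)| >= C (log x)^(1+d) / x^2, so the squared norms are summable along
   geometric progressions; Birkhoff's theorem fills the gaps. *)

Set Implicit Arguments.
Unset Strict Implicit.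
Unset Printing Implicit Defensive.

Local Open Scope classical_set_scope.
Local Open Scope ring_scope.

(** * Trigonometric sums *)

Section trigonometric_sums.
Context {R : realType}.
Implicit Types (x y t u v : R) (b k s : nat -> R).

(** The exponent [2 + eps] is what the method can just afford. At time [N] the squared norm is of
    order [1 / (N^2 |r''(N)|)], and along a geometric progression [log N] grows linearly, so
    summability asks for [N^2 |r''(N)| >= C (log N)^(1 + d)]; for [r = (log x)^(2 + eps)] the left
    side is of order [(log N)^(1 + eps)]. The obstacle is to get this from the mere size of [r]:
    growth alone says nothing about derivatives, and the Hardy field at hand may contain neither [x]
    nor [log x]. The tool is that elements of the field have eventual signs, which become bounds by
    integrating differential inequalities. The supremum over [t] controls the [L^2] norm through a
    discrete Fourier transform on long orbit segments, in place of the spectral theorem, so all sums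
    stay real and finite. Only convergence is asserted, so Birkhoff's theorem is proved without
    identifying the limit. *)

Lemma derive_le_increment (f df g dg : R -> R) (x0 x y : R) :
  (forall z, x0 <= z -> is_derive z (1 : R) f (df z)) ->
  (forall z, x0 <= z -> is_derive z (1 : R) g (dg z)) ->
  (forall z, x0 <= z -> df z <= dg z) ->
  x0 <= x -> x <= y -> f y - f x <= g y - g x.
Proof.
move=> Df Dg le_d x0x; rewrite le_eqVlt => /orP[/eqP->|xy]; first by rewrite !subrr.
have D z : x0 <= z -> is_derive z (1 : R) (g - f) (dg z - df z).
  by move=> z0; have ? := Df _ z0; have ? := Dg _ z0; exact: is_deriveB.
have [||z] := @MVT R (g - f) (fun z => dg z - df z) x y xy.
- by move=> z /[!in_itv]/= /andP[xz _]; apply: D; lra.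
- apply: derivable_within_continuous => z /[!in_itv]/= /andP[xz _].
  by apply: (@ex_derive _ _ _ _ _ _ _ (D z _)); lra.
rewrite in_itv/= => /andP[xz zy]; rewrite !fctE => e.
have : 0 <= (dg z - df z) * (y - x).
  by rewrite mulr_ge0// subr_ge0 ?le_d ?(ltW xy)//; lra.
by rewrite -e; lra.
Qed.

Lemma sin_le_id u : 0 <= u -> sin u <= u.
Proof.
move=> u0; have := @derive_le_increment sin cos id (cst 1) 0 0 u.
rewrite sin0 !subr0; apply => //.
by move=> z _; exact: cos_le1.
Qed.

(** By [1 - cos u = 2 sin^2 (u / 2)] this is [|sin w| <= |w|] at [w = u / 2]. Integrated, it yields
    the cubic bound below, which serves to get an explicit linear lower bound for the sine on an
    interval reaching past [pi / 2]. *)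
Lemma cos_ge_parabola u : 1 - u ^+ 2 / 2 <= cos u.
Proof.
have -> : cos u = 1 - 2 * sin (u / 2) ^+ 2.
  have {1}-> : u = u / 2 + u / 2 by lra.
  by rewrite cosD -!expr2 sin2cos2; ring.
have {1}-> : u = 2 * (u / 2) by lra.
have H v : 0 <= v -> sin v ^+ 2 <= v ^+ 2.
  move=> v0; have [s0|s0] := leP 0 (sin v).
    by rewrite lerXn2r// ?nnegrE//; exact: sin_le_id.
  have -> : sin v ^+ 2 = (- sin v) ^+ 2 by ring.
  have [v1|v1] := leP v 1.
    suff : 0 <= sin v by lra.
    by rewrite sin_ge0_pi// v0/=; have := @pi_ge2 R; lra.
  by rewrite lerXn2r// ?nnegrE//; have := sin_geN1 v; lra.
set w := u / 2; suff : sin w ^+ 2 <= w ^+ 2 by lra.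
have [w0|w0] := leP 0 w; first exact: H.
by have := H (- w); rewrite sinN !sqrrN; apply; lra.
Qed.

Lemma sin_ge_cubic u : 0 <= u -> u - u ^+ 3 / 6 <= sin u.
Proof.
move=> u0; have := @derive_le_increment (fun u => u - u ^+ 3 / 6)
  (fun u => 1 - u ^+ 2 / 2) sin cos 0 0 u.
rewrite sin0 expr0n/= mul0r !subr0; apply => //.
- move=> z _; apply: is_derive_eq.
  by rewrite /GRing.scale/=; field.
- by move=> z _; exact: cos_ge_parabola.
Qed.

(* [22 / 5] leaves a margin above [pi], for which the library only provides
   [pi < 4]. *)
Lemma sin_lower u : 0 <= u -> u <= 11 / 5 -> u / 6 <= sin u.
Proof.
by move=> u0 u1; apply: le_trans (sin_ge_cubic u0); nra.
Qed.

(** Summation by parts: as [k] is monotone, its total variation is [k 0 - k n <= 2 B], and the two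
    boundary terms add another [2 B]. *)
Lemma abel_sum_nonincr k s n B :
  (forall i, (i < n)%N -> k i.+1 <= k i) ->
  (forall i, (i <= n)%N -> `|k i| <= B) -> (forall i, `|s i| <= 1) ->
  `|\sum_(i < n.+1) k i * (s i.+1 - s i)| <= 4 * B.
Proof.
move=> kn kB s1.
have H m : (m <= n)%N ->
    `|\sum_(i < m.+1) k i * (s i.+1 - s i) - k m * s m.+1| <= B + (k 0%N - k m).
  elim: m => [_|m IH mn].
    rewrite big_ord_recl big_ord0 subrr !addr0.
    rewrite (_ : _ - _ = - (k 0%N * s 0%N)); last by rewrite /=; ring.
    rewrite normrN normrM (le_trans _ (kB 0%N _))// ler_piMr//.
  have h := IH (ltnW mn); rewrite big_ord_recr/=; move: h.
  set S := \sum_(i < m.+1) _ => h.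
  rewrite (_ : S + k m.+1 * (s m.+2 - s m.+1) - k m.+1 * s m.+2 =
    S - k m * s m.+1 + (k m - k m.+1) * s m.+1); last by ring.
  apply: (le_trans (ler_normD _ _)).
  have : `|(k m - k m.+1) * s m.+1| <= k m - k m.+1.
    by rewrite normrM ger0_norm ?subr_ge0 ?kn// ler_piMr// subr_ge0 kn.
  by lra.
have := H n (leqnn n); set S := \sum_(_ < _) _ => h.
have ks : `|k n * s n.+1| <= B.
  by rewrite normrM (le_trans _ (kB n _))// ler_piMr.
have := kB 0%N isT; have := kB n (leqnn n).
have := ler_normD (S - k n * s n.+1) (k n * s n.+1).
rewrite subrK.
have := ler_norm (k 0%N); have := ler_norm (- k n); rewrite normrN.
by lra.
Qed.

(* [cos b + cos (b + a) = cot (a / 2) * (sin (b + a) - sin b)]. *)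
Lemma kusmin_landau b n B :
  let a i := b i.+1 - b i in
  (forall i, (i < n)%N -> 1 <= B * `|sin (a i / 2)|) ->
  (forall i, (i.+1 < n)%N -> 0 <= sin (a i / 2) * sin (a i.+1 / 2)) ->
  (forall i, (i.+1 < n)%N -> a i <= a i.+1 <= a i + 22 / 5) -> 0 <= B ->
  `|\sum_(i < n) (cos (b i) + cos (b i.+1))| <= 4 * B.
Proof.
case: n => [|n] a aB sa am B0; first by rewrite big_ord0 normr0 mulr_ge0.
have s_neq0 i : (i < n.+1)%N -> sin (a i / 2) != 0.
  by move=> /aB; apply: contraTneq => ->; rewrite normr0 mulr0 ler10.
pose k i := cos (a i / 2) / sin (a i / 2).
rewrite (eq_bigr (fun i : 'I_n.+1 => k i * (sin (b i.+1) - sin (b i)))); last first.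
  move=> i _; have s0 := s_neq0 i (ltn_ord i).
  have [m e1 e2] : exists2 m, b i = m - a i / 2 & b i.+1 = m + a i / 2.
    by exists ((b i + b i.+1) / 2); rewrite /a; lra.
  rewrite /k e1 e2; move: (a i / 2) s0 => h s0.
  by rewrite cosB sinB cosD sinD; field.
apply: (@abel_sum_nonincr k (fun i => sin (b i))) => [i|i|i]; last exact: sin_max.
- move=> ni; have s0 := s_neq0 i (ltnW ni : (i < n.+1)%N).
  have s1 := s_neq0 i.+1 ni.
  (* The cotangent decreases: [cot u - cot v = sin (v - u) / (sin u sin v)], where the two sines
     have the same sign and [v - u] is at most [11 / 5]. *)
  rewrite -subr_ge0 /k.
  have -> : cos (a i / 2) / sin (a i / 2) - cos (a i.+1 / 2) / sin (a i.+1 / 2) =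
     sin (a i.+1 / 2 - a i / 2) / (sin (a i / 2) * sin (a i.+1 / 2)).
    by rewrite sinB; field; apply/andP.
  have /andP[am1 am2] := am i ni.
  rewrite divr_ge0 ?sa//.
  by apply: le_trans (sin_lower _ _); lra.
- move=> ni; rewrite /k normrM normfV.
  have s0 := s_neq0 i ni; rewrite ler_pdivrMr ?normr_gt0//.
  exact: le_trans (cos_max _) (aB _ ni).
Qed.

Lemma monotone_threshold a n t : (forall i, (i.+1 < n)%N -> a i <= a i.+1) ->
  exists m, [/\ (m <= n)%N, forall i, (i < m)%N -> a i < t &
    forall i, (m <= i < n)%N -> t <= a i].
Proof.
elim: n => [|n IH] am; first by exists 0%N; split => // i; rewrite ltn0 andbF.
have [|m [mn h1 h2]] := IH; first by move=> i ni; apply: am; exact: ltnW.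
have [/eqP e|ne] := eqVneq m n; last first.
  have mltn : (m < n)%N by rewrite ltn_neqAle ne.
  exists m; split => //; first exact: leqW.
  move=> i /andP[mi]; rewrite ltnS leq_eqVlt => /orP[/eqP->|ni]; last first.
    by apply: h2; rewrite mi.
  case: n mn ne mltn h2 am {IH} => // n _ _ mltn h2 am.
  by apply: le_trans (am n _) => //; apply: h2; rewrite -ltnS mltn/=.
have [tn|tn] := leP t (a n).
  exists m; split => //; first exact: leqW.
  move=> i; rewrite ltnS (eqP e) => /anti_leq <-//.
exists n.+1; split => // i.
  by rewrite ltnS leq_eqVlt => /orP[/eqP->//|]; rewrite -(eqP e); exact: h1.
by move/andP => [h /(leq_trans h)]; rewrite ltnn.
Qed.

(* Van der Corput's second derivative test: the increments of the phase spend
   at most [O(1 / delta)] steps in the resonant window [-delta, delta], and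
   Kusmin-Landau applies on both sides of it. *)
Lemma second_derivative_test b n d :
  let a i := b i.+1 - b i in
  0 < d -> (forall i, (i < n)%N -> `|a i| <= 22 / 5) ->
  (forall i, (i.+1 < n)%N -> a i <= a i.+1) ->
  (forall i, (i.+2 < n)%N -> a i + d ^+ 2 <= a i.+2) ->
  `|\sum_(i < n) cos (b i)| <= 60 / d + 4.
Proof.
move=> a d0 ab am a2; have di : 0 <= d^-1 by rewrite invr_ge0 ltW.
have am_le i j : (i <= j)%N -> (j < n)%N -> a i <= a j.
  move=> ij; elim: j ij => [|j IH]; first by rewrite leqn0 => /eqP->.
  rewrite leq_eqVlt => /orP[/eqP->//|ij jn].
  by apply: le_trans (am _ jn); apply: IH => //; exact: ltnW.
have [m1 [m1n l1 u1]] := @monotone_threshold a n (- d) am.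
have [m2 [m2n l2 u2]] := @monotone_threshold a n d am.
have m12 : (m1 <= m2)%N.
  rewrite leqNgt; apply/negP => m21.
  have := l1 _ m21; have := u2 m2; rewrite leqnn (leq_trans m21)// => /(_ isT).
  by lra.
(* The constant is [sin_lower] at [|t| / 2], which gives [sin (|t| / 2) >= |t| / 12 >= d / 12]. *)
have sinb t : d <= `|t| -> `|t| <= 22 / 5 -> 1 <= 12 / d * `|sin (t / 2)|.
  move=> dt tb; have -> : `|sin (t / 2)| = `|sin (`|t| / 2)|.
    have [t0|t0] := leP 0 t; first by rewrite (ger0_norm t0).
    by rewrite (ltr0_norm t0) mulNr sinN normrN.
  have h : `|t| / 2 / 6 <= sin (`|t| / 2) by apply: sin_lower; lra.
  rewrite mulrAC ler_pdivlMr// mul1r (le_trans dt)//.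
  by have := ler_norm (sin (`|t| / 2)); lra.
have KL p q (e : bool) : (p <= q)%N -> (q <= n)%N ->
    (forall i, (p <= i < q)%N -> if e then a i <= - d else d <= a i) ->
    `|\sum_(p <= i < q) (cos (b i) + cos (b i.+1))| <= 4 * (12 / d).
  move=> pq qn he; rewrite -{1}[p]add0n big_addn big_mkord.
  under eq_bigr do rewrite -addSn ![(_ + p)%N]addnC.
  have inq i : (i < q - p)%N -> (p <= p + i < q)%N by lia.
  have absd i : (i < q - p)%N -> d <= `|a (p + i)%N|.
    move=> /inq /he; have := ler_norm (a (p + i)%N).
    by have := ler_norm (- a (p + i)%N); rewrite normrN; case: (e); lra.
  apply: (@kusmin_landau (fun i => b (p + i)%N)) => [i iqp|i iqp|i iqp|].
  - rewrite addnS; apply: sinb; first exact: absd.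
    by apply: ab; have := inq _ iqp; lia.
  - have pos j : (j < q - p)%N -> 0 <= (if e then - sin (a (p + j)%N / 2)
                                             else sin (a (p + j)%N / 2)).
      move=> jqp; have := he _ (inq _ jqp); have := inq _ jqp => jq.
      have := ab (p + j)%N ltac:(lia); rewrite ler_norml => /andP[b1 b2].
      case: (e) => h.
        by rewrite -sinN; apply: le_trans (sin_lower _ _); lra.
      by apply: le_trans (sin_lower _ _); lra.
    rewrite !addnS; have := pos i (ltnW iqp); have := pos _ iqp; rewrite addnS.
    by case: (e); rewrite /a; nra.
  - rewrite !addnS.
    have := he _ (inq _ iqp); have := he _ (inq _ (ltnW iqp)).
    have := ab (p + i)%N ltac:(have := inq _ iqp; lia).
    have := ab (p + i.+1)%N ltac:(have := inq _ iqp; lia).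
    have := am (p + i)%N ltac:(have := inq _ iqp; lia).
    rewrite addnS /a !ler_norml => h /andP[? ?] /andP[? ?].
    by case: (e) => *; apply/andP; split; lra.
  - by rewrite divr_ge0// ltW.
(* Every two steps raise the increment by [d ^ 2], and the window has width [2 d], so it holds at
   most about [2 / d] pairs of steps. *)
have mid : (m2 - m1)%:R <= 4 / d + 2 :> R.
  have step j : (m1 + j.*2 < m2)%N -> a m1 + d ^+ 2 * j%:R <= a (m1 + j.*2)%N.
    elim: j => [|j IH] jm; first by rewrite mulr0 addr0 addn0.
    have := IH ltac:(lia); have := a2 (m1 + j.*2)%N ltac:(lia).
    by rewrite doubleS !addnS -natr1; lra.
  have [e|e] := leqP (m2 - m1)%N 0.
    have -> : (m2 - m1 = 0)%N by lia.
    by rewrite addr_ge0// divr_ge0// ltW.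
  pose j := (m2 - m1).-1./2.
  have jm : (m1 + j.*2 < m2)%N by rewrite /j; lia.
  have := step _ jm; have := l2 _ jm; have := u1 m1 ltac:(lia) => h1 h2 h3.
  have : d * j%:R <= 2.
    have : d * (d * j%:R) < d * 2 by rewrite mulrA -expr2; lra.
    by rewrite ltr_pM2l// => /ltW.
  move=> dj; have : j%:R <= 2 / d by rewrite ler_pdivlMr// mulrC.
  have : (m2 - m1)%:R <= 2 * j%:R + 2 :> R.
    by rewrite -(natrM _ 2) -(natrD _ _ 2) ler_nat /j; lia.
  by lra.
have tot : `|\sum_(0 <= i < n) (cos (b i) + cos (b i.+1))| <= 112 / d + 4.
  rewrite (big_cat_nat (n := m1))//= (big_cat_nat (m := m1) (n := m2))//=.
  have h1 : `|\sum_(0 <= i < m1) (cos (b i) + cos (b i.+1))| <= 4 * (12 / d).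
    by apply: (@KL _ _ true) => // i /= im; exact/ltW/l1.
  have h3 : `|\sum_(m2 <= i < n) (cos (b i) + cos (b i.+1))| <= 4 * (12 / d).
    by apply: (@KL _ _ false).
  have h2 : `|\sum_(m1 <= i < m2) (cos (b i) + cos (b i.+1))| <= 2 * (4 / d + 2).
    apply: le_trans (ler_norm_sum _ _ _) _.
    apply: (@le_trans _ _ (\sum_(m1 <= i < m2) 2)).
      apply: ler_sum => i _; apply: le_trans (ler_normD _ _) _.
      by have := cos_max (b i); have := cos_max (b i.+1); lra.
    by rewrite sumr_const_nat -mulr_natr; lra.
  apply: le_trans (ler_normD _ _) _.
  have := ler_normD (\sum_(m1 <= i < m2) (cos (b i) + cos (b i.+1)))
    (\sum_(m2 <= i < n) (cos (b i) + cos (b i.+1))).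
  by lra.
(* Pairing neighbours counts every cosine twice up to the two ends, so the bound is halved at the
   cost of a boundary term. *)
have -> : \sum_(i < n) cos (b i) = (\sum_(0 <= i < n) (cos (b i) + cos (b i.+1))
    + (cos (b 0%N) - cos (b n))) / 2.
  have := telescope_sumr (fun i => cos (b i)) (leq0n n).
  rewrite sumrB big_split/= -(big_mkord xpredT (fun i => cos (b i))).
  by lra.
have : `|cos (b 0%N) - cos (b n)| <= 2.
  apply: le_trans (ler_normB _ _) _.
  by have := cos_max (b 0%N); have := cos_max (b n); lra.
rewrite normrM (ger0_norm (_ : 0 <= 2^-1 :> R)) ?invr_ge0//.
have := ler_normD (\sum_(0 <= i < n) (cos (b i) + cos (b i.+1))) (cos (b 0%N) - cos (b n)).
by lra.
Qed.
End trigonometric_sums.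

(** * Finite Fourier analysis *)

Section finite_fourier.
Context {R : realType}.
Implicit Types (x h b t B : R) (g u v w : nat -> R).

Lemma cosD2piz x (z : int) : cos (x + z%:~R * (2 * pi)) = cos x.
Proof.
have cosn n y : cos (y + n%:R * (2 * pi)) = cos y :> R.
  have := periodicn (@cosD2pi R) n y.
  by have -> : pi *+ 2 *+ n = n%:R * (2 * pi) :> R by rewrite !mulr_natl.
case: z => n; first exact: cosn.
by rewrite -(cosn n.+1 (x + _)) NegzE mulrNz mulNr -pmulrn subrK.
Qed.

Lemma sinD2piz x (z : int) : sin (x + z%:~R * (2 * pi)) = sin x.
Proof. by rewrite -!cosBpihalf addrAC cosD2piz. Qed.

Lemma dirichlet_kernel b h n :
  2 * sin (h / 2) * \sum_(i < n) cos (b + i%:R * h) =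
  sin (b + n%:R * h - h / 2) - sin (b - h / 2).
Proof.
elim: n => [|n IH]; first by rewrite big_ord0 mulr0 mul0r addr0 subrr.
rewrite big_ord_recr/= mulrDr IH.
have -> : b + n.+1%:R * h - h / 2 = (b + n%:R * h) + h / 2.
  by rewrite -[n.+1%:R]natr1; lra.
by rewrite [sin (b + n%:R * h - _)]sinB [sin (b + n%:R * h + _)]sinD; ring.
Qed.

Lemma sin_rational_neq0 (M : nat) (d : int) : (0 < `|d|%N < M)%N ->
  sin (2 * pi * d%:~R / M%:R / 2) != 0 :> R.
Proof.
move=> /andP[d0 dM]; have M0 : (0 < M%:R :> R) by rewrite ltr0n; lia.
have pos n : (0 < n < M)%N -> 0 < sin (2 * pi * n%:R / M%:R / 2) :> R.
  move=> /andP[n0 nM]; apply: sin_gt0_pi.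
  have -> : 2 * pi * n%:R / M%:R / 2 = pi * (n%:R / M%:R) :> R by field; lra.
  apply/andP; split; first by rewrite mulr_gt0 ?pi_gt0// divr_gt0// ltr0n.
  by rewrite gtr_pMr ?pi_gt0// ltr_pdivrMr// mul1r ltr_nat.
case: d d0 dM => k k0 kM; first by apply: lt0r_neq0; apply: pos; lia.
rewrite NegzE mulrNz mulrN !mulNr sinN oppr_eq0 -pmulrn.
by apply: lt0r_neq0; apply: pos; lia.
Qed.

(** After [M] steps of [2 pi d / M] the angle has made [d] full turns, so the right side of
    [dirichlet_kernel] vanishes; the bound on [|d|] keeps the factor [sin (h / 2)] nonzero. *)
Lemma sum_cos_eq0 b (M : nat) (d : int) : (0 < `|d|%N < M)%N ->
  \sum_(i < M) cos (b + i%:R * (2 * pi * d%:~R / M%:R)) = 0 :> R.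
Proof.
move=> dM; have M0 : (M%:R != 0 :> R) by rewrite pnatr_eq0; lia.
have s0 := sin_rational_neq0 dM.
apply: (mulfI (mulf_neq0 (_ : 2 != 0) s0)); first by rewrite pnatr_eq0.
rewrite dirichlet_kernel mulr0; apply/eqP; rewrite subr_eq0; apply/eqP.
rewrite -(sinD2piz (b - _) d); congr sin; field; exact: M0.
Qed.

(** Expanding the squares leaves cosines of [(m - l) th t]; for [m <> l] they sum to zero over [t],
    because [|m - l| < P]. *)
Lemma parseval w (P : nat) : (0 < P)%N ->
  let th (t : nat) := 2 * pi * t%:R / P%:R in
  \sum_(t < P) ((\sum_(m < P) w m * cos (m%:R * th t)) ^+ 2 +
                (\sum_(m < P) w m * sin (m%:R * th t)) ^+ 2) =
  P%:R * \sum_(m < P) w m ^+ 2.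
Proof.
move=> P0 th.
have E (t : 'I_P) : (\sum_(m < P) w m * cos (m%:R * th t)) ^+ 2 +
                (\sum_(m < P) w m * sin (m%:R * th t)) ^+ 2 =
   \sum_(m < P) \sum_(l < P) w m * w l * cos ((m%:R - l%:R) * th t).
  rewrite !expr2 !mulr_suml -big_split/=; apply: eq_bigr => m _.
  rewrite !mulr_sumr -big_split/=; apply: eq_bigr => l _.
  by rewrite mulrBl cosB; ring.
under eq_bigr do rewrite E.
rewrite exchange_big/= mulr_sumr; apply: eq_bigr => m _.
rewrite exchange_big/= (bigD1 m)//= [X in _ + X]big1 ?addr0; last first.
  move=> l lm; rewrite -mulr_sumr.
  under eq_bigr => t _.
    have -> : (m%:R - l%:R) * th t =
      0 + t%:R * (2 * pi * (m%:Z - l%:Z)%:~R / P%:R).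
      by rewrite /th rmorphB/= -!pmulrn; field; rewrite pnatr_eq0 -lt0n.
    over.
  rewrite sum_cos_eq0 ?mulr0//.
  have : (l : nat) != m by [].
  by have := ltn_ord m; have := ltn_ord l; lia.
under eq_bigr do rewrite subrr mul0r cos0 mulr1.
by rewrite sumr_const card_ord expr2 mulr_natl.
Qed.

Lemma sum_nat_shift (F : nat -> R) p q :
  \sum_(p <= i < q + p) F i = \sum_(m < q) F (m + p)%N.
Proof. by rewrite -{1}[p]add0n big_addn addnK big_mkord. Qed.

(* The quadratic form on the left is a convolution; extending [u] by zero, its
   discrete Fourier transform factors. *)
Lemma transference g K B :
  (forall t, (\sum_(k < K) g k * cos (k%:R * t)) ^+ 2 +
             (\sum_(k < K) g k * sin (k%:R * t)) ^+ 2 <= B) ->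
  forall u M, \sum_(m < M) (\sum_(k < K) g k * u (m + k)%N) ^+ 2 <=
    B * \sum_(i < M + K) u i ^+ 2.
Proof.
move=> gB u M; have [->|M0] := posnP M.
  rewrite big_ord0 mulr_ge0 ?sumr_ge0//; last by move=> i _; exact: sqr_ge0.
  by apply: le_trans (gB 0); rewrite addr_ge0 ?sqr_ge0.
(* Length of a cyclic model. The first [K] entries of [v] are zeros, so a shift by [k < K] moves
   only zeros across the ends and nothing wraps around. *)
pose P := (M + K + K)%N; have P0 : (0 < P)%N by rewrite /P; lia.
pose v i := if (K <= i < P)%N then u (i - K)%N else 0.
pose w m := \sum_(k < K) g k * v (m + k)%N.
have lw : \sum_(m < M) (\sum_(k < K) g k * u (m + k)%N) ^+ 2 <=
    \sum_(m < P) w m ^+ 2.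
  rewrite -(big_mkord xpredT (fun m => w m ^+ 2)) (big_cat_nat (n := K))//=; last first.
    by rewrite /P; lia.
  rewrite (big_cat_nat (m := K) (n := (M + K)%N))//=; [|lia|rewrite /P; lia].
  rewrite sum_nat_shift.
  rewrite (eq_bigr (fun m : 'I_M => w (m + K)%N ^+ 2)); last first.
    move=> m _; congr (_ ^+ 2); apply: eq_bigr => k _; congr (_ * _).
    rewrite /v ifT; last by have := ltn_ord k; have := ltn_ord m; rewrite /P; lia.
    by congr u; lia.
  rewrite addrCA lerDl addr_ge0// sumr_ge0// => i _; exact: sqr_ge0.
apply: le_trans lw _.
have -> : \sum_(i < M + K) u i ^+ 2 = \sum_(i < P) v i ^+ 2.
  rewrite -(big_mkord xpredT (fun m => v m ^+ 2)) (big_cat_nat (n := K))//=; last first.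
    by rewrite /P; lia.
  rewrite [X in X + _]big_nat [X in X + _]big1 ?add0r; last first.
    by move=> i iK; rewrite /v ifF ?expr0n//; lia.
  rewrite sum_nat_shift; apply: eq_bigr => i _.
  by rewrite /v addnK ifT//; have := ltn_ord i; rewrite /P; lia.
have Pr0 : 0 < P%:R :> R by rewrite ltr0n.
rewrite -(ler_pM2l Pr0) [_ * (B * _)]mulrCA -!parseval// mulr_sumr.
apply: ler_sum => t _; set th := 2 * pi * t%:R / P%:R.
have shift (F : nat -> R) k : (k < K)%N ->
    (forall i, ~~ (K <= i < P)%N -> F i = 0) ->
    \sum_(m < P) F (m + k)%N = \sum_(i < P) F i.
  move=> kK F0.
  transitivity (\sum_(0 <= i < P + k) F i).
    rewrite (big_cat_nat (n := k))//=; last by lia.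
    rewrite [X in X + _]big_nat [X in X + _]big1 ?add0r; last first.
      by move=> i ik; apply: F0; lia.
    by rewrite sum_nat_shift.
  rewrite (big_cat_nat (n := P))//=; last by lia.
  rewrite [X in _ + X]big_nat [X in _ + X]big1 ?addr0 ?big_mkord//.
  by move=> i iP; apply: F0; lia.
set C := \sum_(i < P) v i * cos (i%:R * th).
set D := \sum_(i < P) v i * sin (i%:R * th).
pose G := \sum_(k < K) g k * cos (k%:R * th).
pose H := \sum_(k < K) g k * sin (k%:R * th).
have v0 i : ~~ (K <= i < P)%N -> v i = 0 by move=> /negbTE; rewrite /v => ->.
(* [w] is a correlation, so its transform is [(G - i H) (C + i D)]: the real part is computed here,
   the imaginary part next. *)
have -> : \sum_(m < P) w m * cos (m%:R * th) = G * C + H * D.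
  under eq_bigr do rewrite mulr_suml.
  rewrite exchange_big/= /G /H !mulr_suml -big_split/=; apply: eq_bigr => k _.
  pose F (i : nat) := g k * v i * cos (i%:R * th - k%:R * th).
  transitivity (\sum_(m < P) F (m + k)%N).
    by rewrite /F; apply: eq_bigr => m _; congr (_ * cos _); rewrite natrD; ring.
  rewrite shift//; last by move=> i /v0; rewrite /F => ->; rewrite mulr0 mul0r.
  rewrite /F /C /D !mulr_sumr -big_split/=; apply: eq_bigr => i _.
  by rewrite cosB; ring.
have -> : \sum_(m < P) w m * sin (m%:R * th) = G * D - H * C.
  under eq_bigr do rewrite mulr_suml.
  rewrite exchange_big/= /G /H !mulr_suml -sumrB; apply: eq_bigr => k _.
  pose F (i : nat) := g k * v i * sin (i%:R * th - k%:R * th).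
  transitivity (\sum_(m < P) F (m + k)%N).
    by rewrite /F; apply: eq_bigr => m _; congr (_ * sin _); rewrite natrD; ring.
  rewrite shift//; last by move=> i /v0; rewrite /F => ->; rewrite mulr0 mul0r.
  rewrite /F /C /D !mulr_sumr -sumrB; apply: eq_bigr => i _.
  by rewrite sinB; ring.
have -> : (G * C + H * D) ^+ 2 + (G * D - H * C) ^+ 2 =
  (G ^+ 2 + H ^+ 2) * (C ^+ 2 + D ^+ 2) by ring.
by apply: ler_wpM2r; [rewrite addr_ge0 ?sqr_ge0|exact: gB].
Qed.
End finite_fourier.

(** * Birkhoff's pointwise ergodic theorem *)

Section upper_density.
Context {R : realType}.
Implicit Types (s : nat -> R) (a b c : R).

(* [limsup s_n / n > b], phrased with countable quantifiers only. *)
Definition often_above s b := exists e : nat, forall m : nat,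
  exists2 n : nat, (m <= n)%N & n%:R * (b + e.+1%:R^-1) <= s n.

(** Moving the index by one and the value by a constant changes [s n / n] by [O(1 / n)] relative to
    the level, which is paid for by lowering the margin from [1 / (e + 1)] to [1 / (e + 2)].
    Birkhoff sums change in this way along the orbit, so their exceptional sets are invariant. *)
Lemma often_above_shift s s' b c :
  (forall n, exists n', [/\ (n <= n'.+1)%N, (n' <= n.+1)%N & s n <= s' n' + c]) ->
  often_above s b -> often_above s' b.
Proof.
move=> ss' [e he]; exists e.+1 => m.
set beta := b + e.+1%:R^-1.
set dlt : R := e.+1%:R^-1 - e.+2%:R^-1.
have d0 : 0 < dlt by rewrite subr_gt0 ltf_pV2 ?posrE ?ltr0n// ltr_nat.
pose N := (Num.truncn ((`|beta| + c) / dlt)).+1.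
have hN : `|beta| + c <= N%:R * dlt.
  by rewrite -ler_pdivrMr// ltW// truncnS_gt.
have [n mn hn] := he (maxn m N).+2.
have [n' [nn' n'n sn]] := ss' n.
exists n'; first by lia.
have n'N : N%:R <= n'%:R :> R by rewrite ler_nat; lia.
have h1 : n'%:R * beta - `|beta| <= n%:R * beta.
  have e1 : n%:R <= n'%:R + 1 :> R by rewrite natr1 ler_nat.
  have e2 : n'%:R <= n%:R + 1 :> R by rewrite natr1 ler_nat.
  have [b0|b0] := leP 0 beta.
    by rewrite ger0_norm//; nra.
  by rewrite ltr0_norm//; nra.
have h2 : N%:R * dlt <= n'%:R * dlt by rewrite ler_wpM2r// ltW.
have -> : n'%:R * (b + e.+2%:R^-1) = n'%:R * beta - n'%:R * dlt.
  by rewrite /beta /dlt; ring.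
by rewrite -/beta in hn; lra.
Qed.

Lemma not_often_above s b : ~ often_above s b -> forall eps, 0 < eps ->
  \forall n \near \oo, s n < n%:R * (b + eps).
Proof.
move=> nb eps eps0.
pose e := Num.truncn eps^-1.
have e1 : e.+1%:R^-1 < eps.
  by rewrite invf_plt ?posrE ?ltr0n// truncnS_gt.
have /existsNP[m hm] : ~ forall m : nat, exists2 n : nat, (m <= n)%N & n%:R * (b + e.+1%:R^-1) <= s n.
  by move=> h; apply: nb; exists e.
exists m => // n /= mn; rewrite ltNge; apply/negP => h; apply: hm; exists n => //.
by apply: le_trans h; rewrite ler_wpM2l// lerD2l ltW.
Qed.

(** The infimum [l] of the levels that are not often exceeded is the upper limit of the means. Were
    the lower limit below [l - eps], two neighbouring fractions with denominator [k + 1] would fit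
    in between, against the last hypothesis. *)
Lemma cvg_mean_of_oscillation s : (forall n, 0 <= s n) ->
  (exists B : nat, ~ often_above s B%:R) ->
  (forall i k : nat, ~ (often_above s (i.+1%:R / k.+1%:R) /\
     often_above (fun n => - s n) (- (i%:R / k.+1%:R)))) ->
  cvgn (fun n => s n / n%:R).
Proof.
move=> s0 [B hB] hosc.
pose D := [set b : R | 0 <= b /\ ~ often_above s b].
have D0 : D !=set0 by exists B%:R.
have Dlb : has_lbound D by exists 0 => x [].
pose l := inf D.
have l0 : 0 <= l by apply: lb_le_inf => // x [].
suff : (fun n => s n / n%:R) @ \oo --> l by apply: cvgP.
apply/cvgrPdist_le => eps eps0.
have eps2 : 0 < eps / 2 by rewrite divr_gt0.
have [b [b0 hb] bl] := inf_adherent eps2 (conj D0 Dlb).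
have up := not_often_above hb eps2.
have low : \forall n \near \oo, n%:R * (l - eps) <= s n.
  pose k := Num.truncn (6 / eps).
  have k1 : 1 < k.+1%:R * (eps / 6).
    have := truncnS_gt (6 / eps); rewrite -/k ltr_pdivrMr//; lra.
  have k0 : 0 < k.+1%:R :> R by rewrite ltr0n.
  have [le|le] := leP l eps.
    near=> n; apply: le_trans (s0 n).
    by rewrite mulr_ge0_le0// subr_le0.
  (* Both [i / (k + 1)] and [(i + 1) / (k + 1)] have to lie in [[l - eps / 2, l)]. Here
     [l (k + 1) - 3 < i <= l (k + 1) - 2], and [6 / eps < k + 1] makes three grid steps shorter than
     [eps / 2]. *)
  pose j := (Num.truncn (l * k.+1%:R - 1)).
  have t0 : 0 <= l * k.+1%:R - 1 by nra.
  have /andP[j1 j2] := truncn_itv t0.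
  rewrite -/j in j1 j2.
  pose i := j.-1.
  have ij : (i.+1 = j)%N \/ (j = 0)%N by rewrite /i; lia.
  have j0 : j <> 0%N by move=> z; rewrite z in j2; nra.
  have {}ij : (i.+1 = j)%N by case: ij.
  have ir : j%:R = i%:R + 1 :> R by rewrite -ij natr1.
  have Ub : often_above s (i.+1%:R / k.+1%:R).
    apply: contrapT => h.
    have : l <= i.+1%:R / k.+1%:R.
      by apply: ge_inf => //; split => //; rewrite divr_ge0.
    by rewrite ler_pdivlMr// ij; lra.
  have := hosc i k => /not_andP[//|h].
  have := not_often_above h eps2; apply: filterS => n hn.
  rewrite -lerN2 ltW// (lt_le_trans hn)// -[- (n%:R * _)]mulrN ler_wpM2l//.
  have : l - eps / 2 <= i%:R / k.+1%:R; last by move: (i%:R / _) => z; lra.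
  rewrite ler_pdivlMr//.
  by move: j2; rewrite -[j.+1%:R]natr1; nra.
near=> n.
have n0 : 0 < n%:R :> R by rewrite ltr0n; near: n; exists 1%N.
have h1 : s n < n%:R * (b + eps / 2) by near: n.
have h2 : n%:R * (l - eps) <= s n by near: n.
rewrite ler_norml; apply/andP; split.
  rewrite lerNl opprB lerBlDr ler_pdivrMr//; apply: le_trans (ltW h1) _.
  by rewrite mulrC ler_wpM2r ?ltW//; move: bl; rewrite -/l; lra.
by rewrite lerBlDr -lerBlDl ler_pdivlMr// mulrC.
Unshelve. all: by end_near. Qed.
End upper_density.

Section birkhoff.
Context {R : realType} (d : measure_display) (X : measurableType d)
  (mu : probability X R) (T : X -> X).
Hypothesis mT : measurable_fun [set: X] T.
Hypothesis muT : forall A : set X, measurable A -> mu (T @^-1` A) = mu A.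
Local Open Scope ereal_scope.

Lemma integral_invariant (f : X -> \bar R) : measurable_fun setT f ->
  (forall x, 0 <= f x) -> \int[mu]_x f (T x) = \int[mu]_x f x.
Proof.
move=> mf f0.
have := @ge0_integral_pushforward _ _ _ _ _ _ mT mu setT f measurableT mf
  (fun x _ => f0 x).
rewrite preimage_setT => /esym ->; apply: eq_measure_integral => A mA _.
exact: muT.
Qed.

Section maximal.
Variables p q : X -> R.
Hypotheses (mp : measurable_fun setT p) (mq : measurable_fun setT q).
Hypotheses (p0 : forall x, (0 <= p x)%R) (q0 : forall x, (0 <= q x)%R).
Hypothesis ip : \int[mu]_x (p x)%:E < +oo.

(** Unfolded, this is the maximum of [0] and the sums of [p - q] over the first [1], ..., [n] points
    of the orbit; the recursive form is the one that Garsia's argument uses. Keeping [p] and [q]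
    apart allows all integrals to be those of nonnegative functions. *)
Fixpoint max_partial_sum n x : R :=
  if n is n.+1 then Num.max 0%R (p x - q x + max_partial_sum n (T x))%R else 0%R.
Local Notation M := max_partial_sum.

Lemma max_partial_sum_ge0 n x : (0 <= M n x)%R.
Proof. by case: n => //= n; rewrite le_max lexx. Qed.

Lemma measurable_max_partial_sum n : measurable_fun setT (M n).
Proof.
elim: n => [|n IH]; first exact: measurable_cst.
apply: measurable_maxr; first exact: measurable_cst.
apply: measurable_funD; first exact: measurable_funB.
exact: measurableT_comp.
Qed.

Lemma max_partial_sum_nd n x : (M n x <= M n.+1 x)%R.
Proof.
elim: n x => [|n IH] x; first exact: max_partial_sum_ge0.
rewrite [leLHS]/= [leRHS]/= ge_max le_max lexx/=.
by rewrite le_max lerD2l IH orbT.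
Qed.

Lemma le_max_partial_sum n x :
  (\sum_(i < n) (p (iter i T x) - q (iter i T x)) <= M n x)%R.
Proof.
elim: n x => [|n IH] x; first by rewrite big_ord0.
rewrite big_ord_recl/= le_max lerD2l; apply/orP; right.
by under eq_bigr do rewrite -iterS iterSr; exact: IH.
Qed.

Lemma integral_max_partial_sum n : \int[mu]_x (M n x)%:E < +oo.
Proof.
elim: n => [|n IH]; first by rewrite integral0_eq.
apply: (@le_lt_trans _ _ (\int[mu]_x ((p x)%:E + (M n (T x))%:E))).
  apply: ge0_le_integral => //.
  - by move=> x _; rewrite lee_fin max_partial_sum_ge0.
  - by apply/measurable_EFinP; exact: measurable_max_partial_sum.
  - apply: emeasurable_funD; first exact/measurable_EFinP.
    apply/measurable_EFinP/measurableT_comp => //.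
    exact: measurable_max_partial_sum.
  - move=> x _; rewrite -EFinD lee_fin /= ge_max addr_ge0 ?max_partial_sum_ge0//=.
    by rewrite lerD2r gerBl.
rewrite ge0_integralD//; last 4 first.
- by move=> x _; rewrite lee_fin.
- exact/measurable_EFinP.
- by move=> x _; rewrite lee_fin max_partial_sum_ge0.
- apply/measurable_EFinP/measurableT_comp => //.
  exact: measurable_max_partial_sum.
rewrite (@integral_invariant (fun x => (M n x)%:E)); last 2 first.
- by apply/measurable_EFinP; exact: measurable_max_partial_sum.
- by move=> x; rewrite lee_fin max_partial_sum_ge0.
exact: lte_add_pinfty.
Qed.

(* Garsia: on [0 < M n] one has [M n <= p - q + M n \o T]. *)
Lemma maximal_inequality_level n :
  \int[mu]_(x in [set x | (0 < M n x)%R]) (q x)%:E <= \int[mu]_x (p x)%:E.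
Proof.
set E := [set x | _].
have mM := measurable_max_partial_sum n.
have mE : measurable E.
  rewrite (_ : E = M n @^-1` `]0%R, +oo[%classic).
    by rewrite -[X in measurable X]setTI; exact: mM.
  by apply/seteqP; split => x /=; rewrite in_itv/= andbT.
have mMT : measurable_fun setT (fun x => (M n (T x))%:E).
  by apply/measurable_EFinP/measurableT_comp.
have mqE : measurable_fun setT ((EFin \o q) \_ E).
  by apply/(measurable_restrictT _ mE); apply: measurable_funTS; exact/measurable_EFinP.
have qE0 x : 0 <= ((EFin \o q) \_ E) x.
  by rewrite /patch; case: ifP => //= _; rewrite lee_fin.
have key : \int[mu]_x (((EFin \o q) \_ E) x + (M n x)%:E) <=
    \int[mu]_x ((p x)%:E + (M n (T x))%:E).
  apply: ge0_le_integral => //.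
  - by move=> x _; rewrite adde_ge0// lee_fin max_partial_sum_ge0.
  - apply: emeasurable_funD => //; exact/measurable_EFinP.
  - apply: emeasurable_funD => //; exact/measurable_EFinP.
  - move=> x _; rewrite /patch; case: ifP => [/set_mem|/negbT/negP nE].
      rewrite /E/= -!EFinD lee_fin.
      case: n {E mM mE mMT mqE qE0} => [|n]; first by rewrite ltxx.
      rewrite [M n.+1 x]/= lt_max ltxx/= => h.
      rewrite max_r ?(ltW h)//.
      by have := max_partial_sum_nd n (T x); rewrite [M n.+1 _]/=; lra.
    have -> : M n x = 0%R.
      apply/eqP; rewrite eq_le max_partial_sum_ge0 andbT leNgt; apply/negP => h.
      by apply: nE; rewrite inE.
    by rewrite -[point]/(0%R%:E) add0e -EFinD lee_fin addr_ge0// max_partial_sum_ge0.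
move: key; rewrite !ge0_integralD//.
- rewrite -integral_mkcond (@integral_invariant (fun x => (M n x)%:E)); last 2 first.
  + exact/measurable_EFinP.
  + by move=> x; rewrite lee_fin max_partial_sum_ge0.
  rewrite leeD2rE// ge0_fin_numE ?integral_max_partial_sum//.
  by apply: integral_ge0 => x _; rewrite lee_fin max_partial_sum_ge0.
- by move=> x _; rewrite lee_fin.
- exact/measurable_EFinP.
- by move=> x _; rewrite lee_fin max_partial_sum_ge0.
- by move=> x _; rewrite lee_fin max_partial_sum_ge0.
- exact/measurable_EFinP.
Qed.

(** The sets where [M n] is positive increase and their union contains the set where [q] is
    positive, so the inequality for single [n] passes to the limit by monotone convergence. *)
Lemma maximal_inequality :
  (forall x, (0 < q x)%R -> exists n,
    (\sum_(i < n) q (iter i T x) < \sum_(i < n) p (iter i T x))%R) ->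
  \int[mu]_x (q x)%:E <= \int[mu]_x (p x)%:E.
Proof.
move=> h; pose E n := [set x | (0 < M n x)%R].
have mE n : measurable (E n).
  rewrite (_ : E n = M n @^-1` `]0%R, +oo[%classic).
    by rewrite -[X in measurable X]setTI; exact: measurable_max_partial_sum.
  by apply/seteqP; split => x /=; rewrite in_itv/= andbT.
have ndE : nondecreasing_seq E.
  apply/nondecreasing_seqP => n; apply/subsetPset => x /= h1.
  exact: lt_le_trans h1 (max_partial_sum_nd _ _).
have -> : \int[mu]_x (q x)%:E = \int[mu]_(x in \bigcup_n E n) (q x)%:E.
  rewrite [RHS]integral_mkcond; apply: eq_integral => x _.
  rewrite /patch; case: ifPn => // /negP nE; congr EFin; apply/eqP.
  rewrite eq_le q0 andbT leNgt; apply/negP => /h[n hn].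
  apply: nE; rewrite inE; exists n => //=.
  apply: lt_le_trans (le_max_partial_sum _ _).
  by rewrite sumrB subr_gt0.
have : \int[mu]_(x in E i) (q x)%:E @[i --> \oo] -->
    \int[mu]_(x in \bigcup_n E n) (q x)%:E.
  apply: ge0_nondecreasing_set_cvg_integral => //.
  - by move=> i; apply: measurable_funTS; exact/measurable_EFinP.
  - by move=> i x _; rewrite lee_fin.
move/cvg_lim => <-//.
apply: lime_le.
  apply: ereal_nondecreasing_is_cvgn.
  apply: ge0_nondecreasing_set_nondecreasing_integral => //.
  - by move=> i; apply: measurable_funTS; exact/measurable_EFinP.
  - by move=> i x _; rewrite lee_fin.
by apply: nearW => n; exact: maximal_inequality_level.
Qed.
End maximal.

Lemma measurable_often_above (s : X -> nat -> R) b :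
  (forall n, measurable_fun setT (s^~ n)) ->
  measurable [set x | often_above (s x) b].
Proof.
move=> ms; pose F (e m n : nat) :=
  if (m <= n)%N then [set x | (n%:R * (b + e.+1%:R^-1) <= s x n)%R] else set0.
rewrite (_ : [set x | _] = \bigcup_e \bigcap_m \bigcup_n F e m n); last first.
  apply/seteqP; split => x /=.
    move=> [e he]; exists e => // m _; have [n mn hn] := he m.
    by exists n => //; rewrite /F mn.
  move=> [e _ he]; exists e => m; have [n _] := he m I.
  by rewrite /F; case: ifP => // mn hn; exists n.
apply: bigcup_measurable => e _; apply: bigcap_measurable => // m _.
apply: bigcup_measurable => n _; rewrite /F; case: ifP => // _.
rewrite (_ : [set x | _] = (s^~ n) @^-1` `[(n%:R * (b + e.+1%:R^-1))%R, +oo[%classic).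
  by rewrite -[X in measurable X]setTI; exact: ms.
by apply/seteqP; split => x /=; rewrite in_itv/= andbT.
Qed.

Section pointwise.
Variable f : X -> R.
Hypotheses (mf : measurable_fun setT f) (f0 : forall x, (0 <= f x)%R).
Hypothesis intf : \int[mu]_x (f x)%:E < +oo.

Let S x n : R := (\sum_(i < n) f (iter i T x))%R.

Let mS n : measurable_fun setT (S^~ n).
Proof.
apply: measurable_sum => i; apply: measurableT_comp => //.
by elim: (i : nat) => [|j IH]; [exact: measurable_id|exact: measurableT_comp].
Qed.

Let S_shift x n : S x n.+1 = (f x + S (T x) n)%R.
Proof.
rewrite /S big_ord_recl/=; congr +%R; apply: eq_bigr => i _.
by rewrite -iterS iterSr.
Qed.

Let often_above_invariant x b : often_above (S (T x)) b <-> often_above (S x) b.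
Proof.
split.
- apply: (@often_above_shift _ _ _ _ 0) => n; exists n.+1; split => //; first exact: leqW.
  by rewrite S_shift addr0 lerDr.
- apply: (@often_above_shift _ _ _ _ (f x)) => -[|n].
    by exists 0%N; split => //; rewrite /S !big_ord0 add0r.
  exists n; split => //; first exact: leqW.
  by rewrite S_shift addrC.
Qed.

Let often_below_invariant x b :
  often_above (fun n => - S (T x) n)%R b <-> often_above (fun n => - S x n)%R b.
Proof.
split.
- apply: (@often_above_shift _ _ _ _ (f x)) => n; exists n.+1; split => //; first exact: leqW.
  by rewrite S_shift; lra.
- apply: (@often_above_shift _ _ _ _ 0) => -[|n].
    by exists 0%N; split => //; rewrite /S !big_ord0 addr0.
  exists n; split => //; first exact: leqW.
  by rewrite S_shift addr0; have := f0 x; lra.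
Qed.

Section invariant_set.
Variable A : set X.
Hypotheses (mA : measurable A) (TA : forall x, A (T x) <-> A x).

Let indic_iter x i : A x -> \1_A (iter i T x) = 1%R :> R.
Proof.
move=> Ax; rewrite indicE mem_set//.
by elim: i => //= i; exact: (TA _).2.
Qed.

Let mfA : measurable_fun setT (fun x => f x * \1_A x)%R.
Proof. by apply: measurable_funM => //; exact: measurable_indic. Qed.

Let mcA c : measurable_fun setT (fun x => c * \1_A x : R)%R.
Proof. by apply: measurable_funM => //; exact: measurable_indic. Qed.

Let fA0 x : (0 <= f x * \1_A x)%R.
Proof. by rewrite mulr_ge0. Qed.

Let int_fA : \int[mu]_x (f x * \1_A x)%:E < +oo.
Proof.
apply: le_lt_trans intf; apply: ge0_le_integral => //.
- by move=> x _; rewrite lee_fin.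
- exact/measurable_EFinP.
- exact/measurable_EFinP.
- by move=> x _; rewrite lee_fin ler_piMr// indicE; case: (_ \in _).
Qed.

Let int_cA c : (0 <= c)%R -> \int[mu]_x (c * \1_A x)%:E = c%:E * mu A.
Proof.
move=> c0; under eq_integral do rewrite EFinM.
rewrite ge0_integralZl_EFin//; first by rewrite integral_indic ?setIT.
by apply/measurable_EFinP; exact: measurable_indic.
Qed.

(** Maximal inequality with [p = f 1_A] and [q = b 1_A]; by invariance the indicator is constant
    along orbits. The companion below exchanges the two roles. *)
Lemma integral_often_above b : (0 <= b)%R ->
  (forall x, A x -> exists n, (n%:R * b < S x n)%R) ->
  b%:E * mu A <= \int[mu]_x (f x * \1_A x)%:E.
Proof.
move=> b0 hA; rewrite -int_cA//; apply: maximal_inequality => //.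
- by move=> x; rewrite mulr_ge0.
- move=> x; rewrite indicE; case: (boolP (x \in A)) => [/set_mem Ax _|_]; last first.
    by rewrite mulr0 ltxx.
  have [n hn] := hA _ Ax; exists n.
  rewrite (eq_bigr (fun=> b)) => [|i _]; last by rewrite indic_iter ?mulr1.
  rewrite [ltRHS](eq_bigr (fun i : 'I_n => f (iter i T x))) => [|i _]; last first.
    by rewrite indic_iter ?mulr1.
  by rewrite sumr_const card_ord -mulr_natl.
Qed.

Lemma integral_often_below a : (0 <= a)%R ->
  (forall x, A x -> exists n, (S x n < n%:R * a)%R) ->
  \int[mu]_x (f x * \1_A x)%:E <= a%:E * mu A.
Proof.
move=> a0 hA; rewrite -int_cA//; apply: maximal_inequality => //.
- by move=> x; rewrite mulr_ge0.
- by rewrite int_cA// lte_mul_pinfty// -ge0_fin_numE// fin_num_measure.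
- move=> x; rewrite indicE; case: (boolP (x \in A)) => [/set_mem Ax _|_]; last first.
    by rewrite mulr0 ltxx.
  have [n hn] := hA _ Ax; exists n.
  rewrite (eq_bigr (fun i : 'I_n => f (iter i T x))) => [|i _]; last first.
    by rewrite indic_iter ?mulr1.
  rewrite [ltRHS](eq_bigr (fun=> a)) => [|i _]; last by rewrite indic_iter ?mulr1.
  by rewrite sumr_const card_ord -mulr_natl.
Qed.

End invariant_set.

Theorem birkhoff :
  {ae mu, forall x, cvgn (fun n => (\sum_(i < n) f (iter i T x)) / n%:R : R)%R}.
Proof.
have lt_often x b : often_above (S x) b -> exists n, (n%:R * b < S x n)%R.
  move=> [e he]; have [n n0 hn] := he 1%N; exists n; apply: lt_le_trans hn.
  by rewrite ltr_pM2l ?ltr0n// ltrDl invr_gt0 ltr0n.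
have gt_often x a : often_above (fun n => - S x n)%R (- a)%R ->
    exists n, (S x n < n%:R * a)%R.
  move=> [e he]; have [n n0 hn] := he 1%N; exists n.
  rewrite -ltrN2 -mulrN; apply: lt_le_trans hn.
  by rewrite ltr_pM2l ?ltr0n// ltrDl invr_gt0 ltr0n.
have h1 : {ae mu, forall x, exists B : nat, ~ often_above (S x) B%:R}.
  (* On [V] the upper limit of the means is infinite, so [B mu(V)] is at most the integral of [f]
     for every [B]. *)
  pose V := \bigcap_B [set x | often_above (S x) B%:R].
  have mV : measurable V by apply: bigcap_measurable => // B _; exact: measurable_often_above.
  exists V; split => //; last first.
    by move=> x /= /forallNP h B _; exact: contrapT (h B).
  have TV x : V (T x) <-> V x.
    by split => h B _; have := h B I; move/often_above_invariant.
  have VB (B : nat) : B%:R%:E * mu V <= \int[mu]_x (f x * \1_V x)%:E.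
    by apply: integral_often_above => // x /(_ B I)/lt_often.
  have fin : \int[mu]_x (f x * \1_V x)%:E < +oo.
    apply: le_lt_trans intf; apply: ge0_le_integral => //.
    - by move=> x _; rewrite lee_fin mulr_ge0.
    - by apply/measurable_EFinP; apply: measurable_funM => //; exact: measurable_indic.
    - exact/measurable_EFinP.
    - by move=> x _; rewrite lee_fin ler_piMr// indicE; case: (_ \in _).
  have fin0 : 0 <= \int[mu]_x (f x * \1_V x)%:E.
    by apply: integral_ge0 => x _; rewrite lee_fin mulr_ge0.
  have fV : mu V \is a fin_num by rewrite fin_num_measure.
  move: VB fin fin0; rewrite -(fineK fV).
  case: (\int[mu]_x _) => // r VB _ _; congr EFin; apply/eqP.
  rewrite eq_le fine_ge0// andbT leNgt; apply/negP => v0.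
  have := VB (Num.truncn (r / fine (mu V))).+1.
  rewrite -EFinM lee_fin leNgt => /negP; apply.
  by rewrite -ltr_pdivrMr// truncnS_gt.
(* On the set [V] below, the means exceed [b] and fall below [a < b] infinitely often; integrating
   [f] over this invariant set gives [b mu(V) <= a mu(V)]. *)
have h2 (i k : nat) : {ae mu, forall x, ~ (often_above (S x) (i.+1%:R / k.+1%:R) /\
     often_above (fun n => - S x n)%R (- (i%:R / k.+1%:R))%R)}.
  set b : R := (i.+1%:R / k.+1%:R)%R; set a : R := (i%:R / k.+1%:R)%R.
  pose V := [set x | often_above (S x) b] `&`
    [set x | often_above (fun n => - S x n)%R (- a)%R].
  have mV : measurable V.
    apply: measurableI; first exact: measurable_often_above.
    by apply: measurable_often_above => n; exact: measurable_funN.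
  exists V; split => //; last by move=> x /= /contrapT.
  have TV x : V (T x) <-> V x.
    by split => -[/often_above_invariant ? /often_below_invariant ?].
  have a0 : (0 <= a)%R by rewrite divr_ge0.
  have ab : (a < b)%R by rewrite ltr_pM2r ?invr_gt0 ?ltr0n// ltr_nat.
  have : b%:E * mu V <= a%:E * mu V.
    apply: le_trans (integral_often_below _ _ a0 _) => //.
      by apply: integral_often_above => //; [lra|move=> x [/lt_often]].
    by move=> x [_ /gt_often].
  have fV : mu V \is a fin_num by rewrite fin_num_measure.
  rewrite -(fineK fV) -!EFinM lee_fin => h; congr EFin; apply/eqP.
  rewrite eq_le fine_ge0// andbT leNgt; apply/negP => v0.
  by move: h; rewrite ler_pM2r// leNgt ab.
have h3 : {ae mu, forall x (i k : nat), ~ (often_above (S x) (i.+1%:R / k.+1%:R) /\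
     often_above (fun n => - S x n)%R (- (i%:R / k.+1%:R))%R)}.
  by apply/ae_foralln => i; apply/ae_foralln => k.
apply: filterS2 h1 h3 => x hB hO; apply: cvg_mean_of_oscillation => //.
by move=> n; apply: sumr_ge0.
Qed.
End pointwise.
End birkhoff.

(** * Weighted ergodic averages *)

Section p_series.
Context {R : realType}.

(** Integral test: from the second on, the terms are bounded by the telescoping differences of
    [n ^ (- d) / d]. The inequality [key] is Bernoulli's, in the form
    [(1 - 1 / N) ^ (- d) >= 1 + d / N] with [N = n + 2]. *)
Lemma p_series_bound (d : R) n : 0 < d ->
  \sum_(i < n) (i.+1%:R `^ (1 + d))^-1 <= 1 + d^-1.
Proof.
move=> d0; have di : 0 < d^-1 by rewrite invr_gt0.
case: n => [|n]; first by rewrite big_ord0; lra.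
suff : \sum_(i < n.+1) (i.+1%:R `^ (1 + d))^-1 <= 1 + d^-1 - d^-1 * (n.+1%:R `^ d)^-1.
  have : 0 <= d^-1 * (n.+1%:R `^ d)^-1 by rewrite mulr_ge0 ?ltW// invr_ge0 powR_ge0.
  by lra.
elim: n => [|n IH].
  by rewrite big_ord_recl big_ord0 !powR1 invr1; lra.
rewrite big_ord_recr/=.
suff : (n.+2%:R `^ (1 + d))^-1 <= d^-1 * (n.+1%:R `^ d)^-1 - d^-1 * (n.+2%:R `^ d)^-1.
  by lra.
have n1 : 0 < n.+1%:R :> R by rewrite ltr0n.
have n2 : 0 < n.+2%:R :> R by rewrite ltr0n.
have p1 : 0 < n.+1%:R `^ d :> R by rewrite powR_gt0.
have p2 : 0 < n.+2%:R `^ d :> R by rewrite powR_gt0.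
have key : (1 + d / n.+2%:R) * n.+1%:R `^ d <= n.+2%:R `^ d.
  rewrite /powR !gt_eqF// -[n.+2%:R in leRHS](divfK (lt0r_neq0 n1)).
  rewrite lnM ?posrE ?divr_gt0// mulrDr expRD ler_wpM2r ?expR_ge0//.
  apply: le_trans (expR_ge1Dx _); rewrite lerD2l ler_pM2l//.
  have -> : n.+2%:R / n.+1%:R = (1 - n.+2%:R^-1)^-1 :> R.
    have -> : n.+2%:R = n.+1%:R + 1 :> R by rewrite natr1.
    move: n.+1%:R n1 => a a0; field.
    by rewrite !gt_eqF//; lra.
  rewrite lnV ?posrE; last by rewrite subr_gt0 invf_lt1// ltr1n.
  rewrite lerNr le_ln1Dx// ltrN2 invf_lt1// ltr1n//.
have -> : n.+2%:R `^ (1 + d) = n.+2%:R * n.+2%:R `^ d.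
  by rewrite powRD ?(gt_eqF n2) ?implybT// powRr1 ?ltW.
have -> : d^-1 * (n.+1%:R `^ d)^-1 - d^-1 * (n.+2%:R `^ d)^-1 =
   (n.+2%:R `^ d - n.+1%:R `^ d) / (d * n.+1%:R `^ d * n.+2%:R `^ d).
  by field; rewrite !gt_eqF.
rewrite invfM mulrC ler_pdivlMr ?mulr_gt0//.
have -> : (n.+2%:R `^ d)^-1 / n.+2%:R * (d * n.+1%:R `^ d * n.+2%:R `^ d) =
  d / n.+2%:R * n.+1%:R `^ d by field; rewrite !gt_eqF.
by rewrite lerBrDl -[X in X + _]mul1r -mulrDl.
Qed.
End p_series.

Section filling.
Context {R : realType}.

(** Integer version of [n0 (1 + 1 / q) ^ i]: the added unit outweighs the rounding of the division,
    so each step gains at least the factor [1 + 1 / q], and it forces strict growth even while the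
    term is below [q]. *)
Fixpoint geometric_times (q n0 i : nat) : nat :=
  if i is j.+1 then
    (geometric_times q n0 j + geometric_times q n0 j %/ q + 1)%N else n0.

Lemma geometric_times_ge (q n0 i : nat) : (0 < q)%N ->
  n0%:R * (1 + q%:R^-1) ^+ i <= (geometric_times q n0 i)%:R :> R.
Proof.
move=> q0; elim: i => [|i IH]; first by rewrite expr0 mulr1.
have qr : 0 < q%:R :> R by rewrite ltr0n.
rewrite exprSr mulrA /= !natrD; set n := geometric_times q n0 i in IH *.
have h : n%:R / q%:R <= (n %/ q)%:R + 1 :> R.
  rewrite ler_pdivrMr// {1}(divn_eq n q) natrD natrM mulrDl mul1r lerD2l.
  by rewrite ler_nat ltnW// ltn_pmod.
have : 0 <= q%:R^-1 :> R by rewrite invr_ge0 ltW.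
by nra.
Qed.

Lemma geometric_times_increasing (q n0 i : nat) :
  (geometric_times q n0 i < geometric_times q n0 i.+1)%N.
Proof. by rewrite /= addn1 ltnS leq_addr. Qed.

Lemma geometric_times_geid (q n0 i : nat) : (i <= geometric_times q n0 i)%N.
Proof.
elim: i => // i IH; apply: leq_ltn_trans (geometric_times_increasing q n0 i).
exact: IH.
Qed.

(* Between the times [N] and [N'], with [N'] about [(1 + 1 / q) N], the sum of
   [u] is about [N / q] times the mean of [u]. *)
Lemma mean_step (u g : nat -> R) (l e eps : R) (q N N' K : nat) :
  let A n := (\sum_(k < n) u k) / n%:R in
  let S n := \sum_(k < n) g k * u k in
  (forall k, 0 <= u k) -> (forall k, `|g k| <= 1) ->
  0 <= l -> 0 < e -> e <= 1 -> e <= eps / 16 -> 4 * (l + 1) < q%:R * eps ->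
  (0 < q)%N -> (q <= N)%N -> (N <= K)%N -> (K <= N')%N ->
  (N' * q <= N * q.+1 + q)%N ->
  `|A N - l| <= e -> `|A N' - l| <= e -> `|S N / N%:R| <= e ->
  `|S K / K%:R| <= eps.
Proof.
move=> A S u0 g1 l0 e0 e2 e1 q1 qgt0 qN NK KN' step.
have N0 : (0 < N)%N by exact: leq_trans qN.
have K0 : (0 < K)%N by exact: leq_trans NK.
have N'0 : (0 < N')%N by exact: leq_trans KN'.
have qr : 0 < q%:R :> R by rewrite ltr0n.
have Nr : 0 < N%:R :> R by rewrite ltr0n.
have Kr : 0 < K%:R :> R by rewrite ltr0n.
have N'r : 0 < N'%:R :> R by rewrite ltr0n.
rewrite !ler_norml => /andP[a1 a2] /andP[b1 b2].
rewrite -!ler_norml !normrM !normfV (gtr0_norm Nr) (gtr0_norm Kr).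
rewrite !ler_pdivrMr// => SN.
have AE m : (0 < m)%N -> \sum_(k < m) u k = A m * m%:R.
  by move=> m0; rewrite /A divfK// pnatr_eq0 -lt0n.
have SK : `|S K| <= `|S N| + (A N' * N'%:R - A N * N%:R).
  rewrite -!AE//.
  rewrite /S -!(big_mkord xpredT (fun k => g k * u k)) -!(big_mkord xpredT u).
  rewrite (big_cat_nat (n := N) (p := K))//=.
  rewrite (big_cat_nat (n := N) (p := N'))//=; last exact: leq_trans KN'.
  rewrite [X in _ <= _ + X]addrAC subrr add0r.
  apply: le_trans (ler_normD _ _) _; rewrite lerD2l.
  apply: le_trans (ler_norm_sum _ _ _) _.
  rewrite (big_cat_nat (n := K) (p := N'))//=.
  rewrite ler_wpDr ?sumr_ge0//; apply: ler_sum => k _.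
  by rewrite normrM (ger0_norm (u0 k)) ler_piMl.
have {}step : N'%:R * q%:R <= N%:R * (q%:R + 1) + q%:R :> R.
  by rewrite natr1 -!natrM -natrD ler_nat.
have {}qN : q%:R <= N%:R :> R by rewrite ler_nat.
have KN : N%:R <= K%:R :> R by rewrite ler_nat.
have NN' : N%:R <= N'%:R :> R by rewrite ler_nat; exact: leq_trans KN'.
apply: (@le_trans _ _ (eps * N%:R)); last by rewrite ler_wpM2l//; lra.
apply: le_trans SK _.
have h1 : A N' * N'%:R <= (l + e) * N'%:R.
  by apply: ler_wpM2r; [exact: ltW|lra].
have h2 : (l - e) * N%:R <= A N * N%:R.
  by apply: ler_wpM2r; [exact: ltW|lra].
move: SN h1 h2; move: (A N' * _) (A N * _) `|S N| => x y z SN h1 h2.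
(* The block has length at most [N / q + 1], and [q <= N] turns this into [2 N / q]. *)
have h3 : (N'%:R - N%:R) * q%:R <= 2 * N%:R :> R by lra.
have h4 : (l + 1) * (N'%:R - N%:R) <= eps / 2 * N%:R.
  have h5 : (l + 1) * ((N'%:R - N%:R) * q%:R) <= (l + 1) * (2 * N%:R).
    by rewrite ler_wpM2l//; lra.
  have h6 : 4 * (l + 1) * N%:R <= q%:R * eps * N%:R.
    by rewrite ler_wpM2r ?ltW.
  by rewrite -(ler_pM2r qr); lra.
have h8 : e * (N'%:R - N%:R) <= 1 * (N'%:R - N%:R).
  by rewrite ler_wpM2r//; lra.
have h9 : e * N%:R <= eps / 16 * N%:R by rewrite ler_wpM2r// ltW.
have h10 : 0 <= eps * N%:R by rewrite mulr_ge0 ?ltW//; lra.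
lra.
Qed.

(** A single [q] does not suffice: the error inside a block is of order [l / q], so each tolerance
    [eps] takes its own geometric progression. *)
Lemma mean_cvg0_of_subsequences (u g : nat -> R) (l : R) :
  (forall k, 0 <= u k) -> (forall k, `|g k| <= 1) ->
  (\sum_(k < n) u k) / n%:R @[n --> \oo] --> l ->
  (forall q, exists n0,
    let n := geometric_times q.+1 n0 in
    (\sum_(k < n i) g k * u k) / (n i)%:R @[i --> \oo] --> (0 : R)) ->
  (\sum_(k < n) g k * u k) / n%:R @[n --> \oo] --> (0 : R).
Proof.
move=> u0 g1 ul hq; apply/cvgrPdist_le => eps eps0.
have l0 : 0 <= l.
  apply: (cvgr_to_ge ul); apply: nearW => n.
  by rewrite divr_ge0// sumr_ge0.
pose q := Num.truncn (4 * (l + 1) / eps).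
have q1 : 4 * (l + 1) < q.+1%:R * eps.
  by have := truncnS_gt (4 * (l + 1) / eps); rewrite -/q ltr_pdivrMr.
have [n0 /= hn] := hq q; set n := geometric_times q.+1 n0 in hn.
pose e := Num.min (eps / 16) 1.
have e0 : 0 < e by rewrite lt_min divr_gt0//= ltr01.
have e1 : e <= eps / 16 by rewrite ge_min lexx.
have e2 : e <= 1 by rewrite ge_min lexx orbT.
have /cvgrPdist_le /(_ _ e0) [N1 _ hA] := ul.
have /cvgrPdist_le /(_ _ e0) [I1 _ hS] := hn.
pose I := maxn I1 (maxn N1 q.+1).
have geid := geometric_times_geid q.+1 n0.
have ninc := geometric_times_increasing q.+1 n0.
exists (n I) => // K /= nK; rewrite sub0r normrN.
have [i [Ii niK Kni]] : exists i, [/\ (I <= i)%N, (n i <= K)%N & (K < n i.+1)%N].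
  have h : exists i, (K < n (I + i)%N)%N.
    by exists K.+1; apply: leq_trans (geid _); rewrite leq_addl.
  case: (ex_minnP h) => -[|i] hi hmin.
    by move: hi; rewrite addn0 ltnNge nK.
  exists (I + i)%N; rewrite -addnS; split => //; first exact: leq_addr.
  by rewrite leqNgt; apply/negP => /hmin; rewrite ltnn.
have niI : (I <= n i)%N by apply: leq_trans Ii (geid _).
have [I1i N1n qn] : [/\ (I1 <= i)%N, (N1 <= n i)%N & (q.+1 <= n i)%N].
  split; first by apply: leq_trans Ii; rewrite leq_maxl.
    by apply: leq_trans niI; rewrite !leq_max leqnn orbT.
  by apply: leq_trans niI; rewrite !leq_max leqnn !orbT.
apply: (@mean_step u g l e eps q.+1 (n i) (n i.+1) K) => //.
- exact: ltnW.
- have -> : n i.+1 = (n i + n i %/ q.+1 + 1)%N by [].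
  rewrite !mulnDl mul1n [(n i * q.+2)%N]mulnS leq_add2r addnC leq_add2r.
  exact: leq_trunc_div.
- by rewrite distrC; exact: hA.
- by rewrite distrC; apply: hA; exact: leq_trans N1n (ltnW (ninc i)).
- by have := hS i I1i; rewrite sub0r normrN.
Qed.
End filling.

Section weighted_ergodic.
Context {R : realType} (d : measure_display) (X : measurableType d)
  (mu : probability X R) (T : X -> X).
Hypothesis mT : measurable_fun [set: X] T.
Hypothesis muT : forall A : set X, measurable A -> mu (T @^-1` A) = mu A.
Local Open Scope ereal_scope.

(** By monotone convergence the series of the [F i] has a finite integral, so it converges almost
    everywhere and its terms tend to zero. *)
Lemma ae_cvg0_of_summable (F : nat -> X -> R) (c : nat -> R) (C : R) :
  (forall i, measurable_fun setT (F i)) -> (forall i x, (0 <= F i x)%R) ->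
  (forall i, \int[mu]_x (F i x)%:E <= (c i)%:E) ->
  (forall n, (\sum_(i < n) c i <= C)%R) ->
  {ae mu, forall x, F ^~ x @ \oo --> (0%R : R)}.
Proof.
move=> mF F0 Fc cC.
have mFE i : measurable_fun setT (fun x => (F i x)%:E) by exact/measurable_EFinP.
have F0E i x : 0 <= (F i x)%:E by rewrite lee_fin.
pose G x := \sum_(0 <= i <oo) (F i x)%:E.
have G0 x : 0 <= G x by apply: nneseries_ge0 => *; exact: F0E.
have mG : measurable_fun setT G by apply: ge0_emeasurable_sum => // *; exact: F0E.
have iG : \int[mu]_x G x <= C%:E.
  rewrite integral_nneseries//.
  apply: lime_le.
    by apply: is_cvg_nneseries => *; apply: integral_ge0 => *; exact: F0E.
  apply: nearW => n; rewrite big_mkord.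
  apply: le_trans (_ : (\sum_(i < n) c i)%:E <= _); last by rewrite lee_fin.
  by rewrite -sumEFin; apply: lee_sum => i _; exact: Fc.
have : mu.-integrable setT G.
  apply/integrableP; split => //.
  under eq_integral do rewrite gee0_abs//.
  exact: le_lt_trans (ltry C).
move/(integrable_ae measurableT); apply: filterS => x /(_ I) Gx.
apply: cvg_series_cvg_0; apply: nondecreasing_is_cvgn.
  by apply: nondecreasing_series => *; exact: F0.
exists (fine (G x)) => _ [n _ <-]; rewrite -lee_fin fineK// /series/= -sumEFin.
by apply: nneseries_lim_ge => *; exact: F0E.
Qed.

Let mTn n : measurable_fun setT (iter n T).
Proof. by elim: n => [|n IH]; [exact: measurable_id|exact: measurableT_comp]. Qed.

Let int_iter (F : X -> \bar R) n : measurable_fun setT F -> (forall x, 0 <= F x) ->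
  \int[mu]_x F (iter n T x) = \int[mu]_x F x.
Proof.
move=> mF F0; elim: n => // n IH.
rewrite -[RHS]IH -[RHS](integral_invariant mT muT)//; last exact: measurableT_comp.
by apply: eq_integral => x _; rewrite iterSr.
Qed.

(** Calderon's transference: the inequality for sequences is applied to the orbit segment
    [f (T^i x)], [i < M + K], and integrated. Invariance turns each side into a multiple of one
    integral, and large [M] removes the factor [(M + K) / M]. *)
Lemma L2_bound (f : X -> R) (g : nat -> R) (K : nat) (B : R) :
  measurable_fun setT f -> \int[mu]_x ((f x) ^+ 2)%:E < +oo ->
  (forall t, (\sum_(k < K) g k * cos (k%:R * t)) ^+ 2 +
             (\sum_(k < K) g k * sin (k%:R * t)) ^+ 2 <= B)%R ->
  \int[mu]_x ((\sum_(k < K) g k * f (iter k T x)) ^+ 2)%:E <=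
  B%:E * \int[mu]_x ((f x) ^+ 2)%:E.
Proof.
move=> mf if2 gB.
have B0 : (0 <= B)%R by apply: le_trans (gB 0%R); rewrite addr_ge0 ?sqr_ge0.
pose S x := (\sum_(k < K) g k * f (iter k T x))%R.
have mS : measurable_fun setT S.
  apply: measurable_sum => k; apply: measurable_funM; first exact: measurable_cst.
  exact: measurableT_comp.
pose sq (h : X -> R) x := ((h x) ^+ 2)%:E.
have msq h : measurable_fun setT h -> measurable_fun setT (sq h).
  by move=> mh; apply/measurable_EFinP; exact: measurable_funX.
have sq0 h x : 0 <= sq h x by rewrite lee_fin sqr_ge0.
have sumc (c : \bar R) (M : nat) : 0 <= c -> \sum_(m < M) c = M%:R%:E * c.
  move=> c0; elim: M => [|M IH]; first by rewrite big_ord0 mul0e.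
  by rewrite big_ord_recr/= IH -[M.+1%:R]natr1 EFinD ge0_muleDl ?lee_fin// mul1e.
have int_sq h m : measurable_fun setT h ->
    \int[mu]_x sq h (iter m T x) = \int[mu]_x sq h x.
  by move=> mh; apply: int_iter => //; exact: msq.
have key (M : nat) : M%:R%:E * \int[mu]_x sq S x <=
    (B * (M + K)%:R)%:E * \int[mu]_x sq f x.
  have -> : M%:R%:E * \int[mu]_x sq S x =
      \int[mu]_x (\sum_(m < M) sq S (iter m T x)).
    rewrite ge0_integral_sum//; last first.
      by move=> m; apply: measurableT_comp => //; exact: msq.
    under eq_bigr => m _ do rewrite int_sq//.
    by rewrite sumc// integral_ge0.
  have -> : (B * (M + K)%:R)%:E * \int[mu]_x sq f x =
      \int[mu]_x (B%:E * \sum_(m < M + K) sq f (iter m T x)).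
    rewrite ge0_integralZl_EFin//; last 2 first.
    - by move=> x _; apply: sume_ge0.
    - apply: emeasurable_sum => m; apply: measurableT_comp => //; exact: msq.
    rewrite ge0_integral_sum//; last first.
      by move=> m; apply: measurableT_comp => //; exact: msq.
    under eq_bigr => m _ do rewrite int_sq//.
    by rewrite sumc ?integral_ge0// EFinM muleA.
  apply: ge0_le_integral => //.
  - by move=> x _; apply: sume_ge0.
  - apply: emeasurable_sum => m; apply: measurableT_comp => //; exact: msq.
  - apply: measurable_funeM.
    apply: emeasurable_sum => m; apply: measurableT_comp => //; exact: msq.
  - move=> x _; rewrite !sumEFin -EFinM lee_fin.
    have := @transference R g K B gB (fun i => f (iter i T x)) M.
    congr (_ <= _)%R; apply: eq_bigr => m _; congr (_ ^+ 2)%R.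
    by apply: eq_bigr => k _; rewrite addnC iterD.
have J0 : 0 <= \int[mu]_x sq f x by apply: integral_ge0.
have I0 : 0 <= \int[mu]_x sq S x by apply: integral_ge0.
move: key J0 I0; rewrite -/(sq f) in if2 *; rewrite -/(sq S).
have fJ : \int[mu]_x sq f x \is a fin_num.
  by rewrite ge0_fin_numE//; apply: integral_ge0.
rewrite -[X in _ <= _ * X](fineK fJ) -(fineK fJ).
set J := fine _; move: (\int[mu]_x sq S x) => -[r| |] // key; last first.
  by move: (key 1%N); rewrite mul1e -EFinM leye_eq.
rewrite -EFinM !lee_fin => J0 r0; rewrite leNgt; apply/negP => h.
(* If the bound failed by [r - B J > 0], the excess [M (r - B J)] would outgrow the fixed boundary
   cost [B K J]. *)
pose M := (Num.truncn (B * K%:R * J / (r - B * J))).+1.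
have := key M; rewrite -!EFinM lee_fin leNgt => /negP; apply.
have : (B * K%:R * J < M%:R * (r - B * J))%R.
  by rewrite -ltr_pdivrMr ?subr_gt0// truncnS_gt.
by rewrite natrD; lra.
Qed.

Lemma integral_lty_of_sqr (f : X -> R) : measurable_fun setT f ->
  (forall x, (0 <= f x)%R) -> \int[mu]_x ((f x) ^+ 2)%:E < +oo ->
  \int[mu]_x (f x)%:E < +oo.
Proof.
move=> mf f0 if2.
apply: (@le_lt_trans _ _ (\int[mu]_x (1 + ((f x) ^+ 2)%:E))).
  apply: ge0_le_integral => //.
  - by move=> x _; rewrite lee_fin.
  - exact/measurable_EFinP.
  - apply: emeasurable_funD; first exact: measurable_cst.
    by apply/measurable_EFinP; exact: measurable_funX.
  - by move=> x _; rewrite -EFinD lee_fin; have := sqr_ge0 (f x - 1); have := f0 x; nra.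
rewrite ge0_integralD//; last 2 first.
- by move=> x _; rewrite lee_fin sqr_ge0.
- by apply/measurable_EFinP; exact: measurable_funX.
rewrite integral_cst// mul1e lte_add_pinfty//.
by rewrite -ge0_fin_numE// fin_num_measure.
Qed.

Theorem weighted_mean_cvg0 (f : X -> R) (g : nat -> R) (C e : R) (K0 : nat) :
  measurable_fun setT f -> (forall x, (0 <= f x)%R) ->
  \int[mu]_x ((f x) ^+ 2)%:E < +oo ->
  (forall k, (`|g k| <= 1)%R) -> (0 < e)%R -> (0 <= C)%R ->
  (forall K t, (K0 <= K)%N ->
    (\sum_(k < K) g k * cos (k%:R * t)) ^+ 2 +
    (\sum_(k < K) g k * sin (k%:R * t)) ^+ 2 <=
      C * K%:R ^+ 2 / ln K%:R `^ (1 + e))%R ->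
  {ae mu, forall x,
    ((\sum_(k < n) g k * f (iter k T x)) / n%:R)%R @[n --> \oo] --> (0%R : R)}.
Proof.
move=> mf f0 if2 g1 e0 C0 hg.
have if1 := integral_lty_of_sqr mf f0 if2.
have hB := birkhoff mT muT mf f0 if1.
pose J := fine (\int[mu]_x ((f x) ^+ 2)%:E).
have J0 : (0 <= J)%R by apply: fine_ge0; apply: integral_ge0 => x _; rewrite lee_fin sqr_ge0.
have JE : \int[mu]_x ((f x) ^+ 2)%:E = J%:E.
  by rewrite fineK// ge0_fin_numE//; apply: integral_ge0 => x _; rewrite lee_fin sqr_ge0.
(* Starting at [2 >= 1 + 1 / (q + 1)] gains one factor, so [ln (n q i)] is at least [(i + 1) b],
   which is positive from [i = 0] on. *)
pose n0 := maxn K0 2.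
pose n q := geometric_times q.+1 n0.
have hq q : {ae mu, forall x,
    ((\sum_(k < n q i) g k * f (iter k T x)) / (n q i)%:R)%R @[i --> \oo] --> (0%R : R)}.
  pose b : R := ln (1 + q.+1%:R^-1).
  have qi : (0 < q.+1%:R^-1 :> R)%R by rewrite invr_gt0 ltr0n.
  have b0 : (0 < b)%R by rewrite ln_gt0// ltrDl.
  have nb i : (i.+1%:R * b <= ln (n q i)%:R)%R.
    have h : ((1 + q.+1%:R^-1) ^+ i.+1 <= (n q i)%:R :> R)%R.
      apply: le_trans (@geometric_times_ge R q.+1 n0 i isT).
      rewrite exprS ler_wpM2r ?exprn_ge0 ?addr_ge0 ?(ltW qi)//.
      apply: (@le_trans _ _ 2%:R); last by rewrite ler_nat leq_maxr.
      by rewrite -[X in (_ <= X)%R]natr1 lerD2l invf_le1 ?ltr0n// ler1n.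
    have -> : (i.+1%:R * b = ln ((1 + q.+1%:R^-1) ^+ i.+1))%R.
      by rewrite lnXn ?addr_gt0// mulr_natl.
    by rewrite ler_ln// posrE ?exprn_gt0 ?addr_gt0//; apply: lt_le_trans h; rewrite exprn_gt0 ?addr_gt0.
  (* The assumed bound divided by [K ^ 2], with [ln K] replaced by its lower bound [(i + 1) b]: a
     convergent series since [e > 0]. *)
  pose c i := (C * J / (b `^ (1 + e)) * (i.+1%:R `^ (1 + e))^-1)%R.
  have nK0 i : (K0 <= n q i)%N.
    elim: i => [|i IH]; first by rewrite leq_maxl.
    exact: leq_trans IH (ltnW (geometric_times_increasing _ _ _)).
  have ngt0 i : (0 < (n q i)%:R :> R)%R.
    rewrite ltr0n; elim: i => [|i IH]; first by rewrite leq_max orbT.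
    exact: ltn_trans IH (geometric_times_increasing _ _ _).
  pose F i x := (((\sum_(k < n q i) g k * f (iter k T x)) / (n q i)%:R) ^+ 2)%R.
  have mF i : measurable_fun setT (F i).
    apply: measurable_funX; apply: measurable_funM => //.
    apply: measurable_sum => k; apply: measurable_funM; first exact: measurable_cst.
    exact: measurableT_comp.
  have cC : (0 <= C * J / (b `^ (1 + e)))%R.
    by rewrite divr_ge0 ?mulr_ge0 ?powR_ge0.
  have : {ae mu, forall x, F ^~ x @ \oo --> (0%R : R)}.
    apply: (@ae_cvg0_of_summable F c (C * J / (b `^ (1 + e)) * (1 + e^-1))%R) => //.
    - by move=> i x; exact: sqr_ge0.
    - move=> i; under eq_integral do rewrite /F exprMn EFinM muleC.
      rewrite ge0_integralZl_EFin ?sqr_ge0//; last 2 first.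
      + by move=> x _; rewrite lee_fin sqr_ge0.
      + apply/measurable_EFinP/measurable_funX; apply: measurable_sum => k.
        apply: measurable_funM; first exact: measurable_cst.
        exact: measurableT_comp.
      apply: (le_trans (lee_wpmul2l _ (L2_bound mf if2 (fun t => hg _ t (nK0 i))))).
        by rewrite lee_fin sqr_ge0.
      rewrite JE -!EFinM lee_fin /c.
      have lnb : (b `^ (1 + e) * i.+1%:R `^ (1 + e) <= ln (n q i)%:R `^ (1 + e))%R.
        rewrite -powRM ?(ltW b0)// mulrC ge0_ler_powR// ?nnegrE ?mulr_ge0 ?(ltW b0)//.
        - by rewrite addr_ge0// ltW.
        - by apply: le_trans (nb i); rewrite mulr_ge0 ?(ltW b0).
      have p1 : (0 < b `^ (1 + e) * i.+1%:R `^ (1 + e))%R.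
        by rewrite mulr_gt0// powR_gt0// ltr0n.
      have -> : ((n q i)%:R^-1 ^+ 2 * (C * (n q i)%:R ^+ 2 /
          ln (n q i)%:R `^ (1 + e) * J) = C * J * (ln (n q i)%:R `^ (1 + e))^-1)%R.
        by field; rewrite !gt_eqF//; exact: lt_le_trans p1 lnb.
      rewrite -[leRHS]mulrA -invfM ler_wpM2l ?mulr_ge0// lef_pV2 ?posrE//.
      exact: lt_le_trans p1 lnb.
    - move=> m; rewrite /c -mulr_sumr ler_wpM2l//; exact: p_series_bound.
  apply: filterS => x; rewrite /F => h.
  apply/cvgrPdist_le => eps eps0; move/cvgrPdist_le : h.
  move=> /(_ (eps ^+ 2)%R (exprn_gt0 _ eps0)); apply: filterS => i.
  rewrite !sub0r !normrN normrX ler_pXn2r ?nnegrE//; exact: ltW.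
have /ae_foralln hq' := hq.
apply: filterS2 hB hq' => x /cvg_ex[l hl] hx.
apply: (@mean_cvg0_of_subsequences R (fun k => f (iter k T x)) g l) => //.
by move=> q; exists n0; exact: hx.
Qed.
End weighted_ergodic.

(** * Sawtooth weights and the Fejer kernel *)

Section fejer.
Context {R : realType}.
Implicit Types (x y s eta l : R) (J M m k n : nat).

Definition fejer J y : R :=
  ((\sum_(j < J) cos (j%:R * (2 * pi * y))) ^+ 2 +
   (\sum_(j < J) sin (j%:R * (2 * pi * y))) ^+ 2) / J%:R.

Lemma fejer_ge0 J y : 0 <= fejer J y.
Proof. by rewrite divr_ge0 ?addr_ge0 ?sqr_ge0. Qed.

Lemma fejerE J y : fejer J y =
  (\sum_(i < J) \sum_(j < J) cos (2 * pi * (i%:R - j%:R) * y)) / J%:R.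
Proof.
rewrite /fejer; congr (_ / _); rewrite !expr2 !mulr_suml -big_split/=.
apply: eq_bigr => i _; rewrite !mulr_sumr -big_split/=; apply: eq_bigr => j _.
have -> : 2 * pi * (i%:R - j%:R) * y =
  i%:R * (2 * pi * y) - j%:R * (2 * pi * y) by ring.
by rewrite cosB.
Qed.

Lemma fejer_mean J M y : (0 < J <= M)%N ->
  (\sum_(m < M) fejer J (y - m%:R / M%:R)) / M%:R = 1.
Proof.
move=> /andP[J0 JM]; have M0 : (0 < M)%N by exact: leq_trans JM.
have Jr : J%:R != 0 :> R by rewrite pnatr_eq0 -lt0n.
have Mr : M%:R != 0 :> R by rewrite pnatr_eq0 -lt0n.
under eq_bigr do rewrite fejerE.
rewrite -mulr_suml exchange_big/=.
rewrite (eq_bigr (fun=> M%:R)); last first.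
  move=> i _; rewrite exchange_big/= (bigD1 i)//= [X in _ + X]big1 ?addr0.
    under eq_bigr do rewrite subrr mulr0 mul0r cos0.
    by rewrite sumr_const card_ord.
  move=> j ji; under eq_bigr => m _.
    have -> : 2 * pi * (i%:R - j%:R) * (y - m%:R / M%:R) =
        2 * pi * (i%:R - j%:R) * y + m%:R * (2 * pi * (j%:Z - i%:Z)%:~R / M%:R).
      by rewrite rmorphB/= -!pmulrn; field.
    over.
  apply: sum_cos_eq0.
  have : (j : nat) != i by [].
  by have := ltn_ord i; have := ltn_ord j; lia.
by rewrite sumr_const card_ord -[X in X / _ / _]mulr_natl; field; apply/andP.
Qed.

(** [dirichlet_kernel] bounds the cosine sum and, after a quarter turn, the sine sum by
    [1 / |sin (pi y)|] each; adding the two squares gives the factor [2]. *)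
Lemma fejer_le J y s : (0 < J)%N -> 0 < s -> s <= `|sin (pi * y)| ->
  fejer J y <= 2 / (J%:R * s ^+ 2).
Proof.
move=> J0 s0 sy; have Jr : 0 < J%:R :> R by rewrite ltr0n.
set h := 2 * pi * y; have hE : h / 2 = pi * y by rewrite /h; field.
set C := \sum_(j < J) cos (j%:R * h); set D := \sum_(j < J) sin (j%:R * h).
have two (v w : R) : -1 <= v <= 1 -> -1 <= w <= 1 -> (v - w) ^+ 2 <= 4.
  by move=> /andP[? ?] /andP[? ?]; nra.
have bs z : -1 <= sin z <= 1 by rewrite sin_geN1 sin_le1.
have hC : (2 * sin (pi * y) * C) ^+ 2 <= 4.
  have := @dirichlet_kernel R 0 h J.
  under eq_bigr do rewrite add0r.
  by rewrite hE => ->; apply: two.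
have hD : (2 * sin (pi * y) * D) ^+ 2 <= 4.
  have := @dirichlet_kernel R (- (pi / 2)) h J.
  under eq_bigr do rewrite addrC cosBpihalf.
  by rewrite hE => ->; apply: two.
have s2 : s ^+ 2 <= sin (pi * y) ^+ 2.
  by rewrite -[leRHS]real_normK ?num_real// lerXn2r ?nnegrE// ltW.
have CD : s ^+ 2 * (C ^+ 2 + D ^+ 2) <= 2.
  have : 0 <= C ^+ 2 + D ^+ 2 by rewrite addr_ge0 ?sqr_ge0.
  by rewrite !exprMn in hC hD; nra.
rewrite /fejer -/h -/C -/D ler_pdivrMr// mulrAC ler_pdivlMr ?mulr_gt0 ?exprn_gt0//.
by rewrite mulrCA [leRHS]mulrC ler_pM2l// mulrC.
Qed.

Lemma near_int_or_sin eta y : 0 < eta -> eta <= 1 / 2 ->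
  (exists n : int, `|y - n%:~R| <= eta) \/ sin (pi * eta) <= `|sin (pi * y)|.
Proof.
move=> e0 e1; have p0 := @pi_gt0 R.
pose n := Num.floor (y + 1 / 2).
have [n1 n2] : n%:~R <= y + 1 / 2 /\ y + 1 / 2 < n%:~R + 1.
  by split; [exact: ge_floor|rewrite -intrD1; exact: lt_succ_floor].
have [le|gt] := leP `|y - n%:~R| eta; [by left; exists n|right].
have -> : `|sin (pi * y)| = `|sin (pi * (y - n%:~R))|.
  have sgn z : `|sin (pi * z + pi)| = `|sin (pi * z)|.
    by rewrite sinDpi normrN.
  have shift (j : nat) z : `|sin (pi * (z + j%:R))| = `|sin (pi * z)|.
    elim: j => [|j IH]; first by rewrite addr0.
    by rewrite -natr1 addrA mulrDr mulr1 sgn IH.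
  case: (n) => j; first by rewrite -[in LHS](subrK j%:R y) shift.
  by rewrite NegzE mulrNz opprK -pmulrn shift.
have -> : `|sin (pi * (y - n%:~R))| = `|sin (pi * `|y - n%:~R|)|.
  have [z0|z0] := leP 0 (y - n%:~R); first by rewrite (ger0_norm z0).
  by rewrite (ltr0_norm z0) mulrN sinN normrN.
apply: le_trans (ler_norm _).
have z1 : `|y - n%:~R| <= 1 / 2 by rewrite ler_norml; apply/andP; split; lra.
by rewrite le_eqVlt (ltr_sin _ _) ?in_itv/=; [rewrite ltr_pM2l ?gt ?orbT|nra|nra].
Qed.

Section sandwich.
Variables (u : nat -> R) (l : R) (x : nat -> R) (nu : nat -> int).
Hypothesis u0 : forall k, 0 <= u k.
Hypothesis ul : (\sum_(k < n) u k) / n%:R @[n --> \oo] --> l.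
Hypothesis hcos : forall i j : nat, i <> j ->
  (\sum_(k < n) cos (2 * pi * (i%:R - j%:R) * x k) * u k) / n%:R @[n --> \oo] --> (0 : R).
Hypothesis hsin : forall i j : nat, i <> j ->
  (\sum_(k < n) sin (2 * pi * (i%:R - j%:R) * x k) * u k) / n%:R @[n --> \oo] --> (0 : R).
Hypothesis xnu : forall k, x k <= (nu k)%:~R <= x k + 1.

Let cvg_sumr (I : finType) (F : I -> nat -> R) (L : I -> R) :
  (forall i, F i n @[n --> \oo] --> L i) ->
  \sum_i F i n @[n --> \oo] --> \sum_i L i.
Proof.
move=> h; rewrite (_ : (fun n => \sum_i F i n) = \sum_i F i); last first.
  by apply/funext => n; rewrite fct_sumE.
apply: (big_ind2 (fun (f : nat -> R) (z : R) => f @ \oo --> z)) => //.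
  exact: cvg_cst.
by move=> f a g b; exact: cvgD.
Qed.

(** Only the diagonal [i = j] of the double sum survives: each of its [J] terms tends to [l], and
    the others vanish once [cos (a (x k - s))] is expanded. *)
Let fejer_limit J s : (0 < J)%N ->
  (\sum_(k < n) fejer J (x k - s) * u k) / n%:R @[n --> \oo] --> l.
Proof.
move=> J0; have Jr : J%:R != 0 :> R by rewrite pnatr_eq0 -lt0n.
pose G (i j : 'I_J) (n : nat) :=
  (\sum_(k < n) cos (2 * pi * (i%:R - j%:R) * (x k - s)) * u k) / n%:R.
rewrite (_ : (fun n => _) = (fun n => J%:R^-1 * \sum_i \sum_j G i j n)); last first.
  apply/funext => n; rewrite /G mulr_sumr.
  under [RHS]eq_bigr => i _.
    rewrite mulr_sumr; under eq_bigr do rewrite mulr_suml mulr_sumr.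
    rewrite exchange_big/=; over.
  rewrite exchange_big/= mulr_suml; apply: eq_bigr => k _.
  rewrite fejerE !mulr_suml; apply: eq_bigr => i _.
  by rewrite !mulr_suml; apply: eq_bigr => m _; ring.
have -> : l = J%:R^-1 * \sum_(i < J) \sum_(j < J) (if i == j then l else 0).
  rewrite (eq_bigr (fun=> l)) => [|i _].
    by rewrite sumr_const card_ord -[l *+ J]mulr_natl mulrA mulVf// mul1r.
  by rewrite (bigD1 i)//= eqxx big1 ?addr0// => j /negbTE; rewrite eq_sym => ->.
apply: cvgM; first exact: cvg_cst.
apply: cvg_sumr => i; apply: cvg_sumr => j; rewrite /G.
have [/eqP eij|nij] := boolP (i == j).
  rewrite -eij.
  by under eq_fun do under eq_bigr do rewrite subrr mulr0 mul0r cos0 mul1r.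
set a := 2 * pi * (i%:R - j%:R).
have ij : (i : nat) <> j by move=> e; move/negP: nij; apply; apply/eqP/val_inj.
rewrite (_ : (fun n => _) = (fun n =>
    cos (a * s) * ((\sum_(k < n) cos (a * x k) * u k) / n%:R) +
    sin (a * s) * ((\sum_(k < n) sin (a * x k) * u k) / n%:R))); last first.
  apply/funext => n; rewrite !mulrA -mulrDl !mulr_sumr -big_split/=.
  by congr (_ / _); apply: eq_bigr => k _; rewrite mulrBr cosB; ring.
rewrite -[X in _ --> X](_ : cos (a * s) * 0 + sin (a * s) * 0 = 0); last by rewrite !mulr0 addr0.
by apply: cvgD; (apply: cvgM; first exact: cvg_cst); [exact: hcos|exact: hsin].
Qed.

Let h k : R := (nu k)%:~R - x k.

Let h01 k : 0 <= h k <= 1.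
Proof. by have /andP[? ?] := xnu k; rewrite /h; lra. Qed.

(* The sawtooth [h] is squeezed between two step functions sampled at the
   points [m / M]; near the jump the bounds are relaxed by [1]. *)
Let cp eta s : R := 1 - s + eta + (if 1 - eta <= s then 1 else 0).
Let cm eta s : R := 1 - s - eta - (if s <= eta then 1 else 0).

(** Here [x k] is within [eta] of [n + s]. If [s + eta < 1], this forces [nu k <= n + 1], and if
    [s > eta], it forces [nu k >= n + 1]; in the remaining cases the relaxed bounds are trivial. *)
Let near_bounds eta s k (n : int) : 0 < eta -> 0 <= s < 1 ->
  `|x k - s - n%:~R| <= eta -> cm eta s <= h k <= cp eta s.
Proof.
move=> e0 /andP[s0 s1]; rewrite ler_norml => /andP[n1 n2].
have /andP[k1 k2] := xnu k; have /andP[k3 k4] := h01 k; apply/andP; split.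
  rewrite /cm; case: ifPn => [_|]; first by lra.
  rewrite -ltNge => es.
  have : n%:~R < (nu k)%:~R :> R by lra.
  by rewrite ltr_int -lezD1 -(ler_int R) intrD1 /h; lra.
rewrite /cp; case: ifPn => [_|]; first by lra.
rewrite -ltNge => es.
have : (nu k)%:~R < (n + 2)%:~R :> R by rewrite rmorphD/=; lra.
rewrite ltr_int => n3.
have : nu k <= n + 1 by lia.
by rewrite -(ler_int R) intrD1 /h; lra.
Qed.

Let pointwise_bounds eta J s rho k : (0 < J)%N -> 0 < eta <= 1 / 2 ->
  0 <= s < 1 -> rho = 2 / (J%:R * sin (pi * eta) ^+ 2) ->
  cm eta s * fejer J (x k - s) - rho <= h k * fejer J (x k - s) <=
    cp eta s * fejer J (x k - s) + rho.
Proof.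
move=> J0 /andP[e0 e1] s01 rhoE; have /andP[s0 s1] := s01.
have sp : 0 < sin (pi * eta).
  by rewrite sin_gt0_pi// mulr_gt0 ?pi_gt0//= gtr_pMr ?pi_gt0//; lra.
have rho0 : 0 <= rho by rewrite rhoE divr_ge0// mulr_ge0// sqr_ge0.
have F0 := fejer_ge0 J (x k - s); set F := fejer J _ in F0 *.
have /andP[k3 k4] := h01 k.
have [[n hn]|far] := near_int_or_sin (x k - s) e0 e1.
  have /andP[b1 b2] := near_bounds e0 s01 hn.
  have := ler_wpM2r F0 b1; have := ler_wpM2r F0 b2; lra.
(* Away from the integers the kernel is at most [rho]; as [h k] lies in [[0, 1]], the term [rho]
   alone makes up for the missing comparison. *)
have := fejer_le J0 sp far; rewrite -rhoE -/F => Frho.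
have c1 : cm eta s <= 1 by rewrite /cm; case: ifP => _; lra.
have c2 : 0 <= cp eta s by rewrite /cp; case: ifP => _; lra.
by apply/andP; split; nra.
Qed.

(** Each bound deviates from [1 - s] by [1 / q] and, on a fraction of about [1 / q] of the grid, by
    another [1]; rounding in the Riemann sum and in the count costs at most [1 / q] more. The grid
    size [q J] puts the cut [1 / q] at the grid point [J] and is at least [J], as [fejer_mean]
    demands. *)
Let mean_cp q J : (1 < q)%N -> (0 < J)%N ->
  (\sum_(m < q * J) cp q%:R^-1 (m%:R / (q * J)%:R)) / (q * J)%:R <= 1 / 2 + 3 / q%:R /\
  1 / 2 - 3 / q%:R <= (\sum_(m < q * J) cm q%:R^-1 (m%:R / (q * J)%:R)) / (q * J)%:R.
Proof.
move=> q1 J0; set M := (q * J)%N.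
have qr : 0 < q%:R :> R by rewrite ltr0n; lia.
have Jr : 0 < J%:R :> R by rewrite ltr0n.
have J1 : 1 <= J%:R :> R by rewrite ler1n.
have Mr : 0 < M%:R :> R by rewrite ltr0n muln_gt0 J0 andbT; lia.
have MqJ : M%:R = q%:R * J%:R :> R by rewrite natrM.
have arith : \sum_(m < M) (m%:R / M%:R) = (M%:R - 1) / 2 :> R.
  rewrite -mulr_suml; suff -> : \sum_(m < M) m%:R = M%:R * (M%:R - 1) / 2 :> R.
    by field; rewrite gt_eqF.
  elim: (M) => [|n IH]; first by rewrite big_ord0 !mul0r.
  by rewrite big_ord_recr/= IH -[n.+1%:R]natr1; field.
have cst (c : R) : \sum_(m < M) c = c * M%:R by rewrite sumr_const card_ord mulr_natr.
have countge (a n : nat) : \sum_(m < n) (if (a <= m)%N then 1 else 0) = (n - a)%:R :> R.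
  elim: n => [|n IH]; first by rewrite big_ord0 sub0n.
  rewrite big_ord_recr/= IH; case: leqP => an; last by rewrite addr0; congr _%:R; lia.
  by rewrite natr1; congr _%:R; lia.
have countle (a n : nat) : \sum_(m < n) (if (m <= a)%N then 1 else 0) <= (a + 1)%:R :> R.
  apply: (@le_trans _ _ (minn n (a + 1))%:R); last by rewrite ler_nat geq_minr.
  elim: n => [|n IH]; first by rewrite big_ord0 min0n.
  rewrite big_ord_recr/=; case: leqP => an.
    by apply: (@le_trans _ _ ((minn n (a + 1))%:R + 1)); [rewrite lerD2r|rewrite natr1 ler_nat; lia].
  by rewrite addr0; apply: le_trans IH _; rewrite ler_nat; lia.
have qi : q%:R^-1 = J%:R / M%:R :> R by rewrite MqJ; field; rewrite !gt_eqF.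
have upE (m : nat) : (1 - q%:R^-1 <= m%:R / M%:R :> R) = (M - J <= m)%N.
  rewrite qi ler_pdivlMr// mulrBl mul1r divfK ?gt_eqF//.
  by rewrite lerBlDr -natrD ler_nat; lia.
have dnE (m : nat) : (m%:R / M%:R <= q%:R^-1 :> R) = (m <= J)%N.
  by rewrite qi ler_pM2r ?invr_gt0// ler_nat.
have JM : (J <= M)%N by rewrite /M leq_pmull//; lia.
have iM : q%:R^-1 * M%:R = J%:R :> R by rewrite qi divfK ?gt_eqF.
split.
  rewrite ler_pdivrMr// /cp !big_split/= sumrN arith !cst iM.
  under eq_bigr do rewrite upE.
  rewrite countge subKn// [leRHS]mulrDl -[3 / _ * _]mulrA iM; lra.
rewrite ler_pdivlMr// /cm !big_split/= !sumrN arith !cst iM.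
under eq_bigr do rewrite dnE.
have := countle J M; rewrite natrD => cJ.
by rewrite [leLHS]mulrBl -[3 / _ * _]mulrA iM; lra.
Qed.

(** Averaged over the shifts [m / M] the kernel equals [1], so [h k] is the average of [h k] times
    the kernel, to which the step bounds apply. The order of choices matters: [q] for the width of
    the steps, then [J], depending on [sin (pi / q)], for the tail of the kernel. *)
Lemma sawtooth_mean :
  (\sum_(k < n) ((nu k)%:~R - x k) * u k) / n%:R @[n --> \oo] --> l / 2.
Proof.
have l0 : 0 <= l.
  by apply: (cvgr_to_ge ul); apply: nearW => n; rewrite divr_ge0// sumr_ge0.
apply/cvgrPdist_le => eps eps0.
pose q := (Num.truncn (12 * l / eps)).+2.
have q1 : (1 < q)%N by [].
have qr : 0 < q%:R :> R by rewrite ltr0n.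
have hq : 3 / q%:R * l <= eps / 4.
  rewrite mulrAC ler_pdivrMr//.
  have : 12 * l / eps <= q%:R.
    by apply/ltW/(lt_le_trans (truncnS_gt _)); rewrite ler_nat.
  by rewrite ler_pdivrMr//; lra.
pose eta : R := q%:R^-1.
have eta0 : 0 < eta <= 1 / 2.
  by rewrite invr_gt0 qr/= mul1r lef_pV2 ?posrE// ler_nat.
pose sg := sin (pi * eta).
have sg0 : 0 < sg.
  have /andP[e0 e1] := eta0.
  by rewrite sin_gt0_pi// mulr_gt0 ?pi_gt0//= gtr_pMr ?pi_gt0//; lra.
pose J := (Num.truncn (8 * l / (sg ^+ 2 * eps))).+1.
have J0 : (0 < J)%N by [].
have Jr : 0 < J%:R :> R by rewrite ltr0n.
pose rho := 2 / (J%:R * sg ^+ 2).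
have hrho : rho * l <= eps / 4.
  rewrite /rho mulrAC ler_pdivrMr ?mulr_gt0 ?exprn_gt0//.
  have : 8 * l / (sg ^+ 2 * eps) <= J%:R by apply/ltW; exact: truncnS_gt.
  by rewrite ler_pdivrMr ?mulr_gt0 ?exprn_gt0//; lra.
pose M := (q * J)%N.
have M0 : (0 < M)%N by rewrite muln_gt0.
have Mr : 0 < M%:R :> R by rewrite ltr0n.
have [mcp mcm] := mean_cp q1 J0.
pose W (c : R -> R -> R) n := \sum_(m < M) c eta (m%:R / M%:R) / M%:R *
  ((\sum_(k < n) fejer J (x k - m%:R / M%:R) * u k) / n%:R).
have Wl c : W c n @[n --> \oo] --> \sum_(m < M) c eta (m%:R / M%:R) / M%:R * l.
  apply: cvg_sumr => m; apply: cvgM; first exact: cvg_cst.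
  exact: fejer_limit.
pose A n := (\sum_(k < n) u k) / n%:R.
have hA : A n @[n --> \oo] --> l by [].
have up : W cp n + rho * A n @[n --> \oo] --> \sum_(m < M) cp eta (m%:R / M%:R) / M%:R * l + rho * l.
  by apply: cvgD => //; apply: cvgM => //; exact: cvg_cst.
have dn : W cm n - rho * A n @[n --> \oo] --> \sum_(m < M) cm eta (m%:R / M%:R) / M%:R * l - rho * l.
  by apply: cvgB => //; apply: cvgM => //; exact: cvg_cst.
have bounds n : W cm n - rho * A n <= (\sum_(k < n) h k * u k) / n%:R <= W cp n + rho * A n.
  have WE c : W c n = (\sum_(k < n) (\sum_(m < M) c eta (m%:R / M%:R) *
      fejer J (x k - m%:R / M%:R)) / M%:R * u k) / n%:R.
    rewrite /W; under eq_bigr do rewrite mulr_suml mulr_sumr.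
    rewrite exchange_big/= mulr_suml; apply: eq_bigr => k _.
    by rewrite !mulr_suml; apply: eq_bigr => m _; ring.
  have hE k : h k = (\sum_(m < M) h k * fejer J (x k - m%:R / M%:R)) / M%:R.
    by rewrite -mulr_sumr -mulrA fejer_mean ?mulr1// J0 leq_pmull.
  have s01 (m : 'I_M) : 0 <= (m%:R / M%:R : R) < 1.
    by rewrite divr_ge0//= ltr_pdivrMr// mul1r ltr_nat.
  have pb k := fun m : 'I_M => @pointwise_bounds eta J _ rho k J0 eta0 (s01 m) (erefl rho).
  have sumrho : (\sum_(m < M) rho) / M%:R = rho.
    by rewrite sumr_const card_ord -[rho *+ M]mulr_natr mulfK ?gt_eqF.
  rewrite !WE /A !mulrA !mulr_sumr -mulrBl -mulrDl -sumrB -big_split/=.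
  apply/andP; split; rewrite ler_wpM2r ?invr_ge0//; apply: ler_sum => k _.
    rewrite -mulrBl ler_wpM2r// [leRHS]hE -[X in _ - X]sumrho -mulrBl -sumrB.
    rewrite ler_wpM2r ?invr_ge0//; apply: ler_sum => m _.
    by have /andP[] := pb k m.
  rewrite -mulrDl ler_wpM2r// [leLHS]hE -[X in _ + X]sumrho -mulrDl -big_split/=.
  rewrite ler_wpM2r ?invr_ge0//; apply: ler_sum => m _.
  by have /andP[] := pb k m.
have e4 : 0 < eps / 4 by rewrite divr_gt0.
move/cvgrPdist_le : up => /(_ _ e4) up; move/cvgrPdist_le : dn => /(_ _ e4) dn.
rewrite -!mulr_suml in up dn.
have ucp : (\sum_(m < M) cp eta (m%:R / M%:R)) / M%:R * l <= (1 / 2 + 3 / q%:R) * l.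
  by rewrite ler_wpM2r.
have ucm : (1 / 2 - 3 / q%:R) * l <= (\sum_(m < M) cm eta (m%:R / M%:R)) / M%:R * l.
  by rewrite ler_wpM2r.
apply: filterS2 up dn => n; rewrite !ler_norml => /andP[up1 up2] /andP[dn1 dn2].
have /andP[] := bounds n; rewrite /h.
move: ucp ucm up1 up2 dn1 dn2 hq hrho; rewrite !mulrDl mulNr.
move: (W cp n + _) (W cm n - _) (_ / n%:R) (_ / M%:R * l) (_ / M%:R * l) (3 / q%:R * l) (rho * l).
move=> *; apply/andP; split; lra.
Qed.
End sandwich.
End fejer.

(** * Exponential sums along a sequence with slowly drifting gaps *)

Section slowly_bent_sequence.
Context {R : realType}.
Variables (x : nat -> R) (gam C d s : R) (Kmin : nat).
Let D k := x k.+1 - x k.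
Hypothesis Dgam : D k @[k --> \oo] --> gam.
Hypotheses (C0 : 0 < C) (d0 : 0 < d) (d1 : d <= 1) (s1 : s = 1 \/ s = -1).
Hypothesis D1 : forall k, 0 <= s * (D k.+1 - D k).
Hypothesis D2 : forall k K : nat, (Kmin <= K)%N -> (k < K)%N ->
  C * ln K%:R `^ (1 + d) / K%:R ^+ 2 <= s * (D k.+2 - D k).

Let L (K : nat) : R := ln K%:R `^ (1 + d).

(** The upper bound, from [d <= 1] and [ln K <= K], makes [K / sqrt (L K)] at least [1], so that
    additive constants can be absorbed into the final estimate. *)
Let L_bounds : exists K0 : nat, (Kmin <= K0)%N /\ forall K : nat, (K0 <= K)%N ->
  (0 < K)%N /\ 1 <= L K <= K%:R ^+ 2.
Proof.
pose K1 := (Num.truncn (expR 1 : R)).+1.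
exists (maxn Kmin K1); split => [|K]; first exact: leq_maxl.
rewrite geq_max => /andP[_ K1K].
have eK : expR 1 <= K%:R :> R.
  by apply/ltW/(lt_le_trans (truncnS_gt _)); rewrite ler_nat.
have K0 : 0 < K%:R :> R by apply: lt_le_trans eK; exact: expR_gt0.
have lnK : 1 <= ln K%:R :> R.
  by move: eK; rewrite -ler_ln ?posrE ?expR_gt0// expRK.
split; first by rewrite -(ltr0n R).
rewrite /L; apply/andP; split.
  apply: (@le_trans _ _ (ln K%:R `^ 0)); first by rewrite powRr0.
  by apply: ler_powR => //; rewrite addr_ge0// ltW.
apply: (@le_trans _ _ (ln K%:R `^ 2%:R)).
  by apply: ler_powR => //; move: d1; lra.
rewrite powR_mulrn; last by lra.
have ln0 : 0 <= ln K%:R :> R by lra.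
rewrite lerXn2r ?nnegrE//.
have := @le_ln1Dx R (K%:R - 1); rewrite addrCA subrr addr0 => h.
by apply: le_trans (h _) _; lra.
Qed.

Let center (t : R) : exists m : int, `|t - m%:~R * (2 * pi)| <= 4.
Proof.
have p0 := @pi_gt0 R; have p2 := @pihalf_lt2 R.
exists (Num.floor (t / (2 * pi) + 1 / 2)); set m := Num.floor _.
have m1 : m%:~R <= t / (2 * pi) + 1 / 2 by exact: ge_floor.
have m2 : t / (2 * pi) + 1 / 2 < m%:~R + 1.
  by rewrite -intrD1; exact: lt_succ_floor.
have e : t = t / (2 * pi) * (2 * pi) by rewrite divfK// gt_eqF// mulr_gt0.
have h1 : m%:~R * (2 * pi) <= (t / (2 * pi) + 1 / 2) * (2 * pi).
  by rewrite ler_wpM2r//; lra.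
have h2 : (t / (2 * pi) + 1 / 2) * (2 * pi) <= (m%:~R + 1) * (2 * pi).
  by rewrite ler_wpM2r ?(ltW m2)//; lra.
rewrite [(t / _ + _) * _]mulrDl -e in h1 h2.
by rewrite ler_norml; apply/andP; split; lra.
Qed.

Lemma cos_sum_bound a : a != 0 -> exists B : R, 0 <= B /\ exists K0 : nat,
  (forall K : nat, (K0 <= K)%N -> 1 <= L K) /\
  forall (K : nat) t b, (K0 <= K)%N ->
  `|\sum_(k < K) cos (a * x k + k%:R * t + b)| <= B * K%:R / Num.sqrt (L K).
Proof.
move=> a0; have na0 : 0 < `|a| by rewrite normr_gt0.
(* [center] brings the limiting increment of the phase into [[-4, 4]], and the deviation from it may
   be at most [22 / 5 - 4 = 2 / 5]. *)
have e0 : 0 < 2 / 5 / `|a| by rewrite !divr_gt0.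
move/cvgrPdist_le : (Dgam) => /(_ _ e0) [k0 _ hk0].
have [K1 [K1min hK1]] := L_bounds.
have Ca : 0 < `|a| * C by rewrite mulr_gt0.
pose r := Num.sqrt (`|a| * C).
have r0 : 0 < r by rewrite sqrtr_gt0.
exists (60 / r + k0%:R + 4); split.
  by rewrite !addr_ge0// divr_ge0// ltW.
exists (maxn K1 k0); split.
  by move=> K; rewrite geq_max => /andP[/hK1[_ /andP[]]].
move=> K t b; rewrite geq_max => /andP[KK1 Kk0].
have [Kgt0 /andP[L1 L2]] := hK1 _ KK1.
have Kr : 0 < K%:R :> R by rewrite ltr0n.
have sL1 : 1 <= Num.sqrt (L K) by rewrite -[leLHS]sqrtr1 ler_wsqrtr.
have sL2 : Num.sqrt (L K) <= K%:R.
  by rewrite -[leRHS]ger0_norm// -sqrtr_sqr ler_wsqrtr.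
have sLK : 1 <= K%:R / Num.sqrt (L K) by rewrite ler_pdivlMr ?mul1r//; lra.
(* Chosen so that [del ^ 2] is exactly [|a|] times the lower bound in [D2]. *)
pose del := r * Num.sqrt (L K) / K%:R.
have del0 : 0 < del by rewrite divr_gt0// mulr_gt0//; lra.
have del2 : del ^+ 2 = `|a| * (C * L K / K%:R ^+ 2).
  rewrite /del expr_div_n exprMn !sqr_sqrtr//; last 2 first.
  - by lra.
  - exact: ltW.
  by rewrite !mulrA.
(* The sign [sg] flips the phase if necessary, which the cosine does not see, so that the increments
   of the phase increase. *)
have [sg [sgE sga]] : exists sg : R, (sg = 1 \/ sg = -1) /\ sg * a = `|a| * s.
  have [ap|an] := leP 0 a.
    by exists s; split => //; rewrite ger0_norm// mulrC.
  exists (- s); split; first by case: s1 => ->; [right|left; rewrite opprK].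
  by rewrite ltr0_norm// mulNr mulrC mulNr.
have [m hm] := center (a * gam + t).
(* The first [k0] terms are dropped, and [i] times a multiple of [2 pi] is subtracted to bring the
   increments near the origin. Since [t] enters the increments only as a constant, the bound is
   uniform in [t]. *)
pose be (i : nat) := sg * (a * x (k0 + i)%N + (k0 + i)%:R * t + b
  - i%:R * (m%:~R * (2 * pi))).
have cosbe i : cos (be i) = cos (a * x (k0 + i)%N + (k0 + i)%:R * t + b).
  have -> : cos (be i) = cos (a * x (k0 + i)%N + (k0 + i)%:R * t + b
      - i%:R * (m%:~R * (2 * pi))).
    by rewrite /be; case: sgE => ->; rewrite ?mul1r// mulN1r cosN.
  rewrite -[RHS](cosD2piz _ (- (i%:Z * m))); congr cos.
  by rewrite rmorphN rmorphM/= -pmulrn mulNr mulrA.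
have beE i : be i.+1 - be i = `|a| * s * D (k0 + i)%N + sg * (t - m%:~R * (2 * pi)).
  by rewrite -sga /be /D addnS -[(k0 + i).+1%:R]natr1 -[i.+1%:R]natr1; ring.
have test : `|\sum_(i < K - k0) cos (be i)| <= 60 / del + 4.
  apply: second_derivative_test => // i iK; rewrite !beE.
  - have -> : `|a| * s * D (k0 + i)%N + sg * (t - m%:~R * (2 * pi)) =
        sg * (a * gam + t - m%:~R * (2 * pi)) + `|a| * s * (D (k0 + i)%N - gam).
      by rewrite -sga; ring.
    apply: le_trans (ler_normD _ _) _.
    have -> : `|sg * (a * gam + t - m%:~R * (2 * pi))| = `|a * gam + t - m%:~R * (2 * pi)|.
      by case: sgE => ->; rewrite ?mul1r// mulN1r normrN.
    have -> : `| `|a| * s * (D (k0 + i)%N - gam)| = `|a| * `|gam - D (k0 + i)%N|.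
      rewrite distrC !normrM normr_id; congr (_ * _).
      by case: s1 => ->; rewrite ?normrN normr1 mulr1.
    have := hk0 (k0 + i)%N (leq_addr _ _); rewrite ler_pdivlMr// mulrC.
    lra.
  - by have := D1 (k0 + i)%N; rewrite addnS -subr_ge0 => h; nra.
  - have ki : (k0 + i < K)%N.
      by rewrite -ltn_subRL; apply: leq_trans iK; rewrite ltnW// ltnW.
    have h := D2 (leq_trans K1min KK1) ki; rewrite del2 !addnS.
    by rewrite addrAC lerD2r -lerBrDl -mulrBr -[leRHS]mulrA ler_pM2l.
have -> : \sum_(k < K) cos (a * x k + k%:R * t + b) =
    \sum_(k < k0) cos (a * x k + k%:R * t + b) + \sum_(i < K - k0) cos (be i).
  rewrite -!(big_mkord xpredT (fun k => cos (a * x k + k%:R * t + b))).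
  rewrite (big_cat_nat (n := k0))//=; congr (_ + _).
  rewrite -{1}(subnK Kk0) sum_nat_shift; apply: eq_bigr => i _.
  by rewrite cosbe addnC.
apply: le_trans (ler_normD _ _) _.
have h1 : `|\sum_(k < k0) cos (a * x k + k%:R * t + b)| <= k0%:R.
  apply: le_trans (ler_norm_sum _ _ _) _.
  apply: (@le_trans _ _ (\sum_(k < k0) 1)); first by apply: ler_sum => k _; exact: cos_max.
  by rewrite sumr_const card_ord.
have delE : 60 / del = 60 / r * (K%:R / Num.sqrt (L K)).
  by rewrite /del; field; rewrite !gt_eqF//; lra.
rewrite delE in test.
have k04 : 0 <= k0%:R + 4 :> R by rewrite addr_ge0.
have := ler_wpM2l k04 sLK; rewrite mulr1 -mulrA.
move: test h1; move: (K%:R / _) => z; lra.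
Qed.

(** Product formulas reduce to [cos_sum_bound] with [t] and [- t]; the products with sines need the
    phase [b - pi / 2]. *)
Lemma modulated_sum_bound a b : a != 0 -> exists (C' : R) (K0 : nat), 0 <= C' /\
  forall (K : nat) t, (K0 <= K)%N ->
    (\sum_(k < K) cos (a * x k + b) * cos (k%:R * t)) ^+ 2 +
    (\sum_(k < K) cos (a * x k + b) * sin (k%:R * t)) ^+ 2 <=
      C' * K%:R ^+ 2 / ln K%:R `^ (1 + d).
Proof.
move=> /cos_sum_bound[B [B0 [K0 [hL hB]]]].
exists (2 * B ^+ 2), K0; split; first by rewrite mulr_ge0// sqr_ge0.
move=> K t KK0; rewrite -/(L K); have L1 := hL _ KK0.
set E := B * K%:R / Num.sqrt (L K).
have E0 : 0 <= E by rewrite divr_ge0 ?mulr_ge0 ?sqrtr_ge0.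
have -> : 2 * B ^+ 2 * K%:R ^+ 2 / L K = E ^+ 2 + E ^+ 2.
  rewrite /E expr_div_n sqr_sqrtr; last by lra.
  by rewrite exprMn; ring.
have sqle z : `|z| <= E -> z ^+ 2 <= E ^+ 2.
  by move=> zE; rewrite -[z ^+ 2]real_normK ?num_real// lerXn2r ?nnegrE.
apply: lerD; apply: sqle.
  rewrite (_ : \sum_(k < K) _ = (\sum_(k < K) cos (a * x k + k%:R * t + b) +
    \sum_(k < K) cos (a * x k + k%:R * (- t) + b)) / 2); last first.
    rewrite -big_split/= mulr_suml; apply: eq_bigr => k _.
    have -> : a * x k + k%:R * t + b = (a * x k + b) + k%:R * t by ring.
    have -> : a * x k + k%:R * - t + b = (a * x k + b) - k%:R * t by ring.
    by move: (a * x k + b) => th; rewrite cosB cosD; field.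
  have := hB _ t b KK0; have := hB _ (- t) b KK0; rewrite -/E => h1 h2.
  rewrite normrM [`|2^-1|]gtr0_norm ?invr_gt0// ler_pdivrMr//.
  by apply: le_trans (ler_normD _ _) _; lra.
rewrite (_ : \sum_(k < K) _ = (\sum_(k < K) cos (a * x k + k%:R * t + (b - pi / 2)) -
    \sum_(k < K) cos (a * x k + k%:R * (- t) + (b - pi / 2))) / 2); last first.
  rewrite -sumrB mulr_suml; apply: eq_bigr => k _.
  have -> : a * x k + k%:R * t + (b - pi / 2) = (a * x k + b) + k%:R * t - pi / 2 by ring.
  have -> : a * x k + k%:R * - t + (b - pi / 2) = (a * x k + b) - k%:R * t - pi / 2 by ring.
  by move: (a * x k + b) => th; rewrite !cosBpihalf sinB sinD; field.
have := hB _ t (b - pi / 2) KK0; have := hB _ (- t) (b - pi / 2) KK0; rewrite -/E => h1 h2.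
rewrite normrM [`|2^-1|]gtr0_norm ?invr_gt0// ler_pdivrMr//.
by apply: le_trans (ler_normB _ _) _; lra.
Qed.
End slowly_bent_sequence.

Section oscillation_ae.
Context {R : realType} (dX : measure_display) (X : measurableType dX)
  (mu : probability X R) (T : X -> X).
Hypothesis mT : measurable_fun [set: X] T.
Hypothesis muT : forall A : set X, measurable A -> mu (T @^-1` A) = mu A.

Lemma sawtooth_mean_ae (f : X -> R) (x : nat -> R) (gam C d s : R) (Kmin : nat)
    (nu : nat -> int) :
  measurable_fun setT f -> (forall y, 0 <= f y) ->
  (\int[mu]_y ((f y) ^+ 2)%:E < +oo)%E ->
  x k.+1 - x k @[k --> \oo] --> gam ->
  0 < C -> 0 < d -> d <= 1 -> s = 1 \/ s = -1 ->
  (forall k, 0 <= s * ((x k.+2 - x k.+1) - (x k.+1 - x k))) ->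
  (forall k K : nat, (Kmin <= K)%N -> (k < K)%N ->
    C * ln K%:R `^ (1 + d) / K%:R ^+ 2 <= s * ((x k.+3 - x k.+2) - (x k.+1 - x k))) ->
  (forall k, x k <= (nu k)%:~R <= x k + 1) ->
  {ae mu, forall y,
    cvgn (fun n => (\sum_(k < n) ((nu k)%:~R - x k) * f (iter k T y)) / n%:R)}.
Proof.
move=> mf f0 if2 xgam C0 d0 d1 s1 D1 D2 xnu.
have osc a b : a != 0 -> {ae mu, forall y,
    (\sum_(k < n) cos (a * x k + b) * f (iter k T y)) / n%:R @[n --> \oo] --> (0 : R)}.
  move=> a0; have [C' [K0 [C'0 h]]] := modulated_sum_bound xgam C0 d0 d1 s1 D1 D2 b a0.
  apply: (@weighted_mean_cvg0 _ _ _ _ _ mT muT f (fun k => cos (a * x k + b))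
    C' d K0 mf f0 if2 _ d0 C'0 h) => k.
  exact: cos_max.
have if1 := integral_lty_of_sqr mf f0 if2.
have hB := birkhoff mT muT mf f0 if1.
have p0 := @pi_gt0 R.
(* Phase [0] will give the cosine averages and phase [- (pi / 2)] the sine averages. There are
   countably many frequencies, so one null set serves them all. *)
have hosc b : {ae mu, forall y (i j : nat), i <> j ->
    (\sum_(k < n) cos (2 * pi * (i%:R - j%:R) * x k + b) * f (iter k T y)) / n%:R
      @[n --> \oo] --> (0 : R)}.
  apply/ae_foralln => i; apply/ae_foralln => j.
  have [->|/eqP ij] := eqVneq i j; first by apply: aeW => y.
  have : 2 * pi * (i%:R - j%:R) != 0 :> R.
    apply: mulf_neq0; first by rewrite mulf_neq0// gt_eqF.
    by rewrite subr_eq0 eqr_nat; apply/eqP.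
  by move/osc => /(_ b); apply: filterS => y h _.
apply: filterS3 hB (hosc 0) (hosc (- (pi / 2))) => y /cvg_ex[l hl] hc hs.
apply/cvg_ex; exists (l / 2).
apply: (@sawtooth_mean R (fun k => f (iter k T y)) l x nu) => //.
- move=> i j ij; have := hc i j ij.
  by under eq_fun do under eq_bigr do rewrite addr0.
- move=> i j ij; have := hs i j ij.
  by under eq_fun do under eq_bigr do rewrite cosBpihalf.
Qed.
End oscillation_ae.

(** * From levels to times *)

Section weighted_means.
Context {R : realType}.
Implicit Types (u e w : nat -> R) (l : R).

Lemma mean_mul_small u e l : (forall k, 0 <= u k) ->
  (\sum_(k < n) u k) / n%:R @[n --> \oo] --> l -> e @ \oo --> (0 : R) ->
  (\sum_(k < n) e k * u k) / n%:R @[n --> \oo] --> (0 : R).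
Proof.
move=> u0 ul el; apply/cvgrPdist_le => eps eps0.
have l0 : 0 <= l.
  by apply: (cvgr_to_ge ul); apply: nearW => n; rewrite divr_ge0// sumr_ge0.
have l1 : 0 < 2 * (l + 1) by lra.
have e1 : 0 < eps / (2 * (l + 1)) by rewrite divr_gt0.
move/cvgrPdist_le : el => /(_ _ e1)[k0 _ hk].
move/cvgrPdist_le : ul => /(_ _ ltr01) ul.
pose S := \sum_(k < k0) `|e k * u k|.
have S0 : 0 <= S by apply: sumr_ge0.
near=> n; rewrite sub0r normrN.
have n0 : (0 < n)%N by near: n; exists 1%N.
have nk0 : (k0 <= n)%N by near: n; exists k0.
have nr : 0 < n%:R :> R by rewrite ltr0n.
have nS : 2 * S / eps <= n%:R by near: n; exact: nbhs_infty_ger.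
have /ler_normlP[An _] : `|l - (\sum_(k < n) u k) / n%:R| <= 1 by near: n.
rewrite normrM normfV (gtr0_norm nr) ler_pdivrMr//.
apply: le_trans (ler_norm_sum _ _ _) _.
rewrite -(big_mkord xpredT (fun k => `|e k * u k|)) (big_cat_nat (n := k0))//= big_mkord.
have h1 : \sum_(k0 <= k < n) `|e k * u k| <= eps / (2 * (l + 1)) * \sum_(k < n) u k.
  rewrite -(big_mkord xpredT u) (big_cat_nat (n := k0) (p := n) (F := u))//= mulrDr.
  apply: ler_wpDl; first by apply: mulr_ge0; [exact: ltW|exact: sumr_ge0].
  rewrite mulr_sumr big_nat [leRHS]big_nat.
  apply: ler_sum => k /andP[kk _]; rewrite normrM (ger0_norm (u0 k)) ler_wpM2r//.
  by have := hk k kk; rewrite sub0r normrN.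
have h2 : \sum_(k < n) u k <= (l + 1) * n%:R.
  by rewrite -ler_pdivrMr//; move: An; rewrite opprB lerBlDl.
have h3 : eps / (2 * (l + 1)) * \sum_(k < n) u k <= eps / 2 * n%:R.
  apply: le_trans (ler_wpM2l (ltW e1) h2) _.
  by rewrite le_eqVlt; apply/orP; left; apply/eqP; field; rewrite gt_eqF//; lra.
rewrite -/S; move: nS; rewrite ler_pdivrMr// => nS.
by move: h1 h3; move: (\sum_(k0 <= k < n) _) (_ / _ * _) => y z; lra.
Unshelve. all: by end_near. Qed.

(* [|e u| <= (t W |e| + u^2 / t) / 2] for every [t > 0]. *)
Lemma mean_mul_small_density u e (W l : R) : (forall k, `|e k| <= W) ->
  (\sum_(k < n) `|e k|) / n%:R @[n --> \oo] --> (0 : R) ->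
  (\sum_(k < n) u k ^+ 2) / n%:R @[n --> \oo] --> l ->
  (\sum_(k < n) e k * u k) / n%:R @[n --> \oo] --> (0 : R).
Proof.
move=> eW e_ ul; apply/cvgrPdist_le => eps eps0.
have W0 : 0 <= W by apply: le_trans (eW 0%N).
have l0 : 0 <= l.
  apply: (cvgr_to_ge ul); apply: nearW => n; rewrite divr_ge0// sumr_ge0// => k _.
  exact: sqr_ge0.
pose t := (l + 1) / eps; have t0 : 0 < t by rewrite divr_gt0//; lra.
have e1 : 0 < eps / (t * W + 1) by rewrite divr_gt0// ltr_wpDl// mulr_ge0// ltW.
move/cvgrPdist_le : e_ => /(_ _ e1) e_; move/cvgrPdist_le : ul => /(_ _ ltr01) ul.
near=> n; rewrite sub0r normrN.
have n0 : (0 < n)%N by near: n; exists 1%N.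
have nr : 0 < n%:R :> R by rewrite ltr0n.
have : `|0 - (\sum_(k < n) `|e k|) / n%:R| <= eps / (t * W + 1) by near: n.
rewrite sub0r normrN ger0_norm ?divr_ge0 ?sumr_ge0// => En.
have /ler_normlP[An _] : `|l - (\sum_(k < n) u k ^+ 2) / n%:R| <= 1 by near: n.
set E := _ / n%:R in En; set A := _ / n%:R in An.
have key : `|(\sum_(k < n) e k * u k) / n%:R| <= (t * W * E + t^-1 * A) / 2.
  rewrite normrM normfV (gtr0_norm nr) /E /A !mulrA -mulrDl mulrAC ler_wpM2r ?invr_ge0//.
  apply: le_trans (ler_norm_sum _ _ _) _.
  rewrite !mulr_sumr -big_split/= mulr_suml; apply: ler_sum => k _.
  rewrite normrM -[u k ^+ 2]real_normK ?num_real//.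
  have h : `|e k| * `|u k| <= (t * `|e k| ^+ 2 + t^-1 * `|u k| ^+ 2) / 2.
    rewrite -subr_ge0.
    rewrite (_ : _ - _ = (t * `|e k| - `|u k|) ^+ 2 / (2 * t)); last first.
      by field; rewrite gt_eqF.
    by rewrite divr_ge0 ?sqr_ge0// mulr_ge0// ltW.
  apply: le_trans h _; rewrite ler_pM2r ?invr_gt0// lerD2r -mulrA ler_pM2l//.
  by rewrite expr2 ler_wpM2r.
apply: le_trans key _.
have tW : 0 <= t * W by rewrite mulr_ge0// ltW.
have h1 : t * W * E <= eps.
  apply: (@le_trans _ _ ((t * W + 1) * (eps / (t * W + 1)))).
    have E0 : 0 <= E by rewrite divr_ge0// sumr_ge0.
    by apply: ler_pM => //; lra.
  by rewrite mulrC divfK// gt_eqF//; lra.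
have h2 : t^-1 * A <= eps.
  rewrite ler_pdivrMl// /t divfK ?gt_eqF//; lra.
by lra.
Unshelve. all: by end_near. Qed.

Lemma invn_cvg0 : (n%:R)^-1 @[n --> \oo] --> (0 : R).
Proof. by rewrite -(@cvg_shiftS _ (fun n => (n%:R)^-1 : R)); exact: cvg_harmonic. Qed.

(** [u n] is the difference of two consecutive sums, each of which is [l n + o(n)]. This makes an
    incomplete last block negligible. *)
Lemma last_term_small u l :
  (\sum_(k < n) u k) / n%:R @[n --> \oo] --> l ->
  u n / n%:R @[n --> \oo] --> (0 : R).
Proof.
move=> ul.
have ul1 : (\sum_(k < n.+1) u k) / n.+1%:R @[n --> \oo] --> l.
  by rewrite (@cvg_shiftS _ (fun n => (\sum_(k < n) u k) / n%:R)).
have n0 := invn_cvg0.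
have : (\sum_(k < n.+1) u k) / n.+1%:R * (1 + n%:R^-1) - (\sum_(k < n) u k) / n%:R
    @[n --> \oo] --> l * (1 + 0) - l.
  by apply: cvgB => //; apply: cvgM => //; apply: cvgD => //; exact: cvg_cst.
rewrite addr0 mulr1 subrr; apply: cvg_trans; apply: near_eq_cvg.
near=> n.
have nr : 0 < n%:R :> R by rewrite ltr0n; near: n; exists 1%N.
rewrite big_ord_recr/= -natr1; field.
by rewrite !gt_eqF//; lra.
Unshelve. all: by end_near. Qed.

Section blocks.
Variables (u F : nat -> R) (nu : nat -> nat) (W gam l v : R).
Hypothesis u0 : forall k, 0 <= u k.
Hypothesis nu_nd : forall k, (nu k <= nu k.+1)%N.
Hypothesis nuW : forall k, (nu k.+1 - nu k)%:R <= W.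
Hypothesis Fu : forall k n, (nu k <= n < nu k.+1)%N -> F n = u k.
Hypothesis gam0 : 0 < gam.
Hypothesis nu_gam : (nu k)%:R / k%:R @[k --> \oo] --> gam.
Hypothesis ul : (\sum_(k < n) u k) / n%:R @[n --> \oo] --> l.
Hypothesis wv :
  (\sum_(k < n) (nu k.+1 - nu k)%:R * u k) / n%:R @[n --> \oo] --> v.

Let sum_blocks K : \sum_(n < nu K) F n =
  \sum_(n < nu 0%N) F n + \sum_(k < K) (nu k.+1 - nu k)%:R * u k.
Proof.
elim: K => [|K IH]; first by rewrite big_ord0 addr0.
rewrite big_ord_recr/= addrA -IH -!(big_mkord xpredT F).
rewrite (big_cat_nat (n := nu K))//=; congr (_ + _).
rewrite big_nat (eq_bigr (fun=> u K)); last by move=> n; exact: Fu.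
by rewrite -big_nat sumr_const_nat mulr_natl.
Qed.

Let nu_unbounded A : exists K, (A < nu K)%N.
Proof.
have g0 := gam0; have g2 : gam / 2 < gam by lra.
have [k0 _ h] := cvgr_gt _ nu_gam _ g2.
pose K := maxn k0.+1 (Num.truncn (A%:R * 2 / gam)).+1.
exists K; have := h K ltac:(by rewrite /= /K; lia).
have Kr : 0 < K%:R :> R by rewrite ltr0n /K; lia.
rewrite ltr_pdivlMr// => h1; rewrite -(ltr_nat R); apply: lt_trans h1.
have : A%:R * 2 / gam < K%:R.
  by apply: lt_le_trans (truncnS_gt _) _; rewrite ler_nat leq_maxr.
rewrite ltr_pdivrMr//; lra.
Qed.

(** Let [K] be the block that contains [M]. The full blocks contribute [v K + o(K)], the broken one
    at most [W u K = o(K)], and [M / K] tends to [gam]. *)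
Lemma block_mean : (\sum_(n < M) F n) / M%:R @[M --> \oo] --> v / gam.
Proof.
have /choice[K hK] : forall M, exists K, (nu 0%N <= M)%N -> (nu K <= M < nu K.+1)%N.
  move=> M; have h : exists K, (M < nu K.+1)%N.
    by have [K hK] := nu_unbounded M; exists K; exact: leq_trans hK (nu_nd _).
  case: (ex_minnP h) => j hj jmin; exists j => nuM; rewrite hj andbT.
  case: j hj jmin => // j _ jmin.
  by rewrite leqNgt; apply/negP => /jmin; rewrite ltnn.
have nu_le a b : (a <= b)%N -> (nu a <= nu b)%N.
  by move=> ab; rewrite -(subnKC ab); elim: (b - a)%N => [|c IH]; rewrite ?addn0// addnS (leq_trans IH).
have Koo : K M @[M --> \oo] --> \oo.
  move=> P [A _ AP]; exists (nu A) => //= M nuM; apply: AP => /=.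
  have /andP[_ h] := hK M (leq_trans (nu_le _ _ (leq0n A)) nuM).
  by rewrite -ltnS ltnNge; apply/negP => /nu_le; rewrite leqNgt (leq_ltn_trans nuM h).
have inv0 := invn_cvg0.
(* Times before [nu 0] belong to no block; their total is a constant. *)
pose c0 := \sum_(n < nu 0%N) F n.
have G1 : (c0 + \sum_(k < n) (nu k.+1 - nu k)%:R * u k) / n%:R @[n --> \oo] --> v.
  rewrite [X in _ --> X](_ : v = c0 * 0 + v); last by rewrite mulr0 add0r.
  under eq_fun do rewrite mulrDl.
  by apply: cvgD => //; apply: cvgM => //; exact: cvg_cst.
have nu1 : (nu k.+1)%:R / k%:R @[k --> \oo] --> gam.
  have : (nu k.+1)%:R / k.+1%:R * (1 + k%:R^-1) @[k --> \oo] --> gam * (1 + 0).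
    apply: cvgM; first by rewrite (@cvg_shiftS _ (fun k => (nu k)%:R / k%:R : R)).
    by apply: cvgD => //; exact: cvg_cst.
  rewrite addr0 mulr1; apply: cvg_trans; apply: near_eq_cvg; near=> k.
  have kr : 0 < k%:R :> R by rewrite ltr0n; near: k; exists 1%N.
  by rewrite -natr1; field; rewrite !gt_eqF//; lra.
have MK : M%:R / (K M)%:R @[M --> \oo] --> gam.
  apply: (@squeeze_cvgr _ _ _ _ (fun M => (nu (K M))%:R / (K M)%:R : R)
    (fun M => (nu (K M).+1)%:R / (K M)%:R : R)).
  - exists (nu 0%N) => // M /= /hK/andP[h1 h2].
    by rewrite !ler_wpM2r ?invr_ge0//= ler_nat// ltnW.
  - exact: (cvg_comp K (fun k => (nu k)%:R / k%:R : R) Koo nu_gam).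
  - exact: (cvg_comp K (fun k => (nu k.+1)%:R / k%:R : R) Koo nu1).
have KM : (M%:R / (K M)%:R)^-1 @[M --> \oo] --> gam^-1.
  by apply: cvgV => //; rewrite gt_eqF.
have uK : u (K M) / (K M)%:R @[M --> \oo] --> (0 : R).
  exact: (cvg_comp K (fun k => u k / k%:R) Koo (last_term_small ul)).
have rest : (M - nu (K M))%:R * (u (K M) / (K M)%:R) @[M --> \oo] --> (0 : R).
  apply: (@squeeze_cvgr _ _ _ _ (fun=> 0) (fun M => W * (u (K M) / (K M)%:R))).
  - exists (nu 0%N) => // M /= /hK/andP[h1 h2].
    have uK0 : 0 <= u (K M) / (K M)%:R by rewrite divr_ge0.
    rewrite mulr_ge0//= ler_wpM2r//; apply: le_trans (nuW (K M)).
    by rewrite ler_nat leq_sub2r// ltnW.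
  - exact: cvg_cst.
  - rewrite [X in _ --> X](_ : 0 = W * 0); last by rewrite mulr0.
    by apply: cvgM => //; exact: cvg_cst.
have G2 := cvg_comp K _ Koo G1.
have : ((c0 + \sum_(k < K M) (nu k.+1 - nu k)%:R * u k) / (K M)%:R +
    (M - nu (K M))%:R * (u (K M) / (K M)%:R)) * (M%:R / (K M)%:R)^-1
    @[M --> \oo] --> (v + 0) * gam^-1.
  exact: (cvgM (cvgD G2 rest) KM).
have K_gt0 : \forall M \near \oo, (0 < K M)%N by apply: (Koo [set k | (0 < k)%N]); exists 1%N.
rewrite addr0; apply: cvg_trans; apply: near_eq_cvg; near=> M.
have nuM : (nu 0%N <= M)%N by near: M; exists (nu 0%N).
have Kr : 0 < (K M)%:R :> R.
  by rewrite ltr0n; near: M; exact: K_gt0.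
have Mr : 0 < M%:R :> R by rewrite ltr0n; near: M; exists 1%N.
have /andP[h1 h2] := hK M nuM.
have -> : \sum_(n < M) F n = \sum_(n < nu (K M)) F n + (M - nu (K M))%:R * u (K M).
  rewrite -!(big_mkord xpredT F) (big_cat_nat (n := nu (K M)))//=; congr (_ + _).
  rewrite big_nat (eq_bigr (fun=> u (K M))); last first.
    by move=> n /andP[n1 n2]; apply: Fu; rewrite n1 (ltn_trans n2).
  by rewrite -big_nat sumr_const_nat mulr_natl.
rewrite sum_blocks -/c0; move: (\sum_(k < K M) _) (_ - _)%:R => y z.
by field; rewrite !gt_eqF.
Unshelve. all: by end_near. Qed.

Lemma block_mean_from1 : cvgn (fun N => N%:R^-1 * \sum_(1 <= n < N.+1) F n).
Proof.
have inv0 := invn_cvg0.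
apply/cvg_ex; exists (v / gam * (1 + 0) - F 0%N * 0).
have : (\sum_(n < N.+1) F n) / N.+1%:R * (1 + N%:R^-1) - F 0%N * N%:R^-1
    @[N --> \oo] --> v / gam * (1 + 0) - F 0%N * 0.
  apply: cvgB; last by apply: cvgM => //; exact: cvg_cst.
  apply: cvgM; last by apply: cvgD => //; exact: cvg_cst.
  by rewrite (@cvg_shiftS _ (fun N => (\sum_(n < N) F n) / N%:R)); exact: block_mean.
apply: cvg_trans; apply: near_eq_cvg; near=> N.
have nr : 0 < N%:R :> R by rewrite ltr0n; near: N; exists 1%N.
rewrite -(big_mkord xpredT F) big_nat_recl//= big_add1/= -[N.+1%:R]natr1.
by field; rewrite !gt_eqF//; lra.
Unshelve. all: by end_near. Qed.
End blocks.
End weighted_means.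

(** * Hardy fields *)

Section eventually.
Context {R : realType}.
Implicit Types (f g : R -> R) (x y a : R).

Lemma near_pinftyP (P : R -> Prop) :
  (\forall x \near +oo, P x) <-> exists x0, forall x, x0 <= x -> P x.
Proof.
split=> [[M [_ h]]|[x0 h]].
  by exists (M + 1) => x Mx; apply: h; lra.
by exists x0; split => [|x /ltW]; [exact: num_real|exact: h].
Qed.

Lemma near_pinfty_from (P : R -> Prop) y : (\forall x \near +oo, P x) ->
  exists x0, y <= x0 /\ forall x, x0 <= x -> P x.
Proof.
move=> /near_pinftyP[x0 h]; exists (Num.max x0 y); rewrite le_max lexx orbT.
by split => // x; rewrite ge_max => /andP[xx _]; exact: h.
Qed.

Lemma near_ge y : \forall x \near +oo, (y : R) <= x.
Proof. by apply/near_pinftyP; exists y. Qed.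

Lemma near_ln_ge y : \forall x \near +oo, y <= ln (x : R).
Proof.
apply/near_pinftyP; exists (expR y) => x h.
by rewrite -[leLHS]expRK ler_ln// posrE ?expR_gt0// (lt_le_trans _ h)// expR_gt0.
Qed.

Lemma is_derive_ln_comp f (df : R) x : 0 < f x -> is_derive x 1 f df ->
  is_derive x 1 (fun y => ln (f y)) (df / f x).
Proof.
move=> fx h; have h2 := is_derive1_ln fx.
by apply: is_derive_eq (is_derive1_comp h2 h) _; rewrite mulrC.
Qed.

Lemma is_derive_powR_comp f (df : R) a x : 0 < f x -> is_derive x 1 f df ->
  is_derive x 1 (fun y => f y `^ a) (a * f x `^ (a - 1) * df).
Proof.
move=> fx h; have h2 := is_derive1_powR a fx.
exact: (is_derive1_comp h2 h).
Qed.

Lemma increment_le (f df g dg : R -> R) x0 :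
  (forall x, x0 <= x -> is_derive x (1 : R) f (df x)) ->
  (forall x, x0 <= x -> is_derive x (1 : R) g (dg x)) ->
  (forall x, x0 <= x -> df x <= dg x) ->
  forall x, x0 <= x -> f x <= f x0 + (g x - g x0).
Proof.
move=> Df Dg h x xx; have := derive_le_increment Df Dg h (lexx x0) xx; lra.
Qed.

Lemma increment_ge (f df g dg : R -> R) x0 :
  (forall x, x0 <= x -> is_derive x (1 : R) f (df x)) ->
  (forall x, x0 <= x -> is_derive x (1 : R) g (dg x)) ->
  (forall x, x0 <= x -> dg x <= df x) ->
  forall x, x0 <= x -> f x0 + (g x - g x0) <= f x.
Proof.
move=> Df Dg h x xx; have := derive_le_increment Dg Df h (lexx x0) xx; lra.
Qed.

Lemma is_derive_linear a x : is_derive x (1 : R) (fun y => a * y) a.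
Proof. by apply: is_derive_eq; rewrite /GRing.scale/= mulr1. Qed.

End eventually.

Section hardy_field_theory.
Context {R : realType}.
Variable H : set (R -> R).
Hypothesis hH : hardy_field H.
Implicit Types (f g r : R -> R) (n : nat).

Lemma hardy_zero : H (fun=> 0).
Proof.
have := hardy_sub hH (hardy_one hH) (hardy_one hH).
by under eq_fun do rewrite subrr.
Qed.

Lemma hardy_opp f : H f -> H (fun x => - f x).
Proof.
move=> Hf; have := hardy_sub hH hardy_zero Hf.
by under eq_fun do rewrite sub0r.
Qed.

Lemma hardy_add f g : H f -> H g -> H (fun x => f x + g x).
Proof.
move=> Hf /hardy_opp Hg; have := hardy_sub hH Hf Hg.
by under eq_fun do rewrite opprK.
Qed.

Lemma hardy_nat n : H (fun=> n%:R).
Proof.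
elim: n => [|n IH]; first exact: hardy_zero.
have := hardy_add IH (hardy_one hH).
by under eq_fun do rewrite natr1.
Qed.

Lemma hardy_exp f n : H f -> H (fun x => f x ^+ n).
Proof.
move=> Hf; elim: n => [|n IH]; first exact: (hardy_one hH).
have := hardy_mul hH Hf IH.
by under eq_fun do rewrite -exprS.
Qed.

(** A nonzero germ has an inverse, hence no zeros near infinity, and the intermediate value theorem
    for a continuous representative fixes the sign. Eventual comparison is therefore a total order
    on the field, on which the later case distinctions rest. *)
Lemma hardy_sign f : H f -> [\/ \forall x \near +oo, f x = 0,
  \forall x \near +oo, 0 < f x | \forall x \near +oo, f x < 0].
Proof.
move=> Hf; have [f0|f0] := pselect (germ_eq f (fun=> 0)); first exact: Or31.
have [g Hg fg] := hardy_inv hH Hf f0.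
have [h ch fh] := hardy_cont hH Hf.
have /near_pinftyP[x0 hx] : \forall x \near +oo, f x != 0 /\ f x = h x.
  apply: filterS2 fg fh => x fg fh; split => //.
  by apply/eqP => e; move: fg; rewrite e mul0r => /eqP; rewrite eq_sym oner_eq0.
have hcont a b : {within `[a, b], continuous h} by apply: continuous_subspaceT.
have noz x y : x0 <= x -> x <= y -> f x * f y < 0 -> False.
  move=> xx xy fxy; have xx0 : x0 <= y by lra.
  have [c] : exists2 c, c \in `[x, y]%R & h c = 0.
    apply: IVT => //; rewrite -(hx x xx).2 -(hx y xx0).2 ge_min le_max.
    have [fx|fx] := leP (f x) 0; have [fy|fy] := leP (f y) 0 => //=; nra.
  rewrite in_itv/= => /andP[xc _] hc0.
  have [fc fhc] := hx c (le_trans xx xc).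
  by move: fc; rewrite fhc hc0 eqxx.
have [f0x _] := hx x0 (lexx _).
have [fx|fx] := ltP 0 (f x0).
  apply: Or32; apply/near_pinftyP; exists x0 => x xx.
  rewrite lt_neqAle eq_sym (hx x xx).1/= leNgt; apply/negP => fx'.
  by apply: (noz x0 x) => //; nra.
have {}fx : f x0 < 0 by rewrite lt_neqAle f0x.
apply: Or33; apply/near_pinftyP; exists x0 => x xx.
rewrite lt_neqAle (hx x xx).1/= leNgt; apply/negP => fx'.
by apply: (noz x0 x) => //; nra.
Qed.

Lemma hardy_le_or_lt f g : H f -> H g ->
  (\forall x \near +oo, f x <= g x) \/ (\forall x \near +oo, g x < f x).
Proof.
move=> Hf Hg; have [h|h|h] := hardy_sign (hardy_sub hH Hf Hg).
- by left; apply: filterS h => x; lra.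
- by right; apply: filterS h => x; lra.
- by left; apply: filterS h => x; lra.
Qed.

(** If [r1] stayed above a positive constant, [r] would grow linearly. The comparison takes place in
    [H], which is only known to contain the rational constants, so [eps] is replaced by some
    [1 / (n + 1)]. *)
Lemma hardy_derivative_small_upper r r1 : H r -> H r1 ->
  (\forall x \near +oo, is_derive (x : R) (1 : R) r (r1 x)) ->
  r x / x @[x --> +oo] --> (0 : R) ->
  forall eps, 0 < eps -> \forall x \near +oo, r1 x <= eps.
Proof.
move=> Hr Hr1 Dr rx eps eps0.
pose n := Num.truncn eps^-1.
have n1 : n.+1%:R^-1 < eps by rewrite invf_plt ?posrE ?ltr0n// truncnS_gt.
have nr : 0 < n.+1%:R :> R by rewrite ltr0n.
have [h|h] := hardy_le_or_lt (hardy_mul hH (hardy_nat n.+1) Hr1) (hardy_one hH).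
  apply: filterS h => x h; apply/ltW/(le_lt_trans _ n1).
  by rewrite -[leRHS]mul1r ler_pdivlMr// mulrC.
have [x0 [x0ge hx]] := near_pinfty_from 1 (filterI Dr h).
have grow x : x0 <= x -> r x0 + (n.+1%:R^-1 * x - n.+1%:R^-1 * x0) <= r x.
  apply: (@increment_ge R r r1 _ (fun=> n.+1%:R^-1)) => y xy.
  - exact: (hx y xy).1.
  - exact: is_derive_linear.
  - by have := (hx y xy).2; rewrite mulrC -ltr_pdivrMr// mul1r => /ltW.
have e2 : 0 < n.+1%:R^-1 / 2 :> R by rewrite divr_gt0// invr_gt0.
move/cvgrPdist_lt : rx => /(_ _ e2) small.
have [x1 [x1ge hx1]] := near_pinfty_from x0 small.
(* At this [x] half of the linear growth absorbs the initial values, so [r x] is at least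
   [x / (2 (n + 1))]. *)
pose x := Num.max x1 (2 * (n.+1%:R * `|r x0| + x0)).
have xx1 : x1 <= x by rewrite le_max lexx.
have xx2 : 2 * (n.+1%:R * `|r x0| + x0) <= x by rewrite le_max lexx orbT.
have x_gt0 : 0 < x by lra.
have := hx1 x xx1; rewrite sub0r normrN => /(le_lt_trans (ler_norm _)).
rewrite ltr_pdivrMr// => sm.
have gr := grow x ltac:(lra).
have : n.+1%:R^-1 * (2 * (n.+1%:R * `|r x0| + x0)) <= n.+1%:R^-1 * x.
  by rewrite ler_pM2l ?invr_gt0.
have -> : n.+1%:R^-1 * (2 * (n.+1%:R * `|r x0| + x0)) = 2 * `|r x0| + 2 * (n.+1%:R^-1 * x0).
  by field; rewrite gt_eqF.
have := ler_norm (- r x0); rewrite normrN.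
move: gr sm; rewrite mulrAC; move: (n.+1%:R^-1 * x) (n.+1%:R^-1 * x0) => z w; lra.
Qed.

Lemma hardy_derivative_small r r1 : H r -> H r1 ->
  (\forall x \near +oo, is_derive (x : R) (1 : R) r (r1 x)) ->
  r x / x @[x --> +oo] --> (0 : R) ->
  forall eps, 0 < eps -> \forall x \near +oo, `|r1 x| <= eps.
Proof.
move=> Hr Hr1 Dr rx eps eps0.
have h1 := hardy_derivative_small_upper Hr Hr1 Dr rx eps0.
have h2 : \forall x \near +oo, - r1 x <= eps.
  apply: (hardy_derivative_small_upper (hardy_opp Hr) (hardy_opp Hr1)) => //.
    by apply: filterS Dr => x Dr; exact: is_deriveN.
  by rewrite -oppr0; under eq_fun do rewrite mulNr; exact: cvgN.
by apply: filterS2 h1 h2 => x h1 h2; rewrite ler_norml; apply/andP; split; lra.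
Qed.
End hardy_field_theory.

(** * The second derivative of a slowly growing element of a Hardy field *)

Section second_derivative_bound.
Context {R : realType}.
Variable H : set (R -> R).
Hypothesis hH : hardy_field H.
Variables (r r1 r2 : R -> R) (eps : R).
Hypotheses (Hr : H r) (Hr1 : H r1) (Hr2 : H r2).
Hypothesis Dr : \forall x \near +oo, is_derive (x : R) (1 : R) r (r1 x).
Hypothesis Dr1 : \forall x \near +oo, is_derive (x : R) (1 : R) r1 (r2 x).
Hypothesis r_small : r x / x @[x --> +oo] --> (0 : R).
Hypothesis eps0 : 0 < eps.
Hypothesis r_large : \forall x \near +oo, ln x `^ (2 + eps) <= r x.

Let r_unbounded B : \forall x \near +oo, B <= r x.
Proof.
have e0 := eps0; near=> x.
have l1 : 1 <= ln x by near: x; exact: near_ln_ge.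
have lB : B <= ln x by near: x; exact: near_ln_ge.
have rx : ln x `^ (2 + eps) <= r x by near: x.
apply: le_trans rx; apply: (le_trans lB); rewrite -{1}[ln x]powRr1; last by lra.
by apply: ler_powR => //; lra.
Unshelve. all: by end_near. Qed.

Let r_not_bounded B : ~ \forall x \near +oo, r x <= B.
Proof.
move=> h; have [x0 [_ hx]] := near_pinfty_from 0 (filterI h (r_unbounded (B + 1))).
by have [h1 h2] := hx x0 (lexx _); lra.
Qed.

Lemma derivative_pos : \forall x \near +oo, 0 < r1 x.
Proof.
have [h|//] := hardy_le_or_lt hH Hr1 (hardy_zero hH).
have [x0 [_ hx]] := near_pinfty_from 0 (filterI Dr h).
exfalso; apply: (@r_not_bounded (r x0)); apply/near_pinftyP; exists x0 => x xx.
have := @increment_le R r r1 (fun y => 0 * y) (fun=> 0) x0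
  (fun y xy => (hx y xy).1) (fun y _ => is_derive_linear 0 y) (fun y xy => (hx y xy).2) x xx.
by rewrite !mul0r; lra.
Qed.

Let r1_small (e : R) : 0 < e -> \forall x \near +oo, r1 x <= e.
Proof. exact: (hardy_derivative_small_upper hH Hr Hr1). Qed.

(** [r1] is positive and eventually below any positive constant, so it cannot be nondecreasing. *)
Lemma second_derivative_neg : \forall x \near +oo, r2 x < 0.
Proof.
have [h|//] := hardy_le_or_lt hH (hardy_zero hH) Hr2.
have [x0 [_ hx]] := near_pinfty_from 0 (filterI Dr1 (filterI h derivative_pos)).
have p0 : 0 < r1 x0 by have [_ []] := hx x0 (lexx _).
have e2 : 0 < r1 x0 / 2 by lra.
have [x1 [x01 h1]] := near_pinfty_from x0 (r1_small e2).
have := h1 x1 (lexx _).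
have := @increment_ge R r1 r2 (fun y => 0 * y) (fun=> 0) x0
  (fun y xy => (hx y xy).1) (fun y _ => is_derive_linear 0 y)
  (fun y xy => (hx y xy).2.1) x1 x01.
by rewrite !mul0r; lra.
Qed.

(** Otherwise [r2] would stay below the negative value [r2 x0], and [r1] would have reached zero at
    distance [- r1 x0 / r2 x0]. Monotonicity of [r2] later allows its value at a level point to be
    compared with that at a simpler, later point. *)
Lemma second_derivative_nd r3 : H r3 ->
  (\forall x \near +oo, is_derive (x : R) (1 : R) r2 (r3 x)) ->
  \forall x \near +oo, 0 <= r3 x.
Proof.
move=> Hr3 Dr2; have [//|h] := hardy_le_or_lt hH (hardy_zero hH) Hr3.
have [x0 [_ hx]] := near_pinfty_from 0 (filterI (filterI Dr1 Dr2)
  (filterI h (filterI derivative_pos second_derivative_neg))).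
have [_ [_ [p0 n0]]] := hx x0 (lexx _).
have r2le x : x0 <= x -> r2 x <= r2 x0.
  move=> xx; have := @increment_le R r2 r3 (fun y => 0 * y) (fun=> 0) x0
    (fun y xy => (hx y xy).1.2) (fun y _ => is_derive_linear 0 y)
    (fun y xy => ltW (hx y xy).2.1) x xx.
  by rewrite !mul0r; lra.
pose x := x0 + r1 x0 / - r2 x0.
have xx : x0 <= x by rewrite lerDl divr_ge0 ?oppr_ge0 ?ltW.
have := @increment_le R r1 r2 (fun y => r2 x0 * y) (fun=> r2 x0) x0
  (fun y xy => (hx y xy).1.1) (fun y _ => is_derive_linear _ y) r2le x xx.
have [_ [_ [px _]]] := hx x xx.
have -> : r2 x0 * x - r2 x0 * x0 = - r1 x0 by rewrite /x; field; rewrite lt_eqF.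
by lra.
Qed.

(* [q] stands for [- r1 / r2].  The field [H] need not contain [x] or [ln x], so
   [q r1] is compared with [sqrt r], and [q1] with [q ^ (1 / 7)], inside [H]. *)
Section quotient.
Variables q q1 : R -> R.
Hypotheses (Hq : H q) (Hq1 : H q1).
Hypothesis Dq : \forall x \near +oo, is_derive (x : R) (1 : R) q (q1 x).
Hypothesis qE : \forall x \near +oo, 0 < q x /\ r2 x = - (r1 x / q x).

(** Integrating this equation turns bounds for [q] into bounds for [r1]. *)
Let ln_r1_derive : \forall x \near +oo, is_derive (x : R) (1 : R) (fun y => ln (r1 y)) (- (q x)^-1).
Proof.
near=> x; have p : 0 < r1 x by near: x; exact: derivative_pos.
have D : is_derive (x : R) (1 : R) r1 (r2 x) by near: x.
have [qx e] : 0 < q x /\ r2 x = - (r1 x / q x) by near: x.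
apply: is_derive_eq (is_derive_ln_comp p D) _.
by rewrite e; field; rewrite !gt_eqF.
Unshelve. all: by end_near. Qed.

(** Otherwise [(ln r1)' <= - 4 / (3 x)], so [r1 = O(x ^ (- 4 / 3))] would be integrable and [r]
    bounded. *)
Let q_not_small : ~ \forall x \near +oo, q x <= 3 / 4 * x.
Proof.
move=> h; have [x0 [x0ge hx]] := near_pinfty_from 1
  (filterI (filterI h qE) (filterI (filterI derivative_pos Dr) ln_r1_derive)).
pose K := ln (r1 x0) + 4 / 3 * ln x0.
have r1le x : x0 <= x -> r1 x <= expR K * x `^ (- (4 / 3)).
  move=> xx; have x_gt0 : 0 < x by lra.
  have [[_ _] [[p _] _]] := hx x xx.
  rewrite -[leLHS](lnK p) /powR gt_eqF// -expRD ler_expR.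
  have := @increment_le R (fun y => ln (r1 y)) (fun y => - (q y)^-1)
    (fun y => - (4 / 3) * ln y) (fun y => - (4 / 3) * y^-1) x0
    (fun y xy => (hx y xy).2.2) _ _ x xx.
  rewrite /K => inc; apply: le_trans (inc _ _) _; [| |lra].
    move=> y xy; have y0 : 0 < y by lra.
    have := is_derive1_ln y0 => Dl.
    by apply: is_derive_eq; rewrite /GRing.scale/=.
  move=> y xy; have y0 : 0 < y by lra.
  have [[ql [qp _]] _] := hx y xy.
  rewrite mulNr lerN2 -[4 / 3]invf_div -invfM lef_pV2 ?posrE//.
  by rewrite mulr_gt0// divr_gt0.
apply: (@r_not_bounded (r x0 + 3 * expR K * x0 `^ (- (1 / 3)))).
apply/near_pinftyP; exists x0 => x xx.
have := @increment_le R r r1 (fun y => - (3 * expR K) * y `^ (- (1 / 3)))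
    (fun y => expR K * y `^ (- (4 / 3))) x0
    (fun y xy => (hx y xy).2.1.2) _ r1le x xx.
move=> inc; apply: le_trans (inc _) _.
  move=> y xy; have y0 : 0 < y by lra.
  have Dp := is_derive1_powR (- (1 / 3)) y0.
  apply: is_derive_eq; rewrite /GRing.scale/=.
  have -> : - (1 / 3) - 1 = - (4 / 3) :> R by lra.
  by field.
have := mulr_ge0 (expR_ge0 K) (powR_ge0 x (- (1 / 3))).
by move: (expR K) (x `^ _) (x0 `^ _) => u v w; lra.
Qed.

(** If [q r1 <= sqrt r], then [(sqrt r)' = r1 / (2 sqrt r) <= 1 / (2 q) <= 1 / (2 c x)], so
    [r = O((ln x) ^ 2)]. This is where a growth exponent above [2] is decisive. *)
Let not_le_sqrt (c : R) : 0 < c -> (\forall x \near +oo, c * x <= q x) ->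
  ~ \forall x \near +oo, (q x * r1 x) ^+ 2 <= r x.
Proof.
move=> c0 cq h; have e0 := eps0.
have hall : \forall x \near +oo, [/\ c * x <= q x, (q x * r1 x) ^+ 2 <= r x,
    is_derive (x : R) (1 : R) r (r1 x), 0 < r1 x & 1 <= r x].
  have dp := derivative_pos.
  by near=> x; split; near: x => //; exact: r_unbounded.
have [x0 [x0ge hx]] := near_pinfty_from 1 hall.
pose S y := r y `^ (1 / 2).
have S2 y : 1 <= r y -> S y ^+ 2 = r y.
  move=> ry; rewrite /S -powR_mulrn ?powR_ge0// -powRrM.
  by rewrite (_ : 1 / 2 * 2%:R = 1 :> R) ?powRr1//; lra.
pose K := S x0 - (2 * c)^-1 * ln x0.
have Sle x : x0 <= x -> S x <= K + (2 * c)^-1 * ln x.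
  move=> xx; have := @increment_le R S (fun y => (1 / 2) * r y `^ (1 / 2 - 1) * r1 y)
    (fun y => (2 * c)^-1 * ln y) (fun y => (2 * c)^-1 * y^-1) x0 _ _ _ x xx.
  rewrite /K => inc; apply: le_trans (inc _ _ _) _ => [y xy|y xy|y xy|]; last by lra.
  - have [_ _ Dy _ ry] := hx y xy.
    by apply: is_derive_powR_comp => //; lra.
  - have y0 : 0 < y by lra.
    have := is_derive1_ln y0 => Dl.
    by apply: is_derive_eq; rewrite /GRing.scale/=.
  - have y0 : 0 < y by lra.
    have [cqy qr _ r1y ry] := hx y xy.
    have Sy : 0 < S y by rewrite powR_gt0//; lra.
    have -> : r y `^ (1 / 2 - 1) = (S y)^-1.
      rewrite (_ : 1 / 2 - 1 = - (1 / 2) :> R); last by lra.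
      by rewrite powRN.
    have cy : 0 < c * y by rewrite mulr_gt0.
    have qy : 0 < q y by lra.
    have h1 : q y * r1 y <= S y.
      rewrite -(@ler_pXn2r _ 2) ?nnegrE ?S2 ?(ltW Sy)//.
      by rewrite mulr_ge0// ltW.
    have h2 : c * y * r1 y <= S y by apply: le_trans h1; rewrite ler_pM2r.
    rewrite -subr_ge0 (_ : (2 * c)^-1 / y - 1 / 2 / S y * r1 y =
      (S y - c * y * r1 y) / (2 * (c * y) * S y)); last first.
      by field; rewrite !gt_eqF.
    by rewrite divr_ge0 ?subr_ge0// ltW// mulr_gt0// mulr_gt0.
(* Beyond [x1] the logarithm absorbs the constant [K], and [(ln x) ^ eps] exceeds [c ^ (-2)]. *)
have [x1 [x01 hx1]] := near_pinfty_from x0 (near_ln_ge (Num.max (`|K| * 2 * c + 1) ((c^-2 + 1) `^ eps^-1 + 1))).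
have [x2 [_ hx2]] := near_pinfty_from 0 (filterI (near_ge x1) r_large).
have [x12 rl] := hx2 x2 (lexx _).
have := hx1 x2 x12; rewrite ge_max => /andP[l1 l2].
have := Sle x2 ltac:(lra); have [_ _ _ _ rx2] := hx x2 ltac:(lra).
have ci : 0 < c^-1 by rewrite invr_gt0.
have Kl : K <= (2 * c)^-1 * ln x2.
  rewrite mulrC ler_pdivlMr ?mulr_gt0//; have := ler_norm K.
  by nra.
move=> SK; have SL : S x2 <= c^-1 * ln x2.
  by move: SK Kl; rewrite invfM; lra.
have ln0 : 1 <= ln x2.
  by have := powR_ge0 (c^-2 + 1) eps^-1; lra.
have S0 : 0 <= S x2 by exact: powR_ge0.
have r4 : r x2 <= c^-2 * ln x2 ^+ 2.
  rewrite -S2// -exprVn -exprMn lerXn2r ?nnegrE// mulr_ge0 ?(ltW ci)//; lra.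
move: rl; rewrite powRD ?powR_mulrn; [|by lra|by rewrite gt_eqF ?implybT//; lra].
apply/negP; rewrite -ltNge; apply: le_lt_trans r4 _.
rewrite mulrC ltr_pM2l ?exprn_gt0//; last by lra.
have a0 : 0 <= c^-2 + 1 :> R by rewrite addr_ge0// invr_ge0 sqr_ge0.
have : ((c^-2 + 1) `^ eps^-1) `^ eps <= ln x2 `^ eps.
  by apply: ge0_ler_powR; rewrite ?nnegrE ?powR_ge0//; lra.
rewrite -powRrM mulVf ?gt_eqF// powRr1//; lra.
Unshelve. all: by end_near. Qed.

(** If [q1 <= 1 / 2] eventually, then [q <= x / 2 + O(1)], which [q_not_small] excludes; hence
    [q1 > 1 / 2], and integration gives [q >= x / 2 - O(1)]. *)
Let q_lower : \forall x \near +oo, x / 3 <= q x.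
Proof.
have [h|h] := hardy_le_or_lt hH (hardy_mul hH (hardy_nat hH 2) Hq1) (hardy_one hH).
  exfalso; apply: q_not_small.
  have [x0 [x0ge hx]] := near_pinfty_from 1 (filterI h Dq).
  apply/near_pinftyP; exists (Num.max x0 (4 * `|q x0|)) => x.
  rewrite ge_max => /andP[xx x4].
  have := @increment_le R q q1 (fun y => 2^-1 * y) (fun=> 2^-1) x0
    (fun y xy => (hx y xy).2) (fun y _ => is_derive_linear _ y) _ x xx.
  have := ler_norm (q x0) => n1 inc; apply: le_trans (inc _) _; last by lra.
  by move=> y xy; have [? _] := hx y xy; lra.
have [x0 [x0ge hx]] := near_pinfty_from 1 (filterI h Dq).
apply/near_pinftyP; exists (Num.max x0 (6 * (`|q x0| + x0))) => x.
rewrite ge_max => /andP[xx x4].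
have := @increment_ge R q q1 (fun y => 2^-1 * y) (fun=> 2^-1) x0
  (fun y xy => (hx y xy).2) (fun y _ => is_derive_linear _ y) _ x xx.
have := ler_norm (- q x0); rewrite normrN => n1 inc; apply: le_trans (inc _); first by lra.
by move=> y xy; have [? _] := hx y xy; lra.
Qed.

Let seventh_root (c z : R) : 0 < z -> 0 < c -> (c <= z `^ (1 / 7)) = (c ^+ 7 <= z).
Proof.
move=> z0 c0; rewrite -(@ler_pXn2r _ 7) ?nnegrE ?powR_ge0 ?(ltW c0)//.
rewrite -[_ `^ _ ^+ _]powR_mulrn ?powR_ge0// -powRrM.
by rewrite (_ : 1 / 7 * 7%:R = 1 :> R) ?powRr1 ?(ltW z0)//; lra.
Qed.

(** The derivative of [P] is [6 / 7] times [q1 / q ^ (1 / 7)], so comparing [q1 ^ 7] with [q], both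
    in [H], decides on which side of [6 / 7] it lies. *)
Let P (y : R) := q y `^ (6 / 7).

Let P_derive (y : R) : 0 < q y -> is_derive y (1 : R) q (q1 y) ->
  is_derive y (1 : R) P (6 / 7 * (q1 y / q y `^ (1 / 7))).
Proof.
move=> qy Dy; apply: is_derive_eq (is_derive_powR_comp (6 / 7) qy Dy) _.
rewrite (_ : 6 / 7 - 1 = - (1 / 7) :> R) ?powRN; last by lra.
by rewrite -mulrA; congr (_ * _); rewrite mulrC.
Qed.

(** Here [q <= 3 x], and [not_le_sqrt] leaves [q r1 > sqrt r >= (ln x) ^ (1 + eps / 2)]. The bound
    follows from [- r2 = q r1 / q ^ 2] and [q ^ 2 <= 9 x ^ 2]. *)
Lemma quotient_bound_slow : (\forall x \near +oo, q1 x <= 2) ->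
  \forall x \near +oo, 9^-1 * ln x `^ (1 + eps / 2) / x ^+ 2 <= - r2 x.
Proof.
move=> h; have e0 := eps0.
have q3 : \forall x \near +oo, q x <= 3 * x.
  have [x0 [x0ge hx]] := near_pinfty_from 1 (filterI h Dq).
  apply/near_pinftyP; exists (Num.max x0 `|q x0|) => x.
  rewrite ge_max => /andP[xx x4].
  have := @increment_le R q q1 (fun y => 2 * y) (fun=> 2) x0
    (fun y xy => (hx y xy).2) (fun y _ => is_derive_linear _ y)
    (fun y xy => (hx y xy).1) x xx.
  by have := ler_norm (q x0); lra.
have [|big] := hardy_le_or_lt hH (hardy_exp hH 2 (hardy_mul hH Hq Hr1)) Hr.
  move=> /(@not_le_sqrt 3^-1 _ _)[]//.
  by apply: filterS q_lower => x; rewrite mulrC.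
near=> x.
have x0 : 0 < x by near: x; apply/near_pinftyP; exists 1 => x; lra.
have ln1 : 0 <= ln x by near: x; exact: near_ln_ge.
have r1x : 0 < r1 x by near: x; exact: derivative_pos.
have [qx ->] : 0 < q x /\ r2 x = - (r1 x / q x) by near: x.
have qx3 : q x <= 3 * x by near: x.
have bigx : r x < (q x * r1 x) ^+ 2 by near: x.
have rl : ln x `^ (2 + eps) <= r x by near: x.
set L := ln x `^ _; have L0 : 0 <= L by exact: powR_ge0.
have qr0 : 0 < q x * r1 x by rewrite mulr_gt0.
have Lqr : L <= q x * r1 x.
  rewrite -(@ler_pXn2r _ 2) ?nnegrE ?(ltW qr0)//.
  apply: le_trans (ltW bigx); apply: le_trans rl.
  rewrite -powR_mulrn// /L -powRrM le_eqVlt; apply/orP; left; apply/eqP.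
  by congr (_ `^ _); rewrite mulrDl mul1r divfK.
rewrite opprK ler_pdivlMr// mulrAC ler_pdivrMr ?exprn_gt0//.
have q9 : q x ^+ 2 <= 9 * x ^+ 2.
  rewrite (_ : 9 * x ^+ 2 = (3 * x) ^+ 2); last by ring.
  by rewrite lerXn2r ?nnegrE//; lra.
have : 9^-1 * L * q x * q x <= r1 x * x ^+ 2 * q x.
  apply: (@le_trans _ _ (L * x ^+ 2)).
    rewrite (_ : _ * q x * q x = L * (9^-1 * q x ^+ 2)); last by ring.
    rewrite ler_wpM2l//; lra.
  rewrite (_ : r1 x * x ^+ 2 * q x = q x * r1 x * x ^+ 2); last by ring.
  by rewrite ler_wpM2r// sqr_ge0.
by rewrite ler_pM2r.
Unshelve. all: by end_near. Qed.

(** Here [q >= 3 x / 2], hence [r1 >= C x ^ (- 2 / 3)]. Once [q = O(x ^ (7 / 6))] is known,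
    [- r2 = r1 / q] is at least [C x ^ (- 11 / 6)], which leaves a power of [x] to spare. *)
Lemma quotient_bound_fast : (\forall x \near +oo, 2 < q1 x) ->
  \forall x \near +oo, ln x ^+ 2 / x ^+ 2 <= - r2 x.
Proof.
move=> h.
have base : \forall x \near +oo, [/\ 2 < q1 x, is_derive (x : R) (1 : R) q (q1 x),
    0 < q x, is_derive (x : R) (1 : R) (fun y => ln (r1 y)) (- (q x)^-1) &
    0 < r1 x /\ r2 x = - (r1 x / q x)].
  have dp := derivative_pos.
  near=> x; have [qx e] : 0 < q x /\ r2 x = - (r1 x / q x) by near: x.
  by split; [near: x|near: x|by []|near: x|split=> //; near: x].
have q32 : \forall x \near +oo, 3 / 2 * x <= q x.
  have [x0 [x0ge hx]] := near_pinfty_from 1 base.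
  apply/near_pinftyP; exists (4 * x0) => x xx.
  have xx0 : x0 <= x by lra.
  have [_ _ qx0 _ _] := hx x0 (lexx _).
  have := @increment_ge R q q1 (fun y => 2 * y) (fun=> 2) x0 _
    (fun y _ => is_derive_linear _ y) _ x xx0.
  by move=> inc; apply: le_trans (inc _ _) => [|y /hx[]|y /hx[/ltW]] //; lra.
have [x0 [x0ge hx]] := near_pinfty_from 1 (filterI base q32).
pose K1 := ln (r1 x0) + 2 / 3 * ln x0.
have lnr1 x : x0 <= x -> K1 - 2 / 3 * ln x <= ln (r1 x).
  move=> xx; have := @increment_ge R (fun y => ln (r1 y)) (fun y => - (q y)^-1)
    (fun y => - (2 / 3) * ln y) (fun y => - (2 / 3) * y^-1) x0 _ _ _ x xx.
  move=> inc; apply: le_trans (inc _ _ _); first by rewrite /K1; lra.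
  - by move=> y /hx[[]].
  - move=> y xy; have y0 : 0 < y by lra.
    have := is_derive1_ln y0 => Dl.
    by apply: is_derive_eq; rewrite /GRing.scale/=.
  - move=> y xy; have y0 : 0 < y by lra.
    have [[_ _ qy _ _] q32y] := hx y xy.
    rewrite mulNr lerN2 -[2 / 3]invf_div -invfM lef_pV2 ?posrE//.
    by rewrite mulr_gt0// divr_gt0.
have [q7|q7] := hardy_le_or_lt hH (hardy_exp hH 7 Hq1) Hq; last first.
  (* If [q < q1 ^ 7], then [q >= (x / 2) ^ (7 / 6)] eventually, so [1 / q] is integrable and [ln r1]
     bounded below, whereas [r1] tends to zero. *)
  exfalso; have [x1 [x01 hx1]] := near_pinfty_from x0 q7.
  have P1 x : x1 <= x -> P x1 + (6 / 7 * x - 6 / 7 * x1) <= P x.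
    move=> xx; apply: (@increment_ge R P (fun y => 6 / 7 * (q1 y / q y `^ (1 / 7)))
      (fun y => 6 / 7 * y) (fun=> 6 / 7) x1) => // y xy.
    - by have [[_ Dy qy _ _] _] := hx y (le_trans x01 xy); exact: P_derive.
    - exact: is_derive_linear.
    - have [[q2 _ qy _ _] _] := hx y (le_trans x01 xy).
      rewrite ler_pMr// ler_pdivlMr ?powR_gt0// [leLHS]mul1r.
      have q1y : 0 < q1 y by lra.
      rewrite -(@ler_pXn2r _ 7) ?nnegrE ?powR_ge0 ?(ltW q1y)//.
      apply: le_trans (ltW (hx1 y xy)).
      by rewrite -(seventh_root qy (powR_gt0 _ qy)).
  pose x2 := 3 * x1; have x12 : x1 <= x2 by rewrite /x2; lra.
  have q76 x : x2 <= x -> (x / 2) `^ (7 / 6) <= q x.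
    move=> xx; have Px : x / 2 <= P x.
      have := P1 x ltac:(lra); have : 0 <= P x1 by exact: powR_ge0.
      by move: xx; rewrite /x2; lra.
    have [[_ _ qx _ _] _] := hx x ltac:(lra).
    have -> : q x = P x `^ (7 / 6).
      rewrite /P -powRrM (_ : 6 / 7 * (7 / 6) = 1 :> R); last by lra.
      by rewrite powRr1// ltW.
    by apply: ge0_ler_powR => //; rewrite nnegrE ?powR_ge0//; lra.
  pose g y : R := 12 * (y / 2) `^ (- (1 / 6)).
  pose B := ln (r1 x2) - g x2.
  have lnr x : x2 <= x -> B <= ln (r1 x).
    move=> xx; have := @increment_ge R (fun y => ln (r1 y)) (fun y => - (q y)^-1)
      g (fun y => - (y / 2) `^ (- (7 / 6))) x2 _ _ _ x xx.
    have gx0 : 0 <= g x by rewrite /g mulr_ge0// powR_ge0.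
    move=> inc; apply: le_trans (inc _ _ _); first by rewrite /B; lra.
    - by move=> y xy; have [[]] := hx y ltac:(lra).
    - move=> y xy; have y0 : 0 < y / 2 by lra.
      have D2 : is_derive y (1 : R) (fun y => y / 2) 2^-1.
        by under eq_fun do rewrite mulrC; exact: is_derive_linear.
      have D3 := @is_derive_powR_comp R (fun y => y / 2) 2^-1 (- (1 / 6)) y y0 D2.
      apply: is_derive_eq; rewrite /GRing.scale/=.
      rewrite (_ : - (1 / 6) - 1 = - (7 / 6) :> R); last by lra.
      by field.
    - move=> y xy; have y0 : 0 < y / 2 by lra.
      have [[_ _ qy _ _] _] := hx y ltac:(lra).
      by rewrite lerN2 powRN lef_pV2 ?posrE ?powR_gt0// q76.
  have e0 : 0 < expR B / 2 by rewrite divr_gt0// expR_gt0.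
  have [x3 [x23 hx3]] := near_pinfty_from x2 (r1_small e0).
  have := hx3 x3 (lexx _); have [[_ _ _ _ [p3 _]] _] := hx x3 ltac:(lra).
  have : expR B <= r1 x3 by rewrite -[leRHS]lnK// ler_expR lnr.
  by have := expR_gt0 B; lra.
have [x1 [x01 hx1]] := near_pinfty_from x0 q7.
have P2 x : x1 <= x -> P x <= P x1 + (6 / 7 * x - 6 / 7 * x1).
  move=> xx; apply: (@increment_le R P (fun y => 6 / 7 * (q1 y / q y `^ (1 / 7)))
    (fun y => 6 / 7 * y) (fun=> 6 / 7) x1) => // y xy.
  - by have [[_ Dy qy _ _] _] := hx y (le_trans x01 xy); exact: P_derive.
  - exact: is_derive_linear.
  - have [[q2 _ qy _ _] _] := hx y (le_trans x01 xy).
    rewrite ler_piMr// ler_pdivrMr ?powR_gt0// [leRHS]mul1r seventh_root//; last by lra.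
    exact: hx1.
have lnq : \forall x \near +oo, ln (q x) <= 7 / 6 * (ln 2 + ln x).
  apply/near_pinftyP; exists (Num.max x1 (P x1)) => x.
  rewrite ge_max => /andP[xx xP].
  have [[_ _ qx _ _] _] := hx x ltac:(lra).
  have Px : P x <= 2 * x by have := P2 x xx; lra.
  have P0 : 0 < P x by rewrite powR_gt0.
  have : ln (P x) <= ln (2 * x) by rewrite ler_ln ?posrE//; lra.
  rewrite lnM ?posrE//; last by lra.
  by rewrite ln_powR; lra.
pose K2 := K1 - 7 / 6 * ln 2.
near=> x.
have xx0 : x0 <= x by near: x; exact: near_ge.
have x_gt0 : 0 < x by lra.
have lqx : ln (q x) <= 7 / 6 * (ln 2 + ln x) by near: x.
have lnx1 : 1 <= ln x by near: x; exact: near_ln_ge.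
(* [1296 = 6 ^ 4]: the cubic term of [exp (ln x / 6)] is [(ln x) ^ 3 / 1296], and one of its three
   logarithms absorbs the constants. *)
have lnxK : 1296 / expR K2 <= ln x by near: x; exact: near_ln_ge.
have [[_ _ qx _ [r1x r2E]] _] := hx x xx0.
have := lnr1 x xx0 => lr1.
have -> : - r2 x = expR (ln (r1 x) - ln (q x)).
  by rewrite r2E opprK expRD expRN !lnK.
rewrite ler_pdivrMr ?exprn_gt0//.
have -> : x ^+ 2 = expR (ln x + ln x) by rewrite expRD lnK.
rewrite -expRD; apply: (@le_trans _ _ (expR (K2 + ln x / 6))); last first.
  by rewrite ler_expR /K2; lra.
have y0 : 0 <= ln x / 6 by lra.
have := expR_ge1Dxn 2 y0; rewrite (_ : 3`!%:R = 6 :> R)// => h3.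
rewrite expRD; have ek := expR_gt0 K2.
have h4 : (ln x / 6) ^+ 3 / 6 <= expR (ln x / 6) by lra.
have h5 : expR K2 * ((ln x / 6) ^+ 3 / 6) <= expR K2 * expR (ln x / 6).
  by rewrite ler_pM2l.
apply: le_trans h5.
move: lnxK; rewrite ler_pdivrMr// => h6.
rewrite (_ : expR K2 * _ = ln x ^+ 2 * (ln x * expR K2 / 1296)); last by field.
rewrite ler_peMr ?sqr_ge0//; lra.
Unshelve. all: by end_near. Qed.

Lemma quotient_bound : exists (C d : R), [/\ 0 < C, 0 < d, d <= 1 &
  \forall x \near +oo, C * ln x `^ (1 + d) / x ^+ 2 <= - r2 x].
Proof.
have e0 := eps0.
(* The cap keeps [1 + d] at most [2], as required by the bound [(ln x) ^ 2] of the fast case and by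
   [L_bounds]. *)
pose d := Num.min (eps / 2) 1.
have d0 : 0 < d by rewrite lt_min ltr01 andbT; lra.
have de : d <= eps / 2 by rewrite ge_min lexx.
have d1 : d <= 1 by rewrite ge_min lexx orbT.
exists 9^-1, d; split; [by rewrite invr_gt0|by []|by []|].
have [/quotient_bound_slow h|/quotient_bound_fast h] := hardy_le_or_lt hH Hq1 (hardy_nat hH 2).
  near=> x; have hx : 9^-1 * ln x `^ (1 + eps / 2) / x ^+ 2 <= - r2 x by near: x.
  apply: le_trans hx; rewrite ler_wpM2r ?invr_ge0 ?sqr_ge0// ler_pM2l ?invr_gt0//.
  apply: ler_powR; last by lra.
  by near: x; exact: near_ln_ge.
near=> x; have hx : ln x ^+ 2 / x ^+ 2 <= - r2 x by near: x.
apply: le_trans hx; rewrite ler_wpM2r ?invr_ge0 ?sqr_ge0//.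
have lnx1 : 1 <= ln x by near: x; exact: near_ln_ge.
have lnx0 : 0 <= ln x by lra.
apply: (@le_trans _ _ (ln x `^ (1 + d))).
  by rewrite ler_piMl ?powR_ge0//; lra.
by rewrite -powR_mulrn//; apply: ler_powR => //; lra.
Unshelve. all: by end_near. Qed.
End quotient.

Lemma second_derivative_bound : exists (C d : R), [/\ 0 < C, 0 < d, d <= 1 &
  \forall x \near +oo, C * ln x `^ (1 + d) / x ^+ 2 <= - r2 x].
Proof.
have n0 : ~ germ_eq (fun x => - r2 x) (fun=> 0).
  move=> h; have [x0 [_ hx]] := near_pinfty_from 0 (filterI h second_derivative_neg).
  by have [h1 h2] := hx x0 (lexx _); lra.
have [g Hg r2g] := hardy_inv hH (hardy_opp hH Hr2) n0.
have Hq := hardy_mul hH Hr1 Hg; have [q1 Hq1 Dq] := hardy_deriv hH Hq.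
apply: (quotient_bound Hq Hq1 Dq).
have dp := derivative_pos; have sn := second_derivative_neg.
near=> x.
have r1x : 0 < r1 x by near: x.
have r2x : r2 x < 0 by near: x.
have e : - r2 x * g x = 1 by near: x.
have gx : g x = (- r2 x)^-1.
  by apply: (mulfI (_ : - r2 x != 0)); rewrite ?e ?mulfV// oppr_eq0 lt_eqF.
rewrite gx; split; first by rewrite divr_gt0// oppr_gt0.
by rewrite invfM invrK mulrA mulfV ?(gt_eqF r1x)// mul1r opprK.
Unshelve. all: by end_near. Qed.
End second_derivative_bound.

(** * Points where a function takes integer values *)

Section level_points.
Context {R : realType}.

Lemma mean_value (f df : R -> R) (x0 u v : R) :
  (forall z, x0 <= z -> is_derive z (1 : R) f (df z)) -> x0 <= u -> u <= v ->
  exists2 w, u <= w <= v & f v - f u = df w * (v - u).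
Proof.
move=> Df xu uv; have [||w] := @MVT_segment R f df u v uv.
- by move=> z /[!in_itv]/= /andP[uz _]; apply: Df; lra.
- apply: derivable_within_continuous => z /[!in_itv]/= /andP[uz _].
  by apply: (@ex_derive _ _ _ _ _ _ _ (Df z _)); lra.
by rewrite in_itv/= => wuv e; exists w.
Qed.

Variables (c x0 : R) (r r1 : R -> R).
Hypotheses (c0 : 0 < c) (x0_ge1 : 1 <= x0).
Hypothesis Dr : forall x, x0 <= x -> is_derive x (1 : R) r (r1 x).
Hypothesis r1_half : forall x, x0 <= x -> `|r1 x| <= c / 2.
Hypothesis r1_small : forall e : R, 0 < e -> \forall x \near +oo, `|r1 x| <= e.
Let A x := c * x + r x.

Let DA x : x0 <= x -> is_derive x (1 : R) A (c + r1 x).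
Proof.
move=> xx; have ? := Dr xx; have ? := is_derive_linear c x.
exact: is_deriveD.
Qed.

Let c_gt0 := c0.

Lemma level_slope u v : x0 <= u -> u <= v ->
  c / 2 * (v - u) <= A v - A u <= 3 / 2 * c * (v - u).
Proof.
move=> xu uv; have [w /andP[uw _] ->] := mean_value DA xu uv.
have := r1_half (le_trans xu uw); rewrite ler_norml => /andP[h1 h2].
have vu : 0 <= v - u by lra.
by rewrite !ler_wpM2r//; lra.
Qed.

Lemma level_lt u v : x0 <= u -> x0 <= v -> (A u < A v) = (u < v).
Proof.
move=> xu xv; have [uv|vu] := ltP u v.
  have /andP[h _] := level_slope xu (ltW uv).
  by rewrite -subr_gt0 (lt_le_trans _ h)// mulr_gt0// ?divr_gt0// subr_gt0.
have /andP[h _] := level_slope xv vu.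
apply/negbTE; rewrite -leNgt -subr_ge0 (le_trans _ h)// mulr_ge0 ?subr_ge0//.
by rewrite divr_ge0// ltW.
Qed.

Lemma level_le u v : x0 <= u -> x0 <= v -> (A u <= A v) = (u <= v).
Proof. by move=> xu xv; rewrite !leNgt level_lt. Qed.

Lemma level_point (k : R) : A x0 <= k -> exists2 y, x0 <= y & A y = k.
Proof.
move=> Ak; pose v := x0 + (k - A x0) / (c / 2).
have xv : x0 <= v by rewrite lerDl divr_ge0 ?subr_ge0// divr_ge0// ltW.
have kAv : k <= A v.
  have /andP[+ _] := level_slope (lexx x0) xv.
  by rewrite /v addrC addKr mulrC divfK ?gt_eqF ?divr_gt0//; lra.
have [||y] := @IVT R A x0 v k xv.
- apply: derivable_within_continuous => z /[!in_itv]/= /andP[uz _].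
  exact: (@ex_derive _ _ _ _ _ _ _ (DA uz)).
- by rewrite ge_min le_max Ak kAv orbT.
by rewrite in_itv/= => /andP[xy _] e; exists y.
Qed.

(** [A] is only controlled beyond [x0], so the levels start at some [k0]; this offset is later
    undone by a shift of the orbit. *)
Lemma level_points : exists (k0 : nat) (y : nat -> R),
  forall i, x0 <= y i /\ A (y i) = (k0 + i)%:R.
Proof.
pose k0 := (Num.truncn (A x0)).+1.
have Ak0 : A x0 <= k0%:R by apply/ltW; exact: truncnS_gt.
have /choice[y hy] : forall i, exists z, x0 <= z /\ A z = (k0 + i)%:R.
  move=> i; have [|z xz Az] := @level_point (k0 + i)%:R; last by exists z.
  by apply: le_trans Ak0 _; rewrite ler_nat leq_addr.
by exists k0, y.
Qed.

Variables (k0 : nat) (y : nat -> R).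
Hypothesis y_ge : forall i, x0 <= y i.
Hypothesis Ay : forall i, A (y i) = (k0 + i)%:R.

Let A_gap i : A (y i.+1) - A (y i) = 1.
Proof. by rewrite !Ay addnS -[(k0 + i).+1%:R]natr1 addrC addKr. Qed.

Lemma level_gap_gt0 i : y i < y i.+1.
Proof. by rewrite -level_lt// -subr_gt0 A_gap. Qed.

Lemma level_gap i : 2 / (3 * c) <= y i.+1 - y i <= 2 / c.
Proof.
have /andP[] := level_slope (y_ge i) (ltW (level_gap_gt0 i)).
rewrite A_gap; have := c_gt0 => cp h1 h2; apply/andP; split.
  by rewrite ler_pdivrMr ?mulr_gt0//; lra.
by rewrite ler_pdivlMr//; lra.
Qed.

Lemma level_upper i : y i <= y 0%N + i%:R * (2 / c).
Proof.
elim: i => [|i IH]; first by rewrite mul0r addr0.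
have /andP[_ h] := level_gap i; rewrite -[i.+1%:R]natr1 mulrDl mul1r; lra.
Qed.

Lemma level_lower i : y 0%N + i%:R * (2 / (3 * c)) <= y i.
Proof.
elim: i => [|i IH]; first by rewrite mul0r addr0.
have /andP[h _] := level_gap i; rewrite -[i.+1%:R]natr1 mulrDl mul1r; lra.
Qed.

Lemma level_gap_cvg : y i.+1 - y i @[i --> \oo] --> c^-1.
Proof.
have cp := c_gt0; apply/cvgrPdist_le => e e0.
(* The gap differs from [1 / c] by [r1 w / c] times the gap, and the gap is at most [2 / c]. *)
have e1 : 0 < e * c ^+ 2 / 2 by rewrite divr_gt0// mulr_gt0// exprn_gt0.
have [x1 [_ hx1]] := near_pinfty_from 0 (r1_small e1).
have c3 : 0 < 2 / (3 * c) by rewrite divr_gt0// mulr_gt0.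
near=> i.
have yi : x1 <= y i.
  apply: le_trans (level_lower i); have y0 := y_ge 0%N; have x01 := x0_ge1.
  have : x1 / (2 / (3 * c)) <= i%:R by near: i; exact: nbhs_infty_ger.
  by rewrite ler_pdivrMr//; lra.
have [w /andP[yw _]] := mean_value DA (y_ge i) (ltW (level_gap_gt0 i)).
rewrite A_gap => e2; have /andP[_ g2] := level_gap i.
have g0 : 0 < y i.+1 - y i by rewrite subr_gt0 level_gap_gt0.
have -> : c^-1 - (y i.+1 - y i) = r1 w * (y i.+1 - y i) / c.
  have -> : r1 w * (y i.+1 - y i) = 1 - c * (y i.+1 - y i) by rewrite e2; ring.
  by field; rewrite gt_eqF.
rewrite !normrM normfV (gtr0_norm cp) (gtr0_norm g0) ler_pdivrMr//.
have r1w := hx1 w (le_trans yi yw).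
apply: le_trans (ler_pM (normr_ge0 _) (ltW g0) r1w g2) _.
by rewrite le_eqVlt; apply/orP; left; apply/eqP; field; rewrite gt_eqF.
Unshelve. all: by end_near. Qed.

Section bent.
Variables (r2 : R -> R) (s C d : R).
Hypotheses (C0 : 0 < C) (d0 : 0 < d) (s1 : s = 1 \/ s = -1).
Hypothesis Dr1 : forall x, x0 <= x -> is_derive x (1 : R) r1 (r2 x).
Hypothesis r2_nd : forall u v, x0 <= u -> u <= v -> - (s * r2 v) <= - (s * r2 u).
Hypothesis r2_bound : forall x, x0 <= x ->
  C * ln x `^ (1 + d) / x ^+ 2 <= - (s * r2 x).

Let r2_ge0 x : x0 <= x -> 0 <= - (s * r2 x).
Proof.
move=> xx; apply: le_trans (r2_bound xx).
by rewrite divr_ge0 ?sqr_ge0// mulr_ge0 ?powR_ge0// ltW// C0.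
Qed.

Let r1_decr u v : x0 <= u -> u <= v -> - (s * r2 v) * (v - u) <= s * (r1 u - r1 v).
Proof.
move=> xu uv; have [w /andP[uw wv] e] := mean_value Dr1 xu uv.
have -> : s * (r1 u - r1 v) = - (s * r2 w) * (v - u).
  by rewrite -[r1 u - _]opprB e; ring.
by rewrite ler_wpM2r ?subr_ge0// r2_nd//; exact: le_trans uw.
Qed.

Let r1_mono u v : x0 <= u -> u <= v -> 0 <= s * (r1 u - r1 v).
Proof.
move=> xu uv; apply: le_trans (r1_decr xu uv).
by rewrite mulr_ge0 ?subr_ge0// r2_ge0//; exact: le_trans uv.
Qed.

Let gap_point i : exists2 w, y i <= w <= y i.+1 & y i.+1 - y i = (c + r1 w)^-1.
Proof.
have [w wy] := mean_value DA (y_ge i) (ltW (level_gap_gt0 i)).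
rewrite A_gap => e; exists w => //.
have n0 : c + r1 w != 0.
  by apply/eqP => z; move: e; rewrite z mul0r => /eqP; rewrite oner_eq0.
by apply: (mulfI n0); rewrite -e mulfV.
Qed.

Let slope_bounds w : x0 <= w -> c / 2 <= c + r1 w <= 3 / 2 * c.
Proof. by move=> /r1_half; rewrite ler_norml => /andP[? ?]; lra. Qed.

Let gap_diff w w' : x0 <= w -> w <= w' ->
  s * (r1 w - r1 w') / (3 / 2 * c) ^+ 2 <= s * ((c + r1 w')^-1 - (c + r1 w)^-1).
Proof.
move=> xw ww'; have cp := c_gt0.
have /andP[a1 a2] := slope_bounds xw.
have /andP[b1 b2] := slope_bounds (le_trans xw ww').
have p1 : 0 < c + r1 w by lra.
have p2 : 0 < c + r1 w' by lra.
have -> : s * ((c + r1 w')^-1 - (c + r1 w)^-1) =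
    s * (r1 w - r1 w') / ((c + r1 w) * (c + r1 w')).
  by field; rewrite !gt_eqF.
rewrite ler_wpM2l ?r1_mono// lef_pV2 ?posrE ?exprn_gt0 ?mulr_gt0//.
by rewrite expr2 ler_pM// ltW.
Qed.

Lemma level_gap_mono i : 0 <= s * ((y i.+2 - y i.+1) - (y i.+1 - y i)).
Proof.
have [w /andP[w1 w2] ->] := gap_point i; have [v /andP[v1 v2] ->] := gap_point i.+1.
have xw := le_trans (y_ge i) w1; have wv := le_trans w2 v1.
apply: le_trans (gap_diff xw wv).
by rewrite divr_ge0 ?sqr_ge0// r1_mono.
Qed.

(** Each gap is [1 / (c + r1)] at some point inside it; for neighbouring gaps these points may be
    arbitrarily close. Skipping one gap separates them by at least [2 / (3 c)], so [r1] changes by a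
    definite amount. Monotonicity of [r2] then moves its argument to [B K], which makes the bound
    depend on [K] only. *)
Lemma level_gap_bent : exists C' : R, 0 < C' /\ forall k K : nat,
  (1 <= K)%N -> (k <= K)%N ->
  C' * ln K%:R `^ (1 + d) / K%:R ^+ 2 <=
    s * ((y k.+3 - y k.+2) - (y k.+1 - y k)).
Proof.
have cp := c_gt0; have Cp := C0; have dp := d0; have x01 := x0_ge1; have y0 := y_ge 0%N.
(* By [level_upper], [y (k + 2) <= y 0 + 3 K (2 / c)], which is at most [B K]. *)
pose B := 1 + y 0%N + 6 / c.
have c6 : 0 < 6 / c by rewrite divr_gt0.
have B1 : 1 <= B by rewrite /B; lra.
have c3 : 0 < 2 / (3 * c) by rewrite divr_gt0// mulr_gt0.
exists (C / B ^+ 2 * (2 / (3 * c)) / (3 / 2 * c) ^+ 2); split.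
  by rewrite !(mulr_gt0, divr_gt0, invr_gt0, exprn_gt0)//; lra.
move=> k K K1 kK.
have Kr : 1 <= K%:R :> R by rewrite ler1n.
have [w /andP[w1 w2] ->] := gap_point k; have [v /andP[v1 v2] ->] := gap_point k.+2.
have yk1 : x0 <= y k.+1 by [].
have xw := le_trans (y_ge k) w1.
have wv : w <= v by apply: (le_trans w2); apply: le_trans v1; exact/ltW/level_gap_gt0.
apply: le_trans (gap_diff xw wv).
rewrite -!mulrA [_^-1 * (ln _ `^ _ / _)]mulrC !mulrA ler_wpM2r ?invr_ge0 ?sqr_ge0//.
apply: (@le_trans _ _ (s * (r1 (y k.+1) - r1 (y k.+2)))); last first.
  have h1 := r1_mono xw w2; have h2 := r1_mono (y_ge k.+2) v1.
  by move: h1 h2; rewrite !mulrBr; lra.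
apply: le_trans (r1_decr yk1 (ltW (level_gap_gt0 _))).
have /andP[g1 _] := level_gap k.+1.
have ykB : y k.+2 <= B * K%:R.
  apply: le_trans (level_upper k.+2) _.
  have kk : k.+2%:R <= 3 * K%:R :> R by rewrite -natrM ler_nat; move: kK K1; clear; lia.
  have h1 : k.+2%:R * (2 / c) <= 3 * K%:R * (2 / c) by rewrite ler_wpM2r// divr_ge0// ltW.
  have h2 : y 0%N * 1 <= y 0%N * K%:R by rewrite ler_wpM2l//; lra.
  rewrite /B; move: h1; rewrite (_ : 3 * K%:R * (2 / c) = 6 / c * K%:R); last by field; rewrite gt_eqF.
  by rewrite !mulrDl; move: (6 / c * K%:R) (k.+2%:R * (2 / c)) => p q; lra.
have low : C * ln K%:R `^ (1 + d) / (B * K%:R) ^+ 2 <= - (s * r2 (y k.+2)).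
  apply: le_trans (r2_nd (y_ge _) ykB).
  have BK : K%:R <= B * K%:R by rewrite ler_peMl//; lra.
  have xB : x0 <= B * K%:R by apply: le_trans ykB.
  apply: le_trans (r2_bound xB); rewrite ler_wpM2r ?invr_ge0 ?sqr_ge0// ler_pM2l//.
  have lnK0 : 0 <= ln K%:R :> R by rewrite ln_ge0.
  have lnKB : ln K%:R <= ln (B * K%:R) by rewrite ler_ln// posrE; lra.
  by apply: ge0_ler_powR; rewrite ?nnegrE//; lra.
apply: (@le_trans _ _ (C * ln K%:R `^ (1 + d) / (B * K%:R) ^+ 2 * (2 / (3 * c)))).
  rewrite le_eqVlt; apply/orP; left; apply/eqP.
  by move: (ln _ `^ _) => L; field; rewrite !gt_eqF//; lra.
by apply: ler_pM => //; [rewrite divr_ge0 ?sqr_ge0// mulr_ge0 ?powR_ge0// ltW|exact: ltW].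
Qed.
End bent.
End level_points.

(** * Convergence of the averages *)

Section block_averages.
Context {R : realType} (dX : measure_display) (X : measurableType dX)
  (mu : probability X R) (T : X -> X).
Hypothesis mT : measurable_fun [set: X] T.
Hypothesis muT : forall A : set X, measurable A -> mu (T @^-1` A) = mu A.

(* The gaps of [y] drift monotonically, fast enough for the second derivative
   test to save a power of [ln K] greater than [1 / 2] in the sums up to [K]. *)
Definition bent (y : nat -> R) := exists C d s : R,
  [/\ 0 < C, 0 < d, d <= 1, s = 1 \/ s = -1 &
    (forall k, 0 <= s * ((y k.+2 - y k.+1) - (y k.+1 - y k))) /\
    (forall k K : nat, (1 <= K)%N -> (k <= K)%N ->
      C * ln K%:R `^ (1 + d) / K%:R ^+ 2 <=
        s * ((y k.+3 - y k.+2) - (y k.+1 - y k)))].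

(** The weight at level [k] involves the sawtooth at [k] and at [k + 1], both with the orbit point
    [T^k x]; hence a second application, to [y] shifted by one. The range [k <= K] in [bent] leaves
    room for that shift. *)
Lemma bent_sawtooth_ae (f : X -> R) (y : nat -> R) (nu : nat -> nat) (gam : R) :
  measurable_fun setT f -> (forall x, 0 <= f x) ->
  (\int[mu]_x ((f x) ^+ 2)%:E < +oo)%E ->
  y k.+1 - y k @[k --> \oo] --> gam -> bent y ->
  (forall k, y k <= (nu k)%:R <= y k + 1) ->
  {ae mu, forall x,
    cvgn (fun n => (\sum_(k < n) ((nu k)%:R - y k) * f (iter k T x)) / n%:R) /\
    cvgn (fun n => (\sum_(k < n) ((nu k.+1)%:R - y k.+1) * f (iter k T x)) / n%:R)}.
Proof.
move=> mf f0 if2 ygam [C [d [s [C0 d0 d1 s1 [D1 D2]]]]] ynu.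
have h1 := @sawtooth_mean_ae R dX X mu T mT muT f y gam C d s 1
  (fun k => (nu k)%:Z) mf f0 if2 ygam C0 d0 d1 s1 D1
  (fun k K K1 kK => D2 k K K1 (ltnW kK)) ynu.
have ygam1 : y k.+2 - y k.+1 @[k --> \oo] --> gam.
  by rewrite (@cvg_shiftS _ (fun k => y k.+1 - y k)).
have h2 := @sawtooth_mean_ae R dX X mu T mT muT f (fun k => y k.+1) gam C d s 1
  (fun k => (nu k.+1)%:Z) mf f0 if2 ygam1 C0 d0 d1 s1 (fun k => D1 k.+1)
  (fun k K K1 kK => D2 k.+1 K K1 kK) (fun k => ynu k.+1).
by apply: filterS2 h1 h2.
Qed.

(** In the first alternative the weights split into the deviation of the gap from [gam], the
    constant [gam] and two sawtooth terms. In the second, all weights lie on the same side of the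
    integer [m]. *)
Lemma block_average_ae (f : X -> R) (y : nat -> R) (nu : nat -> nat) (gam D : R) :
  measurable_fun setT f -> (forall x, 0 <= f x) ->
  (\int[mu]_x ((f x) ^+ 2)%:E < +oo)%E ->
  0 < gam -> y k.+1 - y k @[k --> \oo] --> gam ->
  (forall k, y k.+1 - y k <= D) ->
  (forall k, y k <= (nu k)%:R <= y k + 1) ->
  (forall k, (nu k <= nu k.+1)%N) ->
  bent y \/ (exists m : nat, gam = m%:R /\
    ((forall k, (nu k + m <= nu k.+1)%N) \/ (forall k, (nu k.+1 <= nu k + m)%N))) ->
  {ae mu, forall x (F : nat -> R),
    (forall k n, (nu k <= n < nu k.+1)%N -> F n = f (iter k T x)) ->
    cvgn (fun N => N%:R^-1 * \sum_(1 <= n < N.+1) F n)}.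
Proof.
move=> mf f0 if2 gam0 ygam yD ynu nu_nd alt.
have if1 := integral_lty_of_sqr mf f0 if2.
have hB := birkhoff mT muT mf f0 if1.
have mf2 : measurable_fun setT (fun x => f x ^+ 2) by exact: measurable_funX.
have hB2 := birkhoff mT muT mf2 (fun x => sqr_ge0 (f x)) if2.
have Dgam : (y k.+1 - y k) - gam @[k --> \oo] --> (0 : R).
  by rewrite -(subrr gam); apply: cvgB => //; exact: cvg_cst.
have one : (\sum_(k < n) (1 : R)) / n%:R @[n --> \oo] --> (1 : R).
  have : (fun=> 1 : R) @ \oo --> (1 : R) by exact: (@cvg_cst R).
  apply: cvg_trans; apply: near_eq_cvg; near=> n.
  by rewrite sumr_const card_ord divff// pnatr_eq0 -lt0n; near: n; exists 1%N.
have sum_gap n : \sum_(k < n) (y k.+1 - y k) = y n - y 0%N.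
  by rewrite -(big_mkord xpredT (fun k => y k.+1 - y k)) telescope_sumr.
have ylim : y n / n%:R @[n --> \oo] --> gam.
  have h := mean_mul_small (fun=> ler01) one Dgam.
  have : (\sum_(k < n) ((y k.+1 - y k) - gam) * 1) / n%:R + y 0%N / n%:R + gam
      @[n --> \oo] --> 0 + y 0%N * 0 + gam.
    apply: cvgD; last exact: cvg_cst.
    by apply: cvgD => //; apply: cvgM; [exact: cvg_cst|exact: invn_cvg0].
  rewrite mulr0 !add0r; apply: cvg_trans; apply: near_eq_cvg; near=> n.
  have nr : 0 < n%:R :> R by rewrite ltr0n; near: n; exists 1%N.
  under eq_bigr do rewrite mulr1.
  rewrite sumrB sum_gap sumr_const card_ord -[gam *+ n]mulr_natr.
  by field; rewrite gt_eqF.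
have nulim : (nu n)%:R / n%:R @[n --> \oo] --> gam.
  apply: (@squeeze_cvgr _ _ _ _ (fun n => y n / n%:R : R) (fun n => (y n + 1) / n%:R : R)) => //.
    apply: nearW => n; have /andP[h1 h2] := ynu n.
    by rewrite !ler_wpM2r ?invr_ge0.
  rewrite -[gam]addr0; under eq_fun do rewrite mulrDl mul1r.
  by apply: cvgD => //; exact: invn_cvg0.
have nuW k : (nu k.+1 - nu k)%:R <= D + 1.
  rewrite natrB//; have := ynu k; have := ynu k.+1; have := yD k.
  by move=> ? /andP[? ?] /andP[? ?]; lra.
have weights : {ae mu, forall x,
    cvgn (fun n => (\sum_(k < n) (nu k.+1 - nu k)%:R * f (iter k T x)) / n%:R : R)}.
  case: alt => [by_|[m [gamm alt]]].
    have := bent_sawtooth_ae mf f0 if2 ygam by_ ynu.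
    apply: filterS2 hB => x /cvg_ex[l hl] [/cvg_ex[a ha] /cvg_ex[b hb]].
    have hD := mean_mul_small (fun k => f0 (iter k T x)) hl Dgam.
    apply/cvg_ex; exists (0 + gam * l + b - a).
    rewrite (_ : (fun n => _) = (fun n =>
      (\sum_(k < n) ((y k.+1 - y k) - gam) * f (iter k T x)) / n%:R +
      gam * ((\sum_(k < n) f (iter k T x)) / n%:R) +
      (\sum_(k < n) ((nu k.+1)%:R - y k.+1) * f (iter k T x)) / n%:R -
      (\sum_(k < n) ((nu k)%:R - y k) * f (iter k T x)) / n%:R)); last first.
      apply/funext => n; rewrite mulrA mulr_sumr -!mulrDl -mulrBl; congr (_ / _).
      rewrite -!big_split/= -sumrB; apply: eq_bigr => k _.
      by rewrite natrB//; ring.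
    apply: cvgB => //; apply: cvgD => //; apply: cvgD => //.
    by apply: cvgM => //; exact: cvg_cst.
  pose e k : R := (nu k.+1)%:R - (nu k)%:R - m%:R.
  have sum_e n : \sum_(k < n) e k = (nu n)%:R - (nu 0%N)%:R - gam * n%:R.
    rewrite /e sumrB sumr_const card_ord -[m%:R *+ n]mulr_natr -gamm.
    by rewrite -(big_mkord xpredT (fun k => (nu k.+1)%:R - (nu k)%:R)) telescope_sumr.
  (* As [e] has a constant sign, the sum of absolute values telescopes, and its mean vanishes
     because [nu n / n] tends to [gam = m]. *)
  have e_small : (\sum_(k < n) `|e k|) / n%:R @[n --> \oo] --> (0 : R).
    have [sg sgE] : exists sg : R, forall k, `|e k| = sg * e k.
      case: alt => h; [exists 1|exists (-1)] => k.
        rewrite mul1r ger0_norm// /e subr_ge0 lerBrDl -natrD ler_nat; exact: h.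
      rewrite mulN1r ler0_norm// /e subr_le0 lerBlDl -natrD ler_nat; exact: h.
    under eq_fun do under eq_bigr do rewrite sgE.
    have : sg * ((nu n)%:R / n%:R - (nu 0%N)%:R / n%:R - gam) @[n --> \oo] -->
        sg * (gam - (nu 0%N)%:R * 0 - gam).
      apply: cvgM; first exact: cvg_cst.
      apply: cvgB; last exact: cvg_cst.
      by apply: cvgB => //; apply: cvgM; [exact: cvg_cst|exact: invn_cvg0].
    rewrite mulr0 subr0 subrr mulr0.
    apply: cvg_trans; apply: near_eq_cvg; near=> n.
    have nr : 0 < n%:R :> R by rewrite ltr0n; near: n; exists 1%N.
    by rewrite -mulr_sumr sum_e; field; rewrite gt_eqF.
  have e_bound k : `|e k| <= D + 1 + m%:R.
    rewrite /e -natrB//; apply: le_trans (ler_normB _ _) _.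
    by rewrite !normr_nat lerD2r.
  apply: filterS2 hB hB2 => x /cvg_ex[l hl] /cvg_ex[l2 hl2].
  have he := @mean_mul_small_density R (fun k => f (iter k T x)) _ _ _ e_bound e_small hl2.
  apply/cvg_ex; exists (0 + gam * l).
  rewrite (_ : (fun n => _) = (fun n => (\sum_(k < n) e k * f (iter k T x)) / n%:R +
      gam * ((\sum_(k < n) f (iter k T x)) / n%:R))); last first.
    apply/funext => n; rewrite mulrA mulr_sumr -!mulrDl; congr (_ / _).
    rewrite -!big_split/=; apply: eq_bigr => k _.
    by rewrite /e natrB// gamm; ring.
  by apply: cvgD => //; apply: cvgM => //; exact: cvg_cst.
apply: filterS2 hB weights => x /cvg_ex[l hl] /cvg_ex[v hv] F FE.
apply: (@block_mean_from1 R (fun k => f (iter k T x)) F nu (D + 1) gam l v) => //.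
Unshelve. all: by end_near. Qed.

Let mTn n : measurable_fun setT (iter n T).
Proof. by elim: n => [|n IH]; [exact: measurable_id|exact: measurableT_comp]. Qed.

(* [e] selects whether [B n] follows the floor or the ceiling of [A n]. *)
Lemma level_average_ae (f : X -> R) (B : nat -> X -> X) (e : bool)
    (c x0 : R) (r r1 : R -> R) :
  measurable_fun setT f -> (forall x, 0 <= f x) ->
  (\int[mu]_x ((f x) ^+ 2)%:E < +oo)%E ->
  0 < c -> 1 <= x0 ->
  (forall x, x0 <= x -> is_derive x (1 : R) r (r1 x)) ->
  (forall x, x0 <= x -> `|r1 x| <= c / 2) ->
  (forall eps : R, 0 < eps -> \forall x \near +oo, `|r1 x| <= eps) ->
  (forall n k : nat, x0 <= n%:R ->
    (let A := c * n%:R + r n%:R in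
     if e then k%:R < A <= k%:R + 1 else k%:R <= A < k%:R + 1) ->
    forall x, B n x = iter (k + e) T x) ->
  (exists (r2 : R -> R) (s C d : R), [/\ 0 < C, 0 < d, d <= 1, s = 1 \/ s = -1 &
    [/\ forall x, x0 <= x -> is_derive x (1 : R) r1 (r2 x),
        forall u v, x0 <= u -> u <= v -> - (s * r2 v) <= - (s * r2 u) &
        forall x, x0 <= x -> C * ln x `^ (1 + d) / x ^+ 2 <= - (s * r2 x)]]) \/
  (exists m : nat, c = m%:R^-1 /\
    ((forall x, x0 <= x -> r1 x <= 0) \/ (forall x, x0 <= x -> 0 <= r1 x))) ->
  {ae mu, forall x, cvgn (fun N => N%:R^-1 * \sum_(1 <= n < N.+1) f (B n x))}.
Proof.
move=> mf f0 if2 c0 x01 Dr r1_half r1_small BE alt.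
have [k0 [y hy]] := level_points c0 Dr r1_half.
have y_ge i : x0 <= y i by have [] := hy i.
have Ay i : c * y i + r (y i) = (k0 + i)%:R by have [] := hy i.
pose lt_e (u v : R) := if e then u < v else u <= v.
(* The first time past the level, strictly past it if [e] holds: a block then consists of the [n] on
   which the floor, respectively the ceiling, is constant. *)
have /choice[nu nuE] : forall i, exists m : nat, forall n : nat, (m <= n)%N = lt_e (y i) n%:R.
  move=> i; have ex : exists n : nat, lt_e (y i) n%:R.
    exists (Num.truncn (y i)).+1; rewrite /lt_e.
    by case: (e); [|apply: ltW]; exact: truncnS_gt.
  exists (ex_minn ex) => n; case: ex_minnP => m hm mmin.
  apply/idP/idP => [mn|]; last exact: mmin.
  move: hm; have : m%:R <= n%:R :> R by rewrite ler_nat.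
  by rewrite /lt_e; case: (e) => h1 h2; lra.
have lt_eW u v : lt_e u v -> u <= v by rewrite /lt_e; case: (e) => // /ltW.
have ltW_e u v : u < v -> lt_e u v by rewrite /lt_e; case: (e) => // /ltW.
have gap_gt0 := level_gap_gt0 c0 Dr r1_half y_ge Ay.
have gap := level_gap c0 Dr r1_half y_ge Ay.
have ynu k : y k <= (nu k)%:R <= y k + 1.
  have -> : y k <= (nu k)%:R by apply: lt_eW; rewrite -nuE.
  rewrite leNgt; apply/negP => h; have yk := y_ge k.
  have nu0 : (0 < nu k)%N by rewrite -(ltr0n R); lra.
  have : (nu k <= (nu k).-1)%N.
    rewrite nuE; apply: ltW_e; rewrite -subn1 natrB//; lra.
  by rewrite leqNgt ltn_predL nu0.
have nu_nd k : (nu k <= nu k.+1)%N.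
  rewrite nuE; apply: ltW_e; apply: lt_le_trans (gap_gt0 k) _.
  by have /andP[] := ynu k.+1.
(* Blocks are counted from the level [k0], and the ceiling exceeds the lower level by one; both
   offsets are moved into the function. *)
pose g := f \o iter (k0 + e) T.
have mg : measurable_fun setT g by exact: measurableT_comp.
have ig : (\int[mu]_x ((g x) ^+ 2)%:E < +oo)%E.
  have inv n : (\int[mu]_x ((f (iter n T x)) ^+ 2)%:E = \int[mu]_x ((f x) ^+ 2)%:E)%E.
    elim: n => // n IH; rewrite -[RHS]IH.
    rewrite -[RHS](integral_invariant mT muT); last 2 first.
    - by apply/measurable_EFinP; apply: measurable_funX; exact: measurableT_comp.
    - by move=> x; rewrite lee_fin sqr_ge0.
    by apply: eq_integral => x _; rewrite iterSr.
  by rewrite inv.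
have alt' : bent y \/ (exists m : nat, c^-1 = m%:R /\
    ((forall k, (nu k + m <= nu k.+1)%N) \/ (forall k, (nu k.+1 <= nu k + m)%N))).
  case: alt => [[r2 [s [C [d [C0 d0 d1 s1 [Dr1 r2_nd r2_bound]]]]]]|[m [cm rs]]].
    left; have [C' [C'0 hb]] := level_gap_bent c0 x01 Dr r1_half y_ge Ay C0 d0 Dr1 r2_nd r2_bound.
    exists C', d, s; split => //; split => // k.
    exact: (level_gap_mono c0 Dr r1_half y_ge Ay C0 Dr1 r2_nd r2_bound).
  right; exists m; split; first by rewrite cm invrK.
  have m0 : m%:R != 0 :> R.
    by apply/eqP => m0; move: c0; rewrite cm m0 invr0 ltxx.
  have diff k : exists2 w, x0 <= w & y k.+1 - y k = m%:R - m%:R * (r1 w * (y k.+1 - y k)).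
    have [w /andP[yw _] ew] := mean_value Dr (y_ge k) (ltW (gap_gt0 k)).
    exists w; first exact: le_trans (y_ge k) yw.
    have h : c * (y k.+1 - y k) + r1 w * (y k.+1 - y k) = 1.
      have := Ay k.+1; have := Ay k; rewrite addnS -[(k0 + k).+1%:R]natr1 -ew.
      by rewrite mulrBr; lra.
    have e1 : m%:R * (c * (y k.+1 - y k)) = y k.+1 - y k by rewrite mulrA cm mulfV// mul1r.
    have e2 : c * (y k.+1 - y k) = 1 - r1 w * (y k.+1 - y k) by lra.
    by rewrite -[LHS]e1 e2 mulrBr mulr1.
  (* A shift by the integer [m] commutes with rounding, so a real gap on one side of [m] gives an
     integer gap on the same side. *)
  case: rs => rs; [left|right] => k; have [w xw dk] := diff k.
    have : y k + m%:R <= y k.+1.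
      have : 0 <= m%:R * (- r1 w * (y k.+1 - y k)).
        by rewrite mulr_ge0// mulr_ge0 ?oppr_ge0 ?rs// subr_ge0 ltW.
      by rewrite mulNr mulrN; lra.
    move=> ym; have nm : (m <= nu k.+1)%N.
      have /andP[h _] := ynu k.+1; rewrite -(ler_nat R); have := y_ge k; lra.
    rewrite addnC -leq_subRL// nuE natrB//.
    have : lt_e (y k.+1) (nu k.+1)%:R by rewrite -nuE.
    by rewrite /lt_e; case: (e); lra.
  have : y k.+1 <= y k + m%:R.
    have : 0 <= m%:R * (r1 w * (y k.+1 - y k)).
      by rewrite mulr_ge0// mulr_ge0 ?rs// subr_ge0 ltW.
    by lra.
  move=> ym; rewrite nuE natrD.
  have : lt_e (y k) (nu k)%:R by rewrite -nuE.
  by rewrite /lt_e; case: (e); lra.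
have ci : 0 < c^-1 by rewrite invr_gt0.
have := @block_average_ae g y nu c^-1 (2 / c) mg (fun x => f0 _) ig ci
  (level_gap_cvg c0 x01 Dr r1_half r1_small y_ge Ay) (fun k => proj2 (andP (gap k)))
  ynu nu_nd alt'.
apply: filterS => x h; apply: h => k n /andP[]; rewrite nuE ltnNge nuE => yn /negP ny.
have xn : x0 <= n%:R by apply: le_trans (lt_eW _ _ yn).
rewrite /g /= -iterD addnAC [(k0 + k + e)%N]addnC addnC; congr f.
apply: BE => //=.
have -> : (k0 + k)%:R + 1 = c * y k.+1 + r (y k.+1) by rewrite Ay addnS natr1.
rewrite -Ay.
have lt := level_lt c0 Dr r1_half; have le := level_le c0 Dr r1_half.
move: yn ny; rewrite /lt_e; case: (e) => yn /negP; rewrite -?leNgt -?ltNge => ny.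
  by rewrite lt// yn le.
by rewrite le// yn lt.
Qed.
End block_averages.

Section hardy_averages.
Context {R : realType}.

(** Multiplication by [s] stays inside the field, so the bounds for growth to plus infinity cover
    both signs of [r]. *)
Lemma hardy_bent (H : set (R -> R)) (hH : hardy_field H) (r r1 : R -> R) (eps s : R) :
  H r -> H r1 -> (\forall x \near +oo, is_derive (x : R) (1 : R) r (r1 x)) ->
  r x / x @[x --> +oo] --> (0 : R) -> 0 < eps -> s = 1 \/ s = -1 ->
  (\forall x \near +oo, ln x `^ (2 + eps) <= s * r x) ->
  exists (r2 : R -> R) (C d x0 : R), [/\ 0 < C, 0 < d, d <= 1 &
    [/\ forall x, x0 <= x -> is_derive x (1 : R) r1 (r2 x),
        forall u v, x0 <= u -> u <= v -> - (s * r2 v) <= - (s * r2 u) &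
        forall x, x0 <= x -> C * ln x `^ (1 + d) / x ^+ 2 <= - (s * r2 x)]].
Proof.
move=> Hr Hr1 Dr r_small eps0 s1 large.
have [r2 Hr2 Dr1] := hardy_deriv hH Hr1; have [r3 Hr3 Dr2] := hardy_deriv hH Hr2.
have Hs f : H f -> H (fun x => s * f x).
  move=> Hf; case: s1 => ->; first by under eq_fun do rewrite mul1r.
  by under eq_fun do rewrite mulN1r; exact: hardy_opp.
have Ds (f df : R -> R) : (\forall x \near +oo, is_derive (x : R) (1 : R) f (df x)) ->
    \forall x \near +oo, is_derive (x : R) (1 : R) (fun y => s * f y) (s * df x).
  apply: filterS => x Df; apply: is_derive_eq.
  by rewrite /GRing.scale/=; ring.
have s_small : s * r x / x @[x --> +oo] --> (0 : R).
  rewrite -(mulr0 s); under eq_fun do rewrite -mulrA.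
  by apply: cvgM => //; exact: cvg_cst.
have [C [d [C0 d0 d1 bound]]] := second_derivative_bound hH (Hs _ Hr) (Hs _ Hr1)
  (Hs _ Hr2) (Ds _ _ Dr) (Ds _ _ Dr1) s_small eps0 large.
have nd := second_derivative_nd hH (Hs _ Hr) (Hs _ Hr1)
  (Hs _ Hr2) (Ds _ _ Dr) (Ds _ _ Dr1) s_small eps0 large (Hs _ Hr3) (Ds _ _ Dr2).
have [x0 [_ hx]] := near_pinfty_from 0 (filterI (filterI Dr1 bound) (filterI nd (Ds _ _ Dr2))).
exists r2, C, d, x0; split => //; split => [x /hx[[]]//|u v xu uv|x /hx[[]]//].
rewrite lerN2 -subr_ge0.
have [w /andP[uw _] ->] := mean_value (fun z xz => (hx z xz).2.2) xu uv.
by rewrite mulr_ge0 ?subr_ge0//; have [_ []] := hx w (le_trans xu uw).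
Qed.

Context (dX : measure_display) (X : measurableType dX) (mu : probability X R).

Lemma hardy_average_ae (T : X -> X) (f : X -> R) (B : nat -> X -> X) (e : bool)
    (c xB : R) (H : set (R -> R)) (r : R -> R) :
  measurable_fun [set: X] T ->
  (forall A : set X, measurable A -> mu (T @^-1` A) = mu A) ->
  measurable_fun setT f -> (forall x, 0 <= f x) ->
  (\int[mu]_x ((f x) ^+ 2)%:E < +oo)%E ->
  0 < c -> hardy_field H -> H r -> r x / x @[x --> +oo] --> (0 : R) ->
  (forall n k : nat, xB <= n%:R ->
    (let A := c * n%:R + r n%:R in
     if e then k%:R < A <= k%:R + 1 else k%:R <= A < k%:R + 1) ->
    forall x, B n x = iter (k + e) T x) ->
  (exists eps s : R, [/\ 0 < eps, s = 1 \/ s = -1 &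
     \forall x \near +oo, ln x `^ (2 + eps) <= s * r x]) \/
  (exists m : nat, c = m%:R^-1) ->
  {ae mu, forall x, cvgn (fun N => N%:R^-1 * \sum_(1 <= n < N.+1) f (B n x))}.
Proof.
move=> mT muT mf f0 if2 c0 hH Hr r_small BE alt.
have [r1 Hr1 Dr] := hardy_deriv hH Hr.
have r1_small := hardy_derivative_small hH Hr Hr1 Dr r_small.
have c2 : 0 < c / 2 by rewrite divr_gt0.
have [x1 [x1_ge hx1]] := near_pinfty_from (Num.max xB 1) (filterI Dr (r1_small _ c2)).
have [x0 [x01 alt0]] : exists x0 : R, x1 <= x0 /\
  ((exists (r2 : R -> R) (s C d : R), [/\ 0 < C, 0 < d, d <= 1, s = 1 \/ s = -1 &
    [/\ forall x, x0 <= x -> is_derive x (1 : R) r1 (r2 x),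
        forall u v, x0 <= u -> u <= v -> - (s * r2 v) <= - (s * r2 u) &
        forall x, x0 <= x -> C * ln x `^ (1 + d) / x ^+ 2 <= - (s * r2 x)]]) \/
  (exists m : nat, c = m%:R^-1 /\
    ((forall x, x0 <= x -> r1 x <= 0) \/ (forall x, x0 <= x -> 0 <= r1 x)))).
  case: alt => [[eps [s [eps0 s1 large]]]|[m cm]].
    have [r2 [C [d [x2 [C0 d0 d1 [h1 h2 h3]]]]]] :=
      hardy_bent hH Hr Hr1 Dr r_small eps0 s1 large.
    exists (Num.max x1 x2); rewrite le_max lexx; split => //; left.
    exists r2, s, C, d; split => //; split.
    - by move=> x; rewrite ge_max => /andP[_]; exact: h1.
    - by move=> u v; rewrite ge_max => /andP[_]; exact: h2.
    - by move=> x; rewrite ge_max => /andP[_]; exact: h3.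
  (* For [c = 1 / m] it is the eventual sign of [r1] that puts all gaps on one side of [m]. *)
  have [h|h] := hardy_le_or_lt hH Hr1 (hardy_zero hH).
    have [x0 [x01 hx0]] := near_pinfty_from x1 h.
    by exists x0; split => //; right; exists m; split => //; left.
  have [x0 [x01 hx0]] := near_pinfty_from x1 h.
  exists x0; split => //; right; exists m; split => //; right => x /hx0.
  exact: ltW.
have [xBx0 x0_ge1] : xB <= x0 /\ 1 <= x0.
  by move: x1_ge; rewrite ge_max => /andP[? ?]; split; lra.
apply: (@level_average_ae R dX X mu T mT muT f B e c x0 r r1) => //.
- by move=> x xx; have [] := hx1 x (le_trans x01 xx).
- by move=> x xx; have [] := hx1 x (le_trans x01 xx).
- by move=> n k xn; apply: BE; exact: le_trans xn.
Qed.
End hardy_averages.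

Theorem theorem1p12 (R : realType) (a r : R -> R) (c : R)
    (Ua : U a) (dec : canonical_decomposition a (c *: 'X) r) (c0 : c != 0)
    (hyp : (exists eps : R, 0 < eps /\
             ((r x / (ln x `^ (2 + eps)) @[x --> +oo] --> +oo) \/
              (r x / (ln x `^ (2 + eps)) @[x --> +oo] --> -oo)))
           \/ (exists m : int, m != 0 /\ c = 1 / m%:~R)) :
  pointwise_L2_good R (fun n => Num.floor (a n%:R)).
Proof.
move=> d X mu T Tinv f [TK TinvK mT mTinv muT] fL2.
have [ae [[H hH Hr] _ _] prec1] := dec.
have r_small : r x / x @[x --> +oo] --> (0 : R).
  have [|_] := prec1 1%N; first by rewrite coefZ coefX mulr1.
  by under eq_fun do rewrite expr1.
have muTinv A : measurable A -> mu (Tinv @^-1` A) = mu A.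
  move=> mA; rewrite -muT; last by rewrite -[X in measurable X]setTI; exact: mTinv.
  by congr (mu _); apply/seteqP; split => x /=; rewrite TK.
have mf : measurable_fun setT f by have := sub_Lfun_mfun fL2; rewrite inE.
have if2 : (\int[mu]_x ((f x) ^+ 2)%:E < +oo)%E.
  have /integrableP[_] := Lfun2_integrable_sqr fL2.
  by under eq_integral do rewrite gee0_abs ?lee_fin ?sqr_ge0//.
have growth : (exists eps s : R, [/\ 0 < eps, s = 1 \/ s = -1 &
    \forall x \near +oo, ln x `^ (2 + eps) <= s * r x]) \/
    exists m : int, m != 0 /\ c = 1 / m%:~R.
  case: hyp => [[eps [eps0 lim]]|]; [left|by right].
  have pos : \forall x \near +oo, 0 < ln x `^ (2 + eps) :> R.
    near=> x; rewrite powR_gt0// (@lt_le_trans _ _ 1)//.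
    by near: x; exact: near_ln_ge.
  case: lim => lim.
    exists eps, 1; split => //; first by left.
    move/cvgryPge : lim => /(_ 1) lim; apply: filterS2 pos lim => x px.
    by rewrite ler_pdivlMr// !mul1r.
  exists eps, (-1); split => //; first by right.
  move/cvgrNyPle : lim => /(_ (-1)) lim; apply: filterS2 pos lim => x px.
  by rewrite ler_pdivrMr// !mulN1r lerNr.
have [xa [_ ha]] := near_pinfty_from 0 ae.
have aE x : xa <= x -> a x = c * x + r x.
  by move=> /ha ->; rewrite hornerZ hornerX.
have nonneg (g : X -> R) : measurable_fun setT g -> (forall x, 0 <= g x) ->
    (\int[mu]_x ((g x) ^+ 2)%:E < +oo)%E ->
    {ae mu, forall x, cvgn (ergodic_average T Tinv (fun n => Num.floor (a n%:R)) g x)}.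
  move=> mg g0 ig2.
  have [cp|cn] := ltP 0 c.
    apply: (@hardy_average_ae R d X mu T g
      (fun n x => iterz T Tinv (Num.floor (a n%:R)) x) false c xa H r) => //.
      move=> n k xn /= ank x; rewrite addn0 (_ : Num.floor _ = k)//.
      by apply: floor_def; rewrite aE// intrD -!pmulrn.
    case: growth => [h|[m [m0 cm]]]; [by left|right; exists `|m|%N].
    have mp : 0 < m by rewrite -(ltr0z R) -invr_gt0 -[_^-1]mul1r -cm.
    by rewrite cm div1r pmulrn gez0_abs// ltW.
  have {}cn : 0 < - c by rewrite oppr_gt0 lt_neqAle c0.
  (* [floor (a n) = - (k + 1)] means [k < - a n <= k + 1]: for the inverse map the ceiling takes the
     place of the floor, whence [true] and the iterate [k + 1]. *)
  apply: (@hardy_average_ae R d X mu Tinv g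
    (fun n x => iterz T Tinv (Num.floor (a n%:R)) x) true (- c) xa H (fun x => - r x)) => //.
  - exact: hardy_opp.
  - by rewrite -oppr0; under eq_fun do rewrite mulNr; exact: cvgN.
  - move=> n k xn /= ank x; rewrite addn1 (_ : Num.floor _ = Negz k)//.
    apply: floor_def; rewrite aE// NegzE intrD mulrNz -pmulrn -natr1.
    by move: ank => /andP[? ?]; apply/andP; split; lra.
  - case: growth => [[eps [s [eps0 s1 large]]]|[m [m0 cm]]].
      left; exists eps, (- s); split => //.
        by case: s1 => ->; [right|left; rewrite opprK].
      by apply: filterS large => x; rewrite mulrNN.
    right; exists `|m|%N.
    have mn : m < 0 by rewrite -(ltrz0 R) -invr_lt0 -[_^-1]mul1r -cm -oppr_gt0.
    by rewrite cm div1r pmulrn ltz0_abs// mulrNz invrN.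
have part (g : X -> R) : measurable_fun setT g -> (forall x, 0 <= g x) ->
    (forall x, g x ^+ 2 <= f x ^+ 2) ->
    {ae mu, forall x, cvgn (ergodic_average T Tinv (fun n => Num.floor (a n%:R)) g x)}.
  move=> mg g0 gf; apply: nonneg => //; apply: le_lt_trans if2.
  apply: ge0_le_integral => //.
  - by move=> x _; rewrite lee_fin sqr_ge0.
  - by apply/measurable_EFinP; exact: measurable_funX.
  - by apply/measurable_EFinP; exact: measurable_funX.
  - by move=> x _; rewrite lee_fin.
have fp := part (fun x => Num.max (f x) 0) (measurable_maxr mf (measurable_cst _)).
have fn := part (fun x => Num.max (- f x) 0)
  (measurable_maxr (measurable_funN mf) (measurable_cst _)).
apply: filterS2 (fp _ _) (fn _ _) => [x hp hn|x|x|x|x].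
- rewrite (_ : ergodic_average _ _ _ f x = (fun N =>
    ergodic_average T Tinv (fun n => Num.floor (a n%:R)) (fun x => Num.max (f x) 0) x N -
    ergodic_average T Tinv (fun n => Num.floor (a n%:R)) (fun x => Num.max (- f x) 0) x N)).
    exact: is_cvgB.
  apply/funext => N; rewrite /ergodic_average -mulrBr -sumrB; congr (_ * _).
  apply: eq_bigr => n _; move: (f _) => y.
  by have [y0|y0] := leP 0 y; rewrite /Num.max; case: ltP; case: ltP; lra.
- by rewrite le_max lexx orbT.
- by rewrite /Num.max; case: ltP => _; [rewrite expr0n sqr_ge0|].
- by rewrite le_max lexx orbT.
- by rewrite /Num.max; case: ltP => _; [rewrite expr0n sqr_ge0|rewrite sqrrN].
Unshelve. all: by end_near. Qed.
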